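(* Let $p \in (0,1)$. Define $\{X_i\}_{i\ge1}$ by: $X_1 = 1$ with probability one, and for each $n \ge 1$, with $U_n$ uniform on $\{1,\dots,n\}$ (independent of everything else), $X_{n+1} = X_{U_n}$ with probability $p$ and $X_{n+1}=0$ with probability $1-p$ (all choices independent). Let $H_n := \sum_{i=1}^n X_i$, $a_n := \frac{\Gamma(n+p)}{\Gamma(n)\Gamma(1+p)}$ for $n\ge1$, and let $\widehat{W} := \lim_{n\to\infty} H_n/a_n$ (which exists and is positive almost surely). Let $\phi(t) := \sqrt{2t\log\log t}$. Then $$\limsup_{n\to\infty} \pm\frac{H_n - \widehat{W} a_n}{\phi(\widehat{W} a_n)} = 1 \quad \text{almost surely}$$ (for both choices of sign). *)

(* Defs.v *)
From HB Require Import structures.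
From mathcomp Require Import all_boot all_order all_algebra.
From mathcomp Require Import all_classical all_reals all_analysis.
Set Implicit Arguments. Unset Strict Implicit. Unset Printing Implicit Defensive.
Import Order.TTheory GRing.Theory Num.Theory.
Import numFieldNormedType.Exports.
Local Open Scope classical_set_scope.
Local Open Scope ring_scope.

Definition Gamma (R : realType) (s : R) : R :=
  fine (\int[@lebesgue_measure R]_(x in `]0%R, +oo[)
          ((x `^ (s - 1)) * expR (- x))%:E)%E.

Definition a_seq (R : realType) (p : R) (n : nat) : R :=
  Gamma (n%:R + p) / (Gamma n%:R * Gamma (1 + p)).

Definition phi (R : realType) (t : R) : R := Num.sqrt (2 * t * ln (ln t)).

(* Xs u b n = [:: X_1; ...; X_n] for a realisation u (of U_1, U_2, ...)
   and b (of the coins B_1, B_2, ...):  X_1 = 1 and, for n >= 1,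
   X_{n+1} = X_{u n} if b n, and 0 otherwise. *)
Fixpoint Xs (u : nat -> nat) (b : nat -> bool) (n : nat) : seq nat :=
  match n with
  | 0 => [::]
  | n'.+1 =>
      if n' is 0 then [:: 1%N]
      else let s := Xs u b n' in
           rcons s (if b n' then nth 0%N s (u n').-1 else 0%N)
  end.

Definition Hn (u : nat -> nat) (b : nat -> bool) (n : nat) : nat :=
  sumn (Xs u b n).

Definition mutually_independent (d : measure_display) (T : measurableType d)
  (R : realType) (P : probability T R) (I : eqType) (E : I -> set T) : Prop :=
  forall s : seq I, uniq s ->
    P (\bigcap_(i in [set j | j \in s]) E i) = (\prod_(i <- s) P (E i))%E.

Definition indep_UB (d : measure_display) (T : measurableType d)
  (R : realType) (P : probability T R)
  (U : nat -> T -> nat) (B : nat -> T -> bool) : Prop :=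
  forall (A : nat -> set nat) (C : nat -> set bool),
    mutually_independent P
      (fun i : nat + nat => match i with
                            | inl n => U n @^-1` A n
                            | inr n => B n @^-1` C n
                            end).

(* Main.v *)
Require Import Defs.
From HB Require Import structures.
From mathcomp Require Import all_boot all_order all_algebra.
From mathcomp Require Import all_classical all_reals all_analysis.
From mathcomp Require Import measurable_realfun lebesgue_integral_nonneg.
From mathcomp Require Import ring lra zify.
Import Order.TTheory GRing.Theory Num.Theory.
Import numFieldNormedType.Exports.
Local Open Scope classical_set_scope.
Local Open Scope ring_scope.
Set Implicit Arguments. Unset Strict Implicit. Unset Printing Implicit Defensive.

(* H is a Markov chain: given H_n = h it jumps to h + 1 with probability p h / n.
   For every integer k > - h the functions
     Gamma(h + k) / Gamma(h) * Prod_j (1 + p k / j)^-1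
   are positive martingales, so all moments of the chain are explicit, and they
   behave like exp(k^2 / (2 h)) times (h / a_n)^k.  Optimizing Markov's inequality over k,
   for both signs of k, gives Gaussian upper bounds for the deviations of
   l_n = ln (H_n / a_n) over the whole future, with a smaller variance if H is
   only allowed to grow by a factor close to 1; comparing three moments of
   orders k - s, k, k + s (Cramer's tilting) gives matching lower bounds.
   Everything is done at the first times where H reaches given levels h, since
   the bounds depend on h and not on the time.  Along levels rho^k with rho
   close to 1, Borel-Cantelli yields
     |l_m - l_n| <= (1 + o(1)) phi(H_n) / H_n   for all m >= n large,
   hence the convergence of l_n and the upper half of the theorem.  Along levels
   c^k with c large, the probability that none of the lower-bound events occurs
   from k = K_0 to K is at most Prod (1 - 1/k), which tends to 0, and the
   fluctuations after each of these events are negligible by the upper half.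
   The sequence a_n enters only through a_(n+1) = a_n (1 + p / n). *)

(** On the logarithmic scale the parameter [p] and the time disappear: from level [h] on, [ell]
    behaves like a Gaussian martingale with remaining variance [1 / h]. Hence the scale
    [phi h / h = sqrt (2 ln ln h / h)]: a deviation of [eta] times it costs [exp (- eta^2 ln ln h)],
    which along geometric levels is [k^(- eta^2)] up to a constant, critical at [eta = 1].

    The two halves are not symmetric. Markov's inequality needs the normalizing product of order [k]
    only from above, where [1 + x <= exp x] suffices at any time. The lower bound needs it from both
    sides, with an error [k^2 / n] that for [k] of order [phi h] is small only if [n] is much larger
    than [h ln ln h]; the proof asks for [h ln h <= n]. This holds eventually because [a n] is at
    most of order [n^p] with [p < 1], once [H / a] is known to be bounded, which is taken from the
    upper half.

    The limit sits at the end of the path: [ell n - lim ell] is minus a future increment, so the two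
    signs are exchanged in the passage to the limits superior. *)

Lemma ln1D_ge (R : realType) (x : R) :
  - 2^-1 <= x -> x - 2 * x ^+ 2 <= ln (1 + x).
Proof.
move=> hx.
have h1 : 0 < 1 + x by lra.
(* The bound [ln (1 + y) <= y] is used at [y = - x / (1 + x)], for which [1 + y] is the inverse of
   [1 + x]. *)
have e : 1 + - (x / (1 + x)) = (1 + x)^-1 by field; lra.
have lt1 : -1 < - (x / (1 + x)).
  by rewrite ltrN2 ltr_pdivrMr// mul1r; lra.
have := le_ln1Dx lt1; rewrite e lnV ?posrE// => h'.
have : x - 2 * x ^+ 2 <= x / (1 + x) by rewrite ler_pdivlMr//; nra.
lra.
Qed.

(** * Logarithms of factorials *)

Section LogFactorial.
Variable R : realType.

(* [lf z = ln (z - 1)!] for positive [z]; junk otherwise *)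
Definition lf (z : int) : R := ln ((`|z|%N.-1)`!%:R).

Lemma lf_succ (z : int) : 0 < z -> lf (z + 1) = lf z + ln z%:~R.
Proof.
case: z => [[|n]|n] // _.
rewrite /lf -PoszD addn1 /= factS natrM lnM ?posrE ?ltr0n ?fact_gt0// addrC.
by congr (_ + ln _).
Qed.

Lemma ln_int_le (x y : int) : 0 < x -> x <= y -> ln (x%:~R : R) <= ln y%:~R.
Proof.
move=> x0 xy; rewrite ler_ln ?posrE ?ltr0z ?ler_int//; exact: lt_le_trans xy.
Qed.

(** Tangent inequality for the log-convex Gamma function: each unit step of [lf] above [x] adds the
    logarithm of an integer at least [x], and each step below [x] removes the logarithm of a smaller
    integer. *)
Lemma lf_convex (x y : int) : 0 < x -> 0 < y ->
  (y - x)%:~R * ln x%:~R <= lf y - lf x.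
Proof.
move=> x0 y0; have [xy|xy] := leP x y.
  have [s ->] : exists s : nat, y = x + s%:Z.
    by exists `|y - x|%N; lia.
  elim: s => [|s IH]; first by rewrite addr0 !subrr mul0r.
  have -> : x + s.+1%:Z = (x + s%:Z) + 1 by lia.
  rewrite lf_succ; last lia.
  have := @ln_int_le x (x + s%:Z) x0 ltac:(lia).
  move: IH; have -> : x + s%:Z - x = s%:Z by lia.
  have -> : x + s%:Z + 1 - x = s%:Z + 1 by lia.
  rewrite [(s%:Z + 1)%:~R]intrD mulrDl mul1r; lra.
have [s ys] : exists s : nat, x = y + s%:Z.
  by exists `|x - y|%N; lia.
have -> : y - x = - s%:Z by lia.
rewrite {}ys in x0 *; clear xy x.
elim: s x0 => [|s IH] x0; first by rewrite addr0 mul0r subrr.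
have -> : y + s.+1%:Z = (y + s%:Z) + 1 by lia.
rewrite lf_succ; last lia.
have l1 := @ln_int_le (y + s%:Z) (y + s%:Z + 1) ltac:(lia) ltac:(lia).
have := IH ltac:(lia).
have -> : - s.+1%:Z = - s%:Z - 1 by lia.
rewrite [(- s%:Z - 1)%:~R]intrD mulrDl mulN1r.
have : - s%:~R * ln ((y + s)%:~R + 1) <= - (s%:~R : R) * ln ((y + s)%:~R).
  rewrite ler_wnM2l// ?oppr_le0 ?ler0z//.
  by move: l1; rewrite [(_ + 1)%:~R]intrD.
move: l1; rewrite ![(_ + 1)%:~R]intrD !intrN; lra.
Qed.

(** Second-order expansion of [ln (Gamma (h + k) / Gamma h)]. The increment [ln (h + j)] is compared
    with [ln h + (2 j + 1) / (2 h)] and not with [ln h + j / h], because [2 j + 1] telescopes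
    exactly to [k^2]. *)
Lemma lf_approx (h : nat) (k : int) : (0 < h)%N -> (`|k| *+ 2 <= h%:Z) ->
  `|lf (h%:Z + k) - lf h - k%:~R * ln h%:R - k%:~R ^+ 2 / (2 * h%:R)|
    <= `|k%:~R| / h%:R + 2 * (`|k%:~R| ^+ 3 / h%:R ^+ 2).
Proof.
move=> h0.
have hR : 0 < h%:R :> R by rewrite ltr0n.
have step (j : int) : `|j| *+ 2 <= h%:Z ->
   `|ln (h%:Z + j)%:~R - ln h%:R - (2 * j%:~R + 1) / (2 * h%:R)|
     <= 1 / h%:R + 2 * (`|j%:~R| ^+ 2 / h%:R ^+ 2) :> R.
  move=> jh; set x : R := j%:~R / h%:R.
  have x2 : - 2^-1 <= x.
    rewrite /x ler_pdivlMr//.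
    have : ((- h%:Z)%:~R : R) <= (j *+ 2)%:~R by rewrite ler_int; lia.
    rewrite rmorphMn/= intrN; lra.
  have -> : (h%:Z + j)%:~R = h%:R * (1 + x) :> R by rewrite intrD /x; field; lra.
  rewrite lnM ?posrE//; last lra.
  have -> : (2 * j%:~R + 1) / (2 * h%:R) = x + 1 / h%:R / 2 by rewrite /x; field; lra.
  have -> : `|j%:~R| ^+ 2 / h%:R ^+ 2 = x ^+ 2.
    by rewrite real_normK ?num_real// /x; field; lra.
  have := ln1D_ge x2; have := le_ln1Dx (_ : -1 < x).
  have : 0 < 1 / h%:R :> R by rewrite divr_gt0.
  set u := 1 / h%:R; set v := ln (1 + x) => u0 /(_ ltac:(lra)) v1 v2.
  rewrite ler_norml; apply/andP; split; nra.
(* Adds one increment to the error; the cubic term absorbs it since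
   [s^3 + (s + 1)^2 <= (s + 1)^3]. *)
have mon (s : nat) (u v : R) : 0 <= u -> 0 <= v ->
    u <= s%:R / h%:R + 2 * (s%:R ^+ 3 / h%:R ^+ 2) ->
    v <= 1 / h%:R + 2 * (s.+1%:R ^+ 2 / h%:R ^+ 2) ->
    u + v <= s.+1%:R / h%:R + 2 * (s.+1%:R ^+ 3 / h%:R ^+ 2).
  move=> u0 v0 hu hv; apply: le_trans (lerD hu hv) _.
  have := ler0n R s; rewrite -[s.+1%:R]natr1.
  set a := s%:R; move: a => a a0.
  have -> : (a + 1) / h%:R = a / h%:R + 1 / h%:R by field; lra.
  have : (a ^+ 3 + (a + 1) ^+ 2) / h%:R ^+ 2 <= (a + 1) ^+ 3 / h%:R ^+ 2.
    by rewrite ler_pM2r ?invr_gt0 ?exprn_gt0//; nra.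
  lra.
have key (s : nat) (e : bool) : (s *+ 2)%:Z <= h%:Z ->
  let k := if e then s%:Z else - s%:Z in
  `|lf (h%:Z + k) - lf h - k%:~R * ln h%:R - k%:~R ^+ 2 / (2 * h%:R)|
    <= s%:R / h%:R + 2 * (s%:R ^+ 3 / h%:R ^+ 2).
  rewrite /=; elim: s => [|s IH] hs.
    have -> : (if e then 0%N%:Z else - 0%N%:Z) = 0 by case: e.
    by rewrite addr0 subrr mulr0z expr0n !mul0r !subr0 normr0.
  have {}IH := IH ltac:(lia).
  case: e IH => IH.
  - have -> : h%:Z + s.+1%:Z = h%:Z + s%:Z + 1 by lia.
    rewrite lf_succ; last lia.
    have st := step s%:Z ltac:(lia).
    apply: le_trans (mon _ _ _ (normr_ge0 _) (normr_ge0 _) IH (_ : _ <= _)); last first.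
      apply: (le_trans st); rewrite lerD2l ler_pM2l// ler_pM2r ?invr_gt0 ?exprn_gt0//.
      by rewrite ler_pXn2r ?nnegrE// ger0_norm ?ler0z// ler_nat.
    apply: le_trans (ler_normD _ _).
    rewrite le_eqVlt; apply/predU1P; left; congr `|_|.
    have -> : s.+1%:Z = s%:Z + 1 by lia.
    by rewrite intrD; field; lra.
  - have e1 : h%:Z - s%:Z = h%:Z - s.+1%:Z + 1 by lia.
    rewrite e1 lf_succ in IH; last lia.
    have st := step (- s.+1%:Z) ltac:(lia).
    rewrite -normrN in st.
    apply: le_trans (mon _ _ _ (normr_ge0 _) (normr_ge0 _) IH (_ : _ <= _)); last first.
      apply: (le_trans st); rewrite lerD2l ler_pM2l// ler_pM2r ?invr_gt0 ?exprn_gt0//.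
      by rewrite ler_pXn2r ?nnegrE// intrN normrN ger0_norm ?ler0z.
    apply: le_trans (ler_normD _ _).
    rewrite le_eqVlt; apply/predU1P; left; congr `|_|.
    have -> : s.+1%:Z = s%:Z + 1 by lia.
    by rewrite !intrN !intrD; field; lra.
move=> hk; have [k0|k0] := leP 0 k.
  have := key `|k|%N true ltac:(lia).
  by rewrite /= (gez0_abs k0) -intr_norm -[`|k|]abszE.
have := key `|k|%N false ltac:(lia).
have -> /= : (if false then `|k|%N%:Z else - `|k|%N%:Z) = k by lia.
by rewrite -intr_norm -[`|k|]abszE.
Qed.

End LogFactorial.

(** * The Markov chain of cluster sizes *)

Section Chain.
Variables (R : realType) (p : R).
Hypotheses (p_gt0 : 0 < p) (p_lt1 : p < 1).

Definition step (g : nat -> nat -> R) (n h : nat) : R :=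
  p * h%:R / n%:R * g n.+1 h.+1 + (1 - p * h%:R / n%:R) * g n.+1 h.

(* Probability that the chain [h -> h + 1 w.p. p h / n] started from [h] at
   time [n] meets [D] at some time in [n, n + j]. *)
Fixpoint hit (D : nat -> nat -> bool) (j n h : nat) : R :=
  if D n h then 1 else if j is j'.+1 then step (hit D j') n h else 0.

Lemma step_coef (n h : nat) : (h <= n)%N ->
  0 <= p * h%:R / n%:R /\ 0 <= 1 - p * h%:R / n%:R.
Proof.
move=> hn; split; first by rewrite divr_ge0// mulr_ge0// ltW.
have [->|n0] := posnP n; first by rewrite invr0 mulr0 subr0.
rewrite subr_ge0 ler_pdivrMr ?ltr0n// mul1r.
have : h%:R <= n%:R :> R by rewrite ler_nat.
by apply: le_trans; rewrite ler_piMl// ltW.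
Qed.

Lemma ler_step (g g' : nat -> nat -> R) (n h : nat) : (h <= n)%N ->
  g n.+1 h.+1 <= g' n.+1 h.+1 -> g n.+1 h <= g' n.+1 h ->
  step g n h <= step g' n h.
Proof.
by move=> /step_coef[c1 c2] g1 g2; apply: lerD; rewrite ler_wpM2l.
Qed.

Lemma hit_01 D j n h : (h <= n)%N -> 0 <= hit D j n h <= 1.
Proof.
elim: j n h => [|j IH] n h hn /=; case: (D n h); rewrite ?ler01 ?lexx//.
have /andP[a0 a1] := IH n.+1 h.+1 hn.
have /andP[b0 b1] := IH n.+1 h (leqW hn).
have [c1 c2] := step_coef hn; rewrite /step; apply/andP; split.
  by apply: addr_ge0; apply: mulr_ge0.
rewrite -[leRHS](addrNK (p * h%:R / n%:R)) [leRHS]addrC.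
by apply: lerD; rewrite ler_piMr.
Qed.

(** Maximal inequality for a nonnegative supermartingale dominating the indicator of [D]. Since
    neither time nor level decreases, conditions above [n0] and [h0] suffice. *)
Lemma hit_le (D : nat -> nat -> bool) (g : nat -> nat -> R) (n0 h0 : nat) :
  (forall n h, (n0 <= n)%N -> (h0 <= h <= n)%N ->
    [/\ 0 <= g n h, D n h -> 1 <= g n h & step g n h <= g n h]) ->
  forall j n h, (n0 <= n)%N -> (h0 <= h <= n)%N -> hit D j n h <= g n h.
Proof.
move=> gP; elim=> [|j IH] n h n0n /andP[h0h hn] /=;
  have [g0 gD gs] := gP n h n0n ltac:(lia).
  by case: ifP => // /gD.
case: ifP => [/gD//|_]; apply: le_trans gs.
by apply: ler_step => //; apply: IH; lia.
Qed.

(** Dual bound by a submartingale run up to the fixed time [N]. It is compared with [D] at time [N]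
    only; an earlier visit of [D] makes [hit] equal to 1, which can only help. *)
Lemma hit_ge (D : nat -> nat -> bool) (g : nat -> nat -> R) (n0 h0 N : nat)
    (C : R) : 0 <= C ->
  (forall n h, (n0 <= n < N)%N -> (h0 <= h <= n)%N -> g n h <= step g n h) ->
  (forall h, (h0 <= h <= N)%N -> g N h <= C * (D N h)%:R) ->
  forall j n h, (n + j)%N = N -> (n0 <= n)%N -> (h0 <= h <= n)%N ->
    g n h <= C * hit D j n h.
Proof.
move=> C0 gs gN; elim=> [|j IH] n h nN n0n hn /=.
  have := gN h; rewrite -nN addn0 => /(_ hn).
  by case: (D n h).
have g1 := IH n.+1 h.+1 ltac:(lia) ltac:(lia) ltac:(lia).
have g2 := IH n.+1 h ltac:(lia) ltac:(lia) ltac:(lia).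
have hn' : (h <= n)%N by lia.
apply: le_trans (gs n h ltac:(lia) hn) _.
apply: (@le_trans _ _ (C * step (hit D j) n h)).
  rewrite {2}/step mulrDr ![C * (_ * _)]mulrCA.
  exact: (@ler_step g (fun n h => C * hit D j n h)).
case: ifP => // _; apply: ler_wpM2l => //.
have /andP[] := hit_01 (fun _ _ => false) 0 hn'.
have := @ler_step (hit D j) (fun _ _ => 1) n h hn'.
have /andP[_ ->] := hit_01 D j (hn' : (h.+1 <= n.+1)%N).
have /andP[_ ->] := hit_01 D j (leqW hn').
by move=> /(_ isT isT) /le_trans + _ _; apply; rewrite /step !mulr1 addrC subrK.
Qed.

(** [Gamma (v + k) / Gamma v], the rising factorial extended to negative [k] and meaningful for
    [0 < v + k]. The exponential form makes it positive unconditionally. *)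
Definition rising (k : int) (v : nat) : R := expR (lf R (v%:Z + k) - lf R v).

Lemma rising_succ k v : (0 < v)%N -> 0 < v%:Z + k ->
  rising k v.+1 = rising k v * ((v%:R + k%:~R) / v%:R).
Proof.
move=> v0 vk; rewrite /rising.
have -> : v.+1%:Z + k = v%:Z + k + 1 by lia.
have -> : v.+1%:Z = v%:Z + 1 by lia.
rewrite !lf_succ; [|lia..].
rewrite opprD addrACA [LHS]expRD; congr (_ * _).
by rewrite expRB !lnK ?posrE ?ltr0z ?ltr0n// intrD.
Qed.

Definition beta (k : int) (n m : nat) : R :=
  \prod_(n <= j < m) (1 + p * k%:~R / j%:R).

Definition Lsum (n m : nat) : R := \sum_(n <= j < m) p / j%:R.

Lemma beta_fac_gt0 (k : int) (n j : nat) : (`|k| < n%:Z) -> (n <= j)%N ->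
  0 < 1 + p * k%:~R / j%:R.
Proof.
move=> kn nj; have j0 : 0 < j%:R :> R by rewrite ltr0n; lia.
have kj : 0 < (j%:R : R) + k%:~R.
  by rewrite -[j%:R]/(j%:Z%:~R) -intrD ltr0z; lia.
rewrite -(ltr_pM2r j0) mul0r mulrDl mul1r divfK ?gt_eqF//.
move: (j%:R : R) (k%:~R : R) j0 kj => x y x0 xy.
have [q0 q1] := conj p_gt0 p_lt1.
by have [y0|y0] := leP 0 y; nra.
Qed.

Lemma beta_gt0 (k : int) (n m : nat) : `|k| < n%:Z -> 0 < beta k n m.
Proof.
move=> kn; rewrite /beta big_nat_cond; apply: prodr_gt0 => j /andP[/andP[nj _] _].
exact: beta_fac_gt0 kn nj.
Qed.

(* The chain reweighted by [tilt k] moves from [h] to [h + 1] with probability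
   [p (h + k) / (n + p k)]: it behaves as if [k] individuals had been added. *)
Definition tilt (k : int) (n m v : nat) : R := rising k v / beta k n m.

Lemma tilt_gt0 k n m v : `|k| < n%:Z -> 0 < tilt k n m v.
Proof. by move=> kn; rewrite divr_gt0 ?expR_gt0 ?beta_gt0. Qed.

(** A jump multiplies [rising k] by [(v + k) / v], so the mean over one step multiplies it by
    [1 + (p v / m) (k / v) = 1 + p k / m], a factor free of [v] that [beta] divides out. *)
Lemma tilt_harmonic k n m v : `|k| < n%:Z -> (n <= m)%N -> (0 < v)%N ->
  0 < v%:Z + k -> step (tilt k n) m v = tilt k n m v.
Proof.
move=> kn nm v0 vk; rewrite /step /tilt rising_succ// /beta big_nat_recr//=.
rewrite -/(beta k n m).
have b0 := beta_gt0 m kn; have f0 := beta_fac_gt0 kn nm.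
have m0 : m%:R != 0 :> R by rewrite pnatr_eq0; lia.
have v0' : v%:R != 0 :> R by rewrite pnatr_eq0; lia.
field; rewrite m0 v0' gt_eqF//= andbT.
apply: contraTneq f0 => e.
suff -> : 1 + p * k%:~R / m%:R = 0 by rewrite ltxx.
by apply: (mulIf m0); rewrite mul0r -e; field.
Qed.

Lemma beta_le (k : int) n m : `|k| < n%:Z -> beta k n m <= expR (k%:~R * Lsum n m).
Proof.
move=> kn; rewrite /beta /Lsum mulr_sumr expR_sum.
rewrite big_nat_cond [leRHS]big_nat_cond.
apply: ler_prod => j /andP[/andP[nj _] _]; rewrite ltW ?(beta_fac_gt0 kn)//=.
by rewrite mulrA [_ * p]mulrC expR_ge1Dx.
Qed.

Lemma sum_inv_sqr n m : (0 < n)%N ->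
  \sum_(n <= j < m) (j%:R ^+ 2)^-1 <= 2 / n%:R :> R.
Proof.
move=> n0; have [mn|nm] := leqP m n.
  by rewrite big_geq// divr_ge0.
have : \sum_(n <= j < m) (j%:R ^+ 2)^-1 <= 2 / n%:R - 2 / m%:R :> R.
  rewrite -[m](subnKC (ltnW nm)); move: (m - n)%N => {nm}k.
  elim: k => [|k IH]; first by rewrite addn0 big_geq// subrr.
  rewrite addnS big_nat_recr/=; last by lia.
  apply: (le_trans (lerD IH (lexx _))).
  have x0 : 1 <= (n + k)%:R :> R by rewrite ler1n; lia.
  rewrite -[(n + k).+1%:R]natr1; move: (n + k)%:R x0 => x x0.
  rewrite -addrA lerD2l.
  suff : (x ^+ 2)^-1 <= 2 / x - 2 / (x + 1) by lra.
  have -> : 2 / x - 2 / (x + 1) = (2 * x) / (x + 1) * (x ^+ 2)^-1 by field; lra.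
  rewrite ler_peMl ?invr_ge0 ?sqr_ge0// ler_pdivlMr; lra.
by move/le_trans; apply; rewrite gerBl divr_ge0.
Qed.

(** The quadratic loss of [ln1D_ge], summed over the factors with [sum_inv_sqr], gives
    [4 k^2 / n]. *)
Lemma beta_ge (k : int) n m : (0 < n)%N -> `|k| *+ 2 <= n%:Z ->
  expR (k%:~R * Lsum n m - 4 * (k%:~R ^+ 2 / n%:R)) <= beta k n m.
Proof.
move=> n0 kn.
apply: (@le_trans _ _ (expR (k%:~R * Lsum n m - 2 * k%:~R ^+ 2 *
   \sum_(n <= j < m) (j%:R ^+ 2)^-1))).
  rewrite ler_expR lerD2l lerN2.
  apply: (le_trans (ler_wpM2l _ (sum_inv_sqr m n0))).
    by rewrite mulr_ge0 ?sqr_ge0.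
  by rewrite le_eqVlt; apply/predU1P; left; field; rewrite pnatr_eq0; lia.
rewrite /beta /Lsum !mulr_sumr -sumrB expR_sum.
rewrite big_nat_cond [leRHS]big_nat_cond.
apply: ler_prod => j /andP[/andP[nj _] _]; rewrite expR_ge0/=.
have kn' : `|k| < n%:Z by lia.
have f0 := beta_fac_gt0 kn' nj.
rewrite -ler_ln ?posrE ?expR_gt0// expRK.
have j0 : 0 < j%:R :> R by rewrite ltr0n; lia.
have kj : `|k%:~R| <= j%:R / 2 :> R.
  rewrite ler_pdivlMr// mulr_natr -intr_norm -rmorphMn/=.
  by rewrite -[leRHS]/(j%:Z%:~R) ler_int; lia.
have := kj; rewrite ler_norml => /andP[k1 k2].
have [q0 q1] := conj p_gt0 p_lt1.
have xx : - 2^-1 <= p * k%:~R / j%:R.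
  rewrite ler_pdivlMr//; have [?|?] := leP 0 (k%:~R : R); nra.
apply: le_trans (ln1D_ge xx).
have -> : (p * k%:~R / j%:R) ^+ 2 = p ^+ 2 * (k%:~R ^+ 2 * (j%:R ^+ 2)^-1).
  by field; rewrite gt_eqF.
have : 0 <= k%:~R ^+ 2 * (j%:R ^+ 2)^-1 :> R.
  by rewrite mulr_ge0 ?invr_ge0 ?sqr_ge0.
have -> : p * k%:~R / j%:R = k%:~R * (p / j%:R) by field; rewrite gt_eqF.
have : p ^+ 2 <= 1 by nra.
rewrite -[2 * _ / _]mulrA; move: (k%:~R ^+ 2 / _) => u.
by move=> p1 u0; rewrite lerD2l lerN2 ler_pM2l// ler_piMl.
Qed.

End Chain.

(** * Exponential upper and lower bounds for hitting probabilities *)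

Section Deviations.
Variables (R : realType) (p : R).
Hypotheses (p_gt0 : 0 < p) (p_lt1 : p < 1).
Variable a : nat -> R.
Hypothesis a_gt0 : forall n, (0 < n)%N -> 0 < a n.
Hypothesis aS : forall n, (0 < n)%N -> a n.+1 = a n * (1 + p / n%:R).

(** Up to a constant, [a] is itself the normalizing product of order 1; this ties [Lsum] to the
    increments of [ln a]. *)
Lemma a_ratio n m : (0 < n <= m)%N -> a m = a n * beta p 1 n m.
Proof.
move=> /andP[n0 nm]; rewrite -(subnKC nm); move: (m - n)%N => {nm}k.
elim: k => [|k IH]; first by rewrite addn0 /beta big_geq// mulr1.
rewrite addnS aS ?addn_gt0 ?n0// IH /beta big_nat_recr/= ?leq_addr//.
by rewrite mulr1 mulrA.
Qed.

Lemma ln_a_ratio n m : (1 < n <= m)%N ->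
  Lsum p n m - 4 / n%:R <= ln (a m) - ln (a n) <= Lsum p n m.
Proof.
move=> /andP[n1 nm]; rewrite (@a_ratio n m); last by lia.
have b0 : 0 < beta p 1 n m by apply: beta_gt0 => //; lia.
rewrite lnM ?posrE//; last by apply: a_gt0; lia.
rewrite addrAC subrr add0r; apply/andP; split.
  rewrite -ler_expR lnK ?posrE//.
  have := @beta_ge R p p_gt0 p_lt1 1 n m ltac:(lia) ltac:(lia).
  by rewrite mul1r expr1n mul1r.
rewrite -ler_expR lnK ?posrE//.
have := @beta_le R p p_gt0 p_lt1 1 n m ltac:(lia).
by rewrite mul1r.
Qed.

Definition ell (n h : nat) : R := ln h%:R - ln (a n).

(** Error term of [lf_approx]; it is uniformly small for [k] of order [phi h], since
    [phi h ^ 3 / h ^ 2] tends to 0. *)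
Definition err (k : int) (h : nat) : R :=
  `|k%:~R| / h%:R + 2 * (`|k%:~R| ^+ 3 / h%:R ^+ 2).

Lemma err_mono (k k' : int) h : `|k| <= `|k'| -> err k h <= err k' h.
Proof.
move=> kk; have kkR : `|k%:~R| <= `|k'%:~R| :> R by rewrite -!intr_norm ler_int.
rewrite lerD// ?ler_wpM2r ?invr_ge0// ler_wpM2l// ler_wpM2r ?invr_ge0 ?sqr_ge0//.
by rewrite ler_pXn2r ?nnegrE.
Qed.

Lemma err_anti (k : int) h v : (0 < h <= v)%N -> err k v <= err k h.
Proof.
move=> /andP[h0 hv].
have h0R : 0 < h%:R :> R by rewrite ltr0n.
have v0R : 0 < v%:R :> R by rewrite ltr0n; lia.
have hvR : h%:R <= v%:R :> R by rewrite ler_nat.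
rewrite lerD//; first by rewrite ler_wpM2l// lef_pV2 ?posrE.
rewrite ler_wpM2l// ler_wpM2l ?exprn_ge0// lef_pV2 ?posrE ?exprn_gt0//.
by rewrite ler_pXn2r ?nnegrE.
Qed.

Lemma lf_lower (k : int) (h v : nat) : (0 < h <= v)%N -> `|k| *+ 2 <= h%:Z ->
  k%:~R * ln v%:R + k%:~R ^+ 2 / (2 * v%:R) - err k h
    <= lf R (v%:Z + k) - lf R v.
Proof.
move=> /andP[h0 hv] kh.
have := @lf_approx R v k ltac:(lia) ltac:(lia).
rewrite -/(err k v) ler_norml => /andP[+ _].
have := @err_anti k h v ltac:(lia); lra.
Qed.

Lemma lf_upper (k : int) (h : nat) : (0 < h)%N -> `|k| *+ 2 <= h%:Z ->
  lf R (h%:Z + k) - lf R h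
    <= k%:~R * ln h%:R + k%:~R ^+ 2 / (2 * h%:R) + err k h.
Proof.
move=> h0 kh; have := @lf_approx R h k h0 kh.
rewrite -/(err k h) ler_norml => /andP[_]; lra.
Qed.

(* Markov's inequality for the positive martingale [tilt k]. *)
Lemma hit_upper (h n : nat) (k : int) (y kappa : R) (D : nat -> nat -> bool) :
  (1 < h <= n)%N -> `|k| *+ 2 <= h%:Z -> kappa <= 1 ->
  (forall m v, (n <= m)%N -> (h <= v <= m)%N -> D m v ->
     `|k%:~R| * (y / h%:R) <= k%:~R * (ell m v - ell n h) /\
     (1 - kappa) * v%:R <= h%:R) ->
  forall j, hit p D j n h <=
    expR (kappa * k%:~R ^+ 2 / (2 * h%:R) - `|k%:~R| * (y / h%:R)
          + 2 * err k h + 4 * `|k%:~R| / h%:R).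
Proof.
move=> /andP[h1 hn] kh k1 hD j.
have h0R : 0 < h%:R :> R by rewrite ltr0n; lia.
have n0R : 0 < n%:R :> R by rewrite ltr0n; lia.
(* A lower bound on [D] for the logarithm of [tilt k n], so that [g] is at least 1 there. The term
   with [1 - kappa] is the contribution [k^2 / (2 v)] still to come when [v <= h / (1 - kappa)];
   subtracted from the initial [k^2 / (2 h)], it leaves the variance factor [kappa]. *)
pose C : R := `|k%:~R| * (y / h%:R) + k%:~R * ln h%:R
  + (1 - kappa) * k%:~R ^+ 2 / (2 * h%:R) - err k h - 4 * `|k%:~R| / h%:R.
pose g m v := tilt p k n m v * expR (- C).
apply: (@le_trans _ _ (g n h)); last first.
  rewrite /g /tilt /beta big_geq// divr1 -expRD ler_expR.
  have := @lf_upper k h ltac:(lia) kh; rewrite /C.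
  have -> : (1 - kappa) * k%:~R ^+ 2 / (2 * h%:R) =
    k%:~R ^+ 2 / (2 * h%:R) - kappa * k%:~R ^+ 2 / (2 * h%:R) by field; rewrite gt_eqF.
  lra.
apply: (@hit_le R p p_gt0 p_lt1 D g n h) => //; last by rewrite leqnn.
move=> m v nm /andP[hv vm].
have v0R : 0 < v%:R :> R by rewrite ltr0n; lia.
have kn : `|k| < n%:Z by lia.
have h0 : (0 < h)%N := ltnW h1.
have hv0 : (0 < h <= v)%N by rewrite h0.
have hvm : (h <= v <= m)%N by rewrite hv.
have nm1 : (1 < n <= m)%N by rewrite (leq_trans h1 hn).
have vk0 : 0 < v%:Z + k by clear - kh hv h0; lia.
split.
- by rewrite mulr_ge0 ?expR_ge0// ltW// tilt_gt0.
- move=> /(hD m v nm hvm)[Dy Dk].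
  rewrite /g /tilt; have b0 := beta_gt0 p_gt0 p_lt1 m kn.
  rewrite mulrAC ler_pdivlMr// mul1r -expRD.
  apply: (le_trans (beta_le p_gt0 p_lt1 m kn)); rewrite ler_expR.
  have := lf_lower hv0 kh.
  have /andP[r1 r2] := ln_a_ratio nm1.
  move: Dy; rewrite /ell => Dy.
  have c1 : (1 - kappa) * k%:~R ^+ 2 / (2 * h%:R) <= k%:~R ^+ 2 / (2 * v%:R).
    have -> : (1 - kappa) * k%:~R ^+ 2 / (2 * h%:R) =
       (k%:~R ^+ 2 / 2) * ((1 - kappa) / h%:R) by field; rewrite gt_eqF.
    have -> : k%:~R ^+ 2 / (2 * v%:R) = (k%:~R ^+ 2 / 2) * (1 / v%:R) :> R.
      by field; rewrite gt_eqF.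
    rewrite ler_wpM2l// ?divr_ge0 ?sqr_ge0//.
    by rewrite ler_pdivrMr// mulrAC ler_pdivlMr// mul1r.
  have c2 : k%:~R * (Lsum p n m - (ln (a m) - ln (a n))) <= 4 * `|k%:~R| / h%:R.
    apply: (@le_trans _ _ (`|k%:~R| * (4 / n%:R))).
      apply: le_trans (ler_norm _) _; rewrite normrM ler_wpM2l// ger0_norm; lra.
    rewrite -[4 * _ / _]mulrA [4 * (_ / _)]mulrCA ler_wpM2l// ler_wpM2l// lef_pV2 ?posrE//.
    by rewrite ler_nat.
  rewrite /C; move: Dy c1 c2; rewrite !mulrBr; lra.
- have -> : step p g m v = step p (tilt p k n) m v * expR (- C) by rewrite /step /g; ring.
  by rewrite tilt_harmonic// (leq_trans h0).
Qed.

Definition err2 (k : int) (h n : nat) : R := err k h + 4 * (k%:~R ^+ 2 / n%:R).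

Lemma err2_mono (k k' : int) h n : `|k| <= `|k'| -> err2 k h n <= err2 k' h n.
Proof.
move=> kk; have kkR : `|k%:~R| <= `|k'%:~R| :> R by rewrite -!intr_norm ler_int.
rewrite lerD ?err_mono// ler_wpM2l// ler_wpM2r ?invr_ge0//.
by rewrite -[leLHS]real_normK ?num_real// -[leRHS]real_normK ?num_real// ler_pXn2r ?nnegrE.
Qed.

(** By harmonicity of [tilt k], [rising k h * beta k n N] is the expectation of [rising k] at time
    [N] for the chain started from [h] at time [n]. *)
Lemma moment_bounds (k : int) (h n N : nat) : (0 < h <= n)%N ->
  `|k| *+ 2 <= h%:Z ->
  expR (k%:~R * (ln h%:R + Lsum p n N) + k%:~R ^+ 2 / (2 * h%:R) - err2 k h n)
    <= rising R k h * beta p k n N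
    <= expR (k%:~R * (ln h%:R + Lsum p n N) + k%:~R ^+ 2 / (2 * h%:R) + err2 k h n).
Proof.
move=> /andP[h0 hn] kh; have kn : `|k| < n%:Z by lia.
have b0 := beta_gt0 p_gt0 p_lt1 N kn.
have e0 : 0 <= 4 * (k%:~R ^+ 2 / n%:R) :> R by rewrite mulr_ge0// divr_ge0// sqr_ge0.
have bl := beta_le p_gt0 p_lt1 N kn.
have bg := @beta_ge R p p_gt0 p_lt1 k n N ltac:(lia) ltac:(lia).
have zl := @lf_lower k h h ltac:(lia) kh.
have zu := @lf_upper k h h0 kh.
rewrite /err2 mulrDr; apply/andP; split.
  apply: (@le_trans _ _ (rising R k h * expR (k%:~R * Lsum p n N - 4 * (k%:~R ^+ 2 / n%:R)))).
    by rewrite /rising -expRD ler_expR; lra.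
  by rewrite ler_pM2l// expR_gt0.
apply: (@le_trans _ _ (rising R k h * expR (k%:~R * Lsum p n N))).
  by rewrite ler_pM2l// expR_gt0.
by rewrite /rising -expRD ler_expR; lra.
Qed.

(** Raising the order by [s] gains at least the factor [(v + k)^s]. Together with [rising_subr],
    this makes a neighbouring order dominate the order [k] as soon as [ln (v + k)] leaves a
    window. *)
Lemma rising_addr (k : int) (v s : nat) : 0 < v%:Z + k ->
  rising R k v * expR (s%:R * ln (v%:Z + k)%:~R) <= rising R (k + s%:Z) v.
Proof.
move=> x0; rewrite -expRD ler_expR.
have := @lf_convex R (v%:Z + k) (v%:Z + k + s%:Z) x0 ltac:(lia).
have -> : v%:Z + k + s%:Z - (v%:Z + k) = s%:Z by lia.
rewrite [v%:Z + (k + s%:Z)]addrA; lra.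
Qed.

Lemma rising_subr (k : int) (v s : nat) : 0 < v%:Z + k - s%:Z ->
  rising R k v * expR (- s%:R * ln (v%:Z + k)%:~R) <= rising R (k - s%:Z) v.
Proof.
move=> x0; rewrite -expRD ler_expR.
have := @lf_convex R (v%:Z + k) (v%:Z + k - s%:Z) ltac:(lia) x0.
have -> : v%:Z + k - s%:Z - (v%:Z + k) = - s%:Z by lia.
rewrite [v%:Z + (k - s%:Z)]addrA intrN; lra.
Qed.

Lemma rising_le (k : int) (v : nat) : (0 < v)%N -> 0 < v%:Z + k ->
  rising R k v <= expR (k%:~R * ln (v%:Z + k)%:~R).
Proof.
move=> v0 x0; rewrite ler_expR.
have := @lf_convex R (v%:Z + k) v%:Z x0 ltac:(lia).
have -> : v%:Z - (v%:Z + k) = - k by lia.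
rewrite intrN mulNr; lra.
Qed.

(* Cramer's lower bound: tilting by the [k]-th moment moves [ln (H_N + k)] to
   [ln h + L + k / h], and the moments of orders [k + s] and [k - s] bound the
   tilted mass outside the window of half-width [s / h]. *)
Lemma hit_lower (h n N : nat) (k : int) (s : nat) (D : nat -> nat -> bool) :
  let L := Lsum p n N in
  let E := err2 (`|k| + s%:Z) h n in
  (0 < h <= n)%N -> (n <= N)%N -> (`|k| + s%:Z) *+ 2 <= h%:Z ->
  (forall v, (h <= v <= N)%N ->
     L + ln h%:R + (k%:~R - s%:R) / h%:R <= ln ((v%:Z + k)%:~R)
       <= L + ln h%:R + (k%:~R + s%:R) / h%:R -> D N v) ->
  expR (- (k%:~R ^+ 2 / 2 + `|k%:~R| * s%:R) / h%:R - E)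
    * (1 - 2 * expR (- s%:R ^+ 2 / (2 * h%:R) + 2 * E)) <= hit p D (N - n) n h.
Proof.
move=> L E /andP[h0 hn] nN ksh hD.
have h0R : 0 < h%:R :> R by rewrite ltr0n.
set lA := L + ln h%:R + (k%:~R - s%:R) / h%:R in hD.
set lB := L + ln h%:R + (k%:~R + s%:R) / h%:R in hD.
(* The endpoint of the window at which [k * x] is largest, so that [C] bounds [(v + k)^k] inside
   it. *)
pose lK := if 0 <= k then lB else lA.
pose C := expR (k%:~R * lK).
pose b k' := beta p k' n N.
(* At time [N] the factors [b] cancel the denominators of [tilt], leaving [rising k] minus two
   weighted terms of orders [k + s] and [k - s]. The first exceeds [rising k] above [lB], the second
   below [lA], so [g] can be positive only inside the window. *)
pose g m v := tilt p k n m v * b k - expR (- s%:R * lB) * b (k + s%:Z) * tilt p (k + s%:Z) n m v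
  - expR (s%:R * lA) * b (k - s%:Z) * tilt p (k - s%:Z) n m v.
have bN k' : `|k'| <= `|k| + s%:Z -> 0 < b k'.
  by move=> hk; apply: beta_gt0 => //; clear - hk ksh hn h0; lia.
have C0 : 0 < C by apply: expR_gt0.
have gs m v : (n <= m < N)%N -> (h <= v <= m)%N -> g m v <= step p g m v.
  move=> mN hv.
  rewrite le_eqVlt; apply/predU1P; left.
  have mN1 := andP mN; have hv1 := andP hv.
  have H k' : `|k'| <= `|k| + s%:Z -> step p (tilt p k' n) m v = tilt p k' n m v.
    by move=> hk; apply: tilt_harmonic => //; clear - hk ksh hn h0 mN1 hv1; lia.
  rewrite /g -[in LHS](H k) -?[in LHS](H (k + s%:Z)) -?[in LHS](H (k - s%:Z)); [|clear; lia..].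
  by rewrite /step; ring.
have gN v : (h <= v <= N)%N -> g N v <= C * (D N v)%:R.
  move=> hv.
  have hv1 := andP hv; have x0 : 0 < v%:Z + k by clear - hv1 ksh h0; lia.
  have xs0 : 0 < v%:Z + k - s%:Z by clear - hv1 ksh h0; lia.
  have Fb k' : `|k'| <= `|k| + s%:Z -> tilt p k' n N v * b k' = rising R k' v.
    by move=> hk; rewrite /tilt -/(b k') divfK// gt_eqF// bN.
  have -> : g N v = rising R k v - expR (- s%:R * lB) * rising R (k + s%:Z) v
     - expR (s%:R * lA) * rising R (k - s%:Z) v.
    by rewrite -!Fb; [rewrite /g; ring|clear; lia..].
  have Zs := @rising_addr k v s x0.
  have Zs' := @rising_subr k v s xs0.
  have Zp k' : 0 < rising R k' v by apply: expR_gt0.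
  have e1 : 0 < expR (- s%:R * lB) by apply: expR_gt0.
  have e2 : 0 < expR (s%:R * lA) by apply: expR_gt0.
  have s0 : 0 <= s%:R :> R by [].
  have t1 : 0 <= expR (- s%:R * lB) * rising R (k + s%:Z) v by rewrite mulr_ge0// ltW.
  have t2 : 0 <= expR (s%:R * lA) * rising R (k - s%:Z) v by rewrite mulr_ge0// ltW.
  have [xA|xA] := leP lA (ln (v%:Z + k)%:~R); last first.
    apply: (@le_trans _ _ 0); last by rewrite mulr_ge0// ltW.
    suff : rising R k v <= expR (s%:R * lA) * rising R (k - s%:Z) v by lra.
    apply: (@le_trans _ _ (expR (s%:R * lA) * (rising R k v * expR (- s%:R * ln (v%:Z + k)%:~R)))).
      rewrite mulrCA -expRD; apply: ler_peMr; first exact: ltW.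
      rewrite -[leLHS]expR0 ler_expR mulNr -mulrBr.
      by rewrite mulr_ge0// subr_ge0 ltW.
    by rewrite ler_pM2l.
  have [xB|xB] := leP (ln (v%:Z + k)%:~R) lB; last first.
    apply: (@le_trans _ _ 0); last by rewrite mulr_ge0// ltW.
    suff : rising R k v <= expR (- s%:R * lB) * rising R (k + s%:Z) v by lra.
    apply: (@le_trans _ _ (expR (- s%:R * lB) * (rising R k v * expR (s%:R * ln (v%:Z + k)%:~R)))).
      rewrite mulrCA -expRD; apply: ler_peMr; first exact: ltW.
      rewrite -[leLHS]expR0 ler_expR mulNr addrC -mulrBr.
      by rewrite mulr_ge0// subr_ge0 ltW.
    by rewrite ler_pM2l.
  rewrite hD ?xA ?xB// mulr1.
  apply: (@le_trans _ _ (rising R k v)); first by lra.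
  apply: (le_trans (rising_le _ x0)); first by rewrite (leq_trans h0)//; case: hv1.
  rewrite ler_expR.
  rewrite /lK; case: ifPn => [k0|].
    by rewrite ler_wpM2l// ler0z.
  by rewrite -ltNge => k0; rewrite ler_wnM2l// lerz0 ltW.
have hn' : (h <= h <= n)%N by rewrite leqnn.
have := hit_ge p_gt0 p_lt1 (ltW C0) gs gN (subnKC nN) (leqnn n) hn'.
rewrite mulrC -ler_pdivrMr//; apply: le_trans.
rewrite ler_pdivlMr//.
have Fn k' : tilt p k' n n h = rising R k' h by rewrite /tilt /beta big_geq// divr1.
rewrite /g !Fn.
pose t k' : R := k'%:~R * (ln h%:R + L) + k'%:~R ^+ 2 / (2 * h%:R).
have mb k' : `|k'| <= `|k| + s%:Z ->
    expR (t k' - E) <= rising R k' h * b k' <= expR (t k' + E).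
  move=> hk.
  have k'h : `|k'| *+ 2 <= h%:Z by clear - hk ksh; lia.
  have hn0 : (0 < h <= n)%N by rewrite h0.
  have /andP[m1 m2] := @moment_bounds k' h n N hn0 k'h.
  have ee := @err2_mono k' (`|k| + s%:Z) h n (le_trans hk (ler_norm _)).
  apply/andP; split; [apply: le_trans m1|apply: (le_trans m2)]; rewrite ler_expR /t /E /L; lra.
have /andP[m1 _] := mb k ltac:(clear; lia).
have /andP[_ m2] := mb (k + s%:Z) ltac:(clear; lia).
have /andP[_ m3] := mb (k - s%:Z) ltac:(clear; lia).
(* Completing the square: [t (k + s) - s lB] and [t (k - s) + s lA] are both equal to
   [t k - s^2 / (2 h)]. *)
set q := - s%:R ^+ 2 / (2 * h%:R).
have q2 : expR (- s%:R * lB) * b (k + s%:Z) * rising R (k + s%:Z) h <= expR (t k - E) * expR (q + 2 * E).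
  apply: (@le_trans _ _ (expR (- s%:R * lB) * expR (t (k + s%:Z) + E))).
    by rewrite -mulrA ler_pM2l ?expR_gt0// mulrC.
  rewrite -!expRD ler_expR /t /lB /q intrD.
  rewrite le_eqVlt; apply/predU1P; left; field; by rewrite gt_eqF.
have q3 : expR (s%:R * lA) * b (k - s%:Z) * rising R (k - s%:Z) h <= expR (t k - E) * expR (q + 2 * E).
  apply: (@le_trans _ _ (expR (s%:R * lA) * expR (t (k - s%:Z) + E))).
    by rewrite -mulrA ler_pM2l ?expR_gt0// mulrC.
  rewrite -!expRD ler_expR /t /lA /q intrD intrN.
  rewrite le_eqVlt; apply/predU1P; left; field; by rewrite gt_eqF.
have -> : expR (- (k%:~R ^+ 2 / 2 + `|k%:~R| * s%:R) / h%:R - E) *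
   (1 - 2 * expR (q + 2 * E)) * C = expR (t k - E) * (1 - 2 * expR (q + 2 * E)).
  rewrite mulrAC /C -expRD; congr (expR _ * _).
  rewrite /t /lK /lA /lB; case: ifPn => k0.
    by rewrite ger0_norm ?ler0z//; field; rewrite gt_eqF.
  by rewrite ler0_norm ?lerz0 ?ltW ?ltNge//; field; rewrite gt_eqF.
lra.
Qed.

End Deviations.

(** * The normalization [phi] *)

Section Asymptotics.
Variable R : realType.

Definition lam (x : R) : R := ln (ln x).

Lemma near_ge (M : R) : \forall h \near \oo, M <= (h : nat)%:R.
Proof.
exists (Num.truncn M).+1 => // h /= hM.
rewrite ltW// (lt_le_trans (truncnS_gt M))// ler_nat.
by [].
Qed.

Lemma lam_ge (M x : R) : expR (expR M) <= x -> M <= lam x.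
Proof.
move=> hx; have x0 : 0 < x := lt_le_trans (expR_gt0 _) hx.
have : expR M <= ln x by rewrite -ler_expR lnK.
by move=> l; rewrite -ler_expR lnK// posrE (lt_le_trans (expR_gt0 _) l).
Qed.

Lemma near_lam (M : R) : \forall h \near \oo, M <= lam (h : nat)%:R.
Proof. near=> h; apply: lam_ge; near: h; exact: near_ge. Unshelve. all: by end_near. Qed.

Lemma ln_gt1_lam (x : R) : 0 <= x -> 0 < lam x -> 1 < ln x.
Proof.
rewrite /lam => x0 l; rewrite ltNge; apply: contraTN l => /ln_le0.
by rewrite leNgt.
Qed.

Lemma lam_le_ln (x : R) : 1 < x -> lam x <= ln x.
Proof. by move=> x1; rewrite ltW// ln_sublinear// ln_gt0. Qed.

Lemma lam_mono (x y : R) : 1 < x -> x <= y -> lam x <= lam y.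
Proof.
move=> x1 xy; have y1 := lt_le_trans x1 xy.
by rewrite ler_ln ?posrE ?ln_gt0// ler_ln ?posrE// (lt_trans ltr01).
Qed.

Lemma sqr_phi (x : R) : 0 <= x -> 0 <= lam x -> phi x ^+ 2 = 2 * x * lam x.
Proof. by move=> x0 l0; rewrite sqr_sqrtr// !mulr_ge0. Qed.

Lemma phi_ge0 (x : R) : 0 <= phi x.
Proof. exact: sqrtr_ge0. Qed.

Lemma phi_gt0 (x : R) : 0 < x -> 0 < lam x -> 0 < phi x.
Proof. by move=> x0 l0; rewrite sqrtr_gt0 !mulr_gt0. Qed.

Lemma phi_mono (x y : R) : 1 < x -> x <= y -> 0 <= lam x -> phi x <= phi y.
Proof.
move=> x1 xy l0; have y1 := lt_le_trans x1 xy.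
rewrite ler_wsqrtr// ler_pM//; first by rewrite mulr_ge0; lra.
  by rewrite ler_pM2l.
exact: lam_mono.
Qed.

(** The fourth power is taken to beat [lam h ^ 3] in [near_lam3]. *)
Lemma expR_ge_pow4 (y : R) : 0 <= y -> (y / 4) ^+ 4 <= expR y.
Proof.
move=> y0; have -> : expR y = expR (y / 4) ^+ 4 by rewrite -expRM_natl; congr expR; field.
rewrite ler_pXn2r ?nnegrE ?expR_ge0 ?divr_ge0//.
by have := expR_ge1Dx (y / 4); lra.
Qed.

Lemma near_lam3 (e : R) : 0 < e ->
  \forall h \near \oo, lam (h : nat)%:R ^+ 3 <= e * h%:R.
Proof.
move=> e0; near=> h.
have h1 : 1 < h%:R :> R.
  by apply: (@lt_le_trans _ _ 2); [lra|near: h; exact: near_ge].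
have l0 : 0 <= lam (h%:R : R) by near: h; exact: near_lam.
have lh := lam_le_ln h1.
have : expR (256 / e) <= h%:R by near: h; exact: near_ge.
have h0 : 0 < h%:R :> R by lra.
rewrite -[in X in X -> _](lnK h0) ler_expR => le.
have := expR_ge_pow4 (le_trans l0 lh); rewrite lnK//.
set y := ln h%:R in lh le *; set l := lam _ in l0 lh *.
have y0 : 0 <= y := le_trans l0 lh.
have {}le : 256 <= e * y by rewrite mulrC -ler_pdivrMr.
have : l ^+ 3 <= y ^+ 3 by rewrite ler_pXn2r ?nnegrE.
have -> : (y / 4) ^+ 4 = y ^+ 3 * y / 256 by field.
have : 0 <= y ^+ 3 by rewrite exprn_ge0.
move: (y ^+ 3) (l ^+ 3) => u v; nra.
Unshelve. all: by end_near. Qed.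

Lemma near_phi_le (e : R) : 0 < e -> \forall h \near \oo, phi (h : nat)%:R <= e * h%:R.
Proof.
move=> e0; near=> h.
have h1 : 1 < h%:R :> R.
  by apply: (@lt_le_trans _ _ 2); [lra|near: h; exact: near_ge].
have l1 : 1 <= lam (h%:R : R) by near: h; exact: near_lam.
have l3 : lam (h%:R : R) ^+ 3 <= e ^+ 2 / 2 * h%:R.
  by near: h; apply: near_lam3; rewrite divr_gt0// exprn_gt0.
rewrite -(ler_pXn2r (n := 2))// ?nnegrE ?phi_ge0// ?mulr_ge0 ?(ltW e0)//.
rewrite sqr_phi; [|lra|lra].
have : lam (h%:R : R) <= lam h%:R ^+ 3 by move: (lam _) l1 => l; nra.
move=> /le_trans /(_ l3) ll.
have -> : (e * h%:R) ^+ 2 = 2 * h%:R * (e ^+ 2 / 2 * h%:R) by field.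
by rewrite ler_wpM2l// mulr_ge0.
Unshelve. all: by end_near. Qed.

Lemma near_phi_ge (M : R) : \forall h \near \oo, M <= phi (h : nat)%:R.
Proof.
near=> h.
have l1 : 1 <= lam (h%:R : R) by near: h; exact: near_lam.
have h1 : 1 <= h%:R :> R by near: h; exact: near_ge.
have h2 : M ^+ 2 <= h%:R :> R by near: h; exact: near_ge.
apply: le_trans (ler_norm M) _.
rewrite -(ler_pXn2r (n := 2))// ?nnegrE ?phi_ge0//.
rewrite sqr_phi; [|lra|lra].
rewrite real_normK ?num_real//; nra.
Unshelve. all: by end_near. Qed.

(** The square of the left side is [8 * lam h ^ 3 / h]. *)
Lemma near_phi3 (e : R) : 0 < e ->
  \forall h \near \oo, phi (h : nat)%:R ^+ 3 / h%:R ^+ 2 <= e.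
Proof.
move=> e0; near=> h.
have h1 : 1 < h%:R :> R.
  by apply: (@lt_le_trans _ _ 2); [lra|near: h; exact: near_ge].
have l1 : 1 <= lam (h%:R : R) by near: h; exact: near_lam.
have l3 : lam (h%:R : R) ^+ 3 <= e ^+ 2 / 8 * h%:R.
  by near: h; apply: near_lam3; rewrite divr_gt0// exprn_gt0.
rewrite ler_pdivrMr ?exprn_gt0//; last lra.
rewrite -(ler_pXn2r (n := 2))// ?nnegrE ?exprn_ge0 ?phi_ge0// ?mulr_ge0 ?(ltW e0) ?exprn_ge0//.
rewrite -exprM mulnC exprM sqr_phi; [|lra|lra].
have -> : (2 * h%:R * lam (h%:R : R)) ^+ 3 = 8 * h%:R ^+ 3 * lam h%:R ^+ 3 by ring.
have -> : (e * h%:R ^+ 2) ^+ 2 = 8 * h%:R ^+ 3 * (e ^+ 2 / 8 * h%:R) by field.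
by rewrite ler_wpM2l// mulr_ge0// exprn_ge0.
Unshelve. all: by end_near. Qed.

Lemma near_err (c e : R) : 0 <= c -> 0 < e -> \forall h \near \oo,
  forall k : int, `|k%:~R| <= c * phi (h : nat)%:R -> err R k h <= e.
Proof.
move=> c0 e0.
have e1 : 0 < e / 2 / (c + 1) by rewrite !divr_gt0//; lra.
have c3 : 0 < c ^+ 3 + 1 by rewrite ltr_pwDr// exprn_ge0.
have e2 : 0 < e / 4 / (c ^+ 3 + 1) by rewrite !divr_gt0.
near=> h => k kc.
have h0 : 0 < h%:R :> R.
  by apply: (@lt_le_trans _ _ 1); [lra|near: h; exact: near_ge].
have p1 : phi (h%:R : R) <= e / 2 / (c + 1) * h%:R by near: h; apply: near_phi_le.
have p2 : phi (h%:R : R) ^+ 3 / h%:R ^+ 2 <= e / 4 / (c ^+ 3 + 1).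
  by near: h; apply: near_phi3.
have k1 : `|k%:~R| / h%:R <= e / 2 :> R.
  rewrite ler_pdivrMr//; apply: (le_trans kc).
  apply: (@le_trans _ _ (c * (e / 2 / (c + 1) * h%:R))); first by rewrite ler_wpM2l.
  have -> : c * (e / 2 / (c + 1) * h%:R) = c / (c + 1) * (e / 2 * h%:R) by field; lra.
  apply: ler_piMl; last by rewrite ler_pdivrMr; lra.
  by rewrite mulr_ge0 ?divr_ge0 ?(ltW e0).
have k2 : 2 * (`|k%:~R| ^+ 3 / h%:R ^+ 2) <= e / 2 :> R.
  have -> : e / 2 = 2 * (e / 4) by field.
  rewrite ler_wpM2l//.
  apply: (@le_trans _ _ (c ^+ 3 * (phi h%:R ^+ 3 / h%:R ^+ 2))).
    rewrite mulrA -exprMn ler_wpM2r ?invr_ge0 ?sqr_ge0//.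
    by rewrite ler_pXn2r ?nnegrE ?mulr_ge0 ?phi_ge0.
  apply: (@le_trans _ _ (c ^+ 3 * (e / 4 / (c ^+ 3 + 1)))).
    by rewrite ler_wpM2l// exprn_ge0.
  have -> : c ^+ 3 * (e / 4 / (c ^+ 3 + 1)) = c ^+ 3 / (c ^+ 3 + 1) * (e / 4) by field; lra.
  apply: ler_piMl; first by rewrite divr_ge0 ?(ltW e0).
  by rewrite ler_pdivrMr; lra.
rewrite /err; lra.
Unshelve. all: by end_near. Qed.

End Asymptotics.

(** * Moderate deviations *)

Section LargeDeviations.
Variables (R : realType) (p : R).
Hypotheses (p_gt0 : 0 < p) (p_lt1 : p < 1).
Variable a : nat -> R.
Hypothesis a_gt0 : forall n, (0 < n)%N -> 0 < a n.
Hypothesis aS : forall n, (0 < n)%N -> a n.+1 = a n * (1 + p / n%:R).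

(* A deviation of [ell] before [H] exceeds [h / (1 - kappa)]; for [kappa = 1]
   the second conjunct is void. *)
Definition devU (s : bool) (eta kappa : R) (n h m v : nat) : bool :=
  (eta * phi h%:R / h%:R <= (-1) ^+ s * (ell a m v - ell a n h)) &&
  ((1 - kappa) * v%:R <= h%:R).

Lemma signed_nat (s : bool) (F : nat) :
  `|(-1) ^+ s * F%:Z| = F%:Z /\ ((-1) ^+ s * F%:Z)%:~R = (-1) ^+ s * F%:R :> R.
Proof.
by case: s; rewrite /= ?expr1 ?expr0 ?mul1r ?mulN1r ?normrN ?intrN; split.
Qed.

(** The exponent [kappa k^2 / (2 h) - k y / h] is least at [k = y / kappa], with value
    [- eta^2 / kappa * lam h] for [y = eta * phi h]. The gap between [gamma] and [eta^2 / kappa]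
    pays for the bounded errors, including the rounding of [k] to an integer. *)
Lemma hit_devU (eta kappa gamma : R) : 0 < eta -> 0 < kappa <= 1 ->
  gamma < eta ^+ 2 / kappa -> \forall h \near \oo, forall s n, (h <= n)%N ->
    forall j, hit p (devU s eta kappa n h) j n h <= expR (- (gamma * lam (h : nat)%:R)).
Proof.
move=> eta0 /andP[k0 k1] ge.
have ek0 : 0 < eta / kappa by rewrite divr_gt0.
have ek2 : 0 < kappa / eta / 2 by rewrite !divr_gt0.
have gap : 0 < eta ^+ 2 / kappa - gamma by rewrite subr_gt0.
near=> h => s n hn j.
have h2 : 2 <= h%:R :> R by near: h; exact: near_ge.
have h0 : 0 < h%:R :> R by lra.
(* The 5 covers the rounding loss of at most 1/2, the term [2 * err <= 2] and the term
   [4 * F / h <= 2]. *)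
have l1 : 5 / (eta ^+ 2 / kappa - gamma) <= lam (h%:R : R) by near: h; exact: near_lam.
have l0 : 0 <= lam (h%:R : R) by near: h; exact: near_lam.
have hl : 5 <= (eta ^+ 2 / kappa - gamma) * lam (h%:R : R).
  by move: l1; rewrite ler_pdivrMr// mulrC.
have ph : phi (h%:R : R) <= kappa / eta / 2 * h%:R by near: h; apply: near_phi_le.
have er : forall k : int, `|k%:~R| <= eta / kappa * phi (h%:R : R) -> err R k h <= 1.
  by near: h; apply: near_err => //; exact: ltW.
set y : R := eta * phi h%:R.
have y0 : 0 <= y by rewrite mulr_ge0 ?phi_ge0 ?ltW.
have yk0 : 0 <= y / kappa by rewrite divr_ge0 // ltW.
set F := Num.truncn (y / kappa).
have Fy : F%:R <= y / kappa :> R by rewrite truncn_le.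
have yF : y / kappa < F%:R + 1 :> R by rewrite natr1; exact: truncnS_gt.
have Fh : F%:R * 2 <= h%:R :> R.
  have : y / kappa <= h%:R / 2.
    rewrite ler_pdivrMr// /y mulrC -ler_pdivlMr//.
    by apply: (le_trans ph); rewrite le_eqVlt; apply/predU1P; left; field; rewrite gt_eqF.
  lra.
have [ka kr] := signed_nat s F.
set k : int := (-1) ^+ s * F%:Z in ka kr.
have kaR : `|k%:~R| = F%:R :> R by rewrite -intr_norm ka.
have kh : `|k| *+ 2 <= h%:Z.
  by rewrite ka -mulr_natr -(ler_int R) intrM.
have h1n : (1 < h <= n)%N by rewrite hn andbT -(ler_nat R).
have D_ok m v : (n <= m)%N -> (h <= v <= m)%N -> devU s eta kappa n h m v ->
     `|k%:~R| * (y / h%:R) <= k%:~R * (ell a m v - ell a n h) /\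
     (1 - kappa) * v%:R <= h%:R.
  move=> _ _ /andP[d1 d2]; split=> //.
  rewrite kaR kr -[leRHS]mulrA [leRHS]mulrCA; exact: ler_wpM2l.
apply: (le_trans (hit_upper p_gt0 p_lt1 a_gt0 aS h1n kh k1 D_ok j)).
rewrite ler_expR kaR.
have {}er : err R k h <= 1.
  by apply: er; rewrite kaR mulrAC.
have -> : k%:~R ^+ 2 = F%:R ^+ 2 :> R by rewrite kr exprMn sqrr_sign mul1r.
have t4 : 4 * F%:R / h%:R <= 2 :> R by rewrite ler_pdivrMr//; lra.
have y2 : y ^+ 2 / (2 * kappa * h%:R) = eta ^+ 2 / kappa * lam h%:R.
  rewrite /y exprMn sqr_phi// ?ler0n//; field.
  by rewrite !gt_eqF.
have key : kappa * F%:R ^+ 2 / (2 * h%:R) - F%:R * (y / h%:R)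
   <= - (y ^+ 2 / (2 * kappa * h%:R)) + 1 / 2.
  have [u yu] : exists u, y = kappa * (F%:R + u).
    by exists (y / kappa - F%:R); field; rewrite gt_eqF.
  have u1 : 0 <= u < 1.
    by move: Fy yF; rewrite yu mulrAC divff ?gt_eqF// mul1r; lra.
  rewrite yu.
  have -> : kappa * F%:R ^+ 2 / (2 * h%:R) - F%:R * (kappa * (F%:R + u) / h%:R)
     = - ((kappa * (F%:R + u)) ^+ 2 / (2 * kappa * h%:R)) + kappa * u ^+ 2 / h%:R / 2.
    by field; rewrite !gt_eqF.
  rewrite lerD2l ler_pM2r ?invr_gt0// ler_pdivrMr//.
  case/andP: u1 => u0 u1.
  apply: (@le_trans _ _ 1); last by lra.
  by rewrite mulr_ile1 ?exprn_ge0 ?exprn_ile1 ?(ltW k0)// ltW.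
rewrite y2 in key; lra.
Unshelve. all: by end_near. Qed.

(** Running from time [n] to [n * K] yields a logarithmic growth bounded on both sides independently
    of [n]: large for large [K], so that later fluctuations are negligible, yet bounded, so that the
    level grows by at most a fixed factor. *)
Lemma Lsum_mul_bounds (n K : nat) : (0 < n)%N -> (0 < K)%N ->
  p * ln K%:R <= Lsum p n (n * K) <= K%:R.
Proof.
move=> n0 K0; have nK : (n <= n * K)%N by rewrite leq_pmulr.
have n0R : 0 < n%:R :> R by rewrite ltr0n.
apply/andP; split.
  have H m : (n <= m)%N -> p * (ln m%:R - ln n%:R) <= Lsum p n m.
    move=> nm; rewrite -(subnKC nm); move: (m - n)%N => {nm}i.
    elim: i => [|i IH]; first by rewrite addn0 subrr mulr0 /Lsum big_geq.
    rewrite addnS /Lsum big_nat_recr ?leq_addr//=; apply: le_trans (lerD IH (lexx _)).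
    have x0 : 0 < (n + i)%:R :> R by rewrite ltr0n addn_gt0 n0.
    have -> : (n + i).+1%:R = (n + i)%:R * (1 + (n + i)%:R^-1) :> R.
      by rewrite mulrDr mulr1 mulfV ?gt_eqF// natr1.
    rewrite lnM ?posrE// ?addr_gt0 ?invr_gt0//.
    have := @le_ln1Dx R (n + i)%:R^-1.
    have : 0 < (n + i)%:R^-1 :> R by rewrite invr_gt0.
    set z := _^-1 => z0 /(_ ltac:(lra)) lz.
    have := p_gt0; rewrite -/z; nra.
  have := H _ nK; rewrite natrM lnM ?posrE ?ltr0n//.
  by rewrite addrAC subrr add0r.
rewrite /Lsum big_nat_cond.
apply: (@le_trans _ _ (\sum_(n <= i < n * K | (n <= i < n * K)%N && true) n%:R^-1)).
  apply: ler_sum => i /andP[/andP[ni _] _].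
  have i0 : 0 < i%:R :> R by rewrite ltr0n (leq_trans n0).
  apply: (@le_trans _ _ (1 / i%:R)); first by rewrite ler_pM2r ?invr_gt0// ltW.
  by rewrite mul1r lef_pV2 ?posrE// ler_nat.
rewrite -big_nat_cond sumr_const_nat -[_ *+ _]mulr_natl.
rewrite ler_pdivrMr// -natrM ler_nat mulnC; exact: leq_subr.
Qed.

(* The first conjunct makes the fluctuations of [ell] after time [m] small
   compared with those at level [h]; the second one makes the events that start
   from the levels [c ^ k] depend on disjoint stretches of the path. *)
Definition devL (s : bool) (zeta : R) (c n h m v : nat) : bool :=
  [&& h%:R <= zeta ^+ 2 * v%:R, (v < c * h)%N &
      (1 - zeta) * phi h%:R / h%:R <= (-1) ^+ s * (ell a m v - ell a n h)].

Lemma ln1D_abs (z : R) : `|z| <= 2^-1 -> `|ln (1 + z)| <= 2 * `|z|.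
Proof.
move=> hz; have := hz; rewrite ler_norml => /andP[z1 z2].
have := ln1D_ge z1; have := @le_ln1Dx R z ltac:(lra).
rewrite -[z ^+ 2]real_normK ?num_real// => l1 l2.
have n0 := normr_ge0 z; have n1 := ler_norm z; have n2 := ler_norm (- z).
rewrite normrN in n2.
have : `|z| ^+ 2 <= 2^-1 * `|z| by rewrite expr2 ler_wpM2r.
by rewrite ler_norml => n3; apply/andP; split; lra.
Qed.

(* Translates the window of [hit_lower] to the scale of [ell]. *)
Lemma window_ell (h n N v : nat) (k : int) (s : nat) (zeta : R) :
  let L := Lsum p n N in
  (1 < h <= n)%N -> (n <= N)%N -> 0 < zeta -> 32 / zeta ^+ 2 <= expR L -> 32 <= expR L ->
  `|k%:~R| <= h%:R / 8 :> R -> s%:R <= zeta / 8 * `|k%:~R| -> s%:R <= h%:R / 8 :> R ->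
  (0 < v%:Z + k) ->
  L + ln h%:R + (k%:~R - s%:R) / h%:R <= ln ((v%:Z + k)%:~R)
       <= L + ln h%:R + (k%:~R + s%:R) / h%:R ->
  [/\ h%:R <= zeta ^+ 2 * v%:R, v%:R <= 3 * expR L * h%:R &
    `|ell a N v - ell a n h - k%:~R / h%:R|
      <= (zeta / 8 + zeta ^+ 2 / 8) * `|k%:~R| / h%:R + 4 / h%:R ].
Proof.
move=> L /andP[h1 hn] nN ze0 G1 G2 kh sk sh x0 /andP[xl xu].
have h0 : 0 < h%:R :> R by rewrite ltr0n; exact: ltnW.
have n0 : 0 < n%:R :> R by rewrite ltr0n; exact: leq_trans (ltnW h1) hn.
have hnR : h%:R <= n%:R :> R by rewrite ler_nat.
set x : R := (v%:Z + k)%:~R in xl xu.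
have xvk : v%:R = x - k%:~R by rewrite /x intrD addrK.
have xR0 : 0 < x by rewrite ltr0z.
have G0 : 0 < expR L := expR_gt0 _.
set g := expR L in G1 G2 G0 *.
have := kh; rewrite ler_norml => /andP[k1 k2].
have s0 : 0 <= s%:R :> R by [].
(* As [k] and [s] are at most [h / 8] in absolute value, the window determines [v + k] up to a
   factor 2 around [expR L * h]. *)
have x_ge : g * h%:R / 2 <= x.
  have : expR (L + ln h%:R + (k%:~R - s%:R) / h%:R) <= x by rewrite -[leRHS]lnK ?posrE// ler_expR.
  apply: le_trans; rewrite !expRD lnK ?posrE// -/g ler_pM2l ?mulr_gt0//.
  have := expR_ge1Dx ((k%:~R - s%:R) / h%:R : R); apply: le_trans.
  have : - 2^-1 <= (k%:~R - s%:R) / h%:R :> R by rewrite ler_pdivlMr//; lra.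
  lra.
have x_le : x <= 2 * g * h%:R.
  have : x <= expR (L + ln h%:R + (k%:~R + s%:R) / h%:R) by rewrite -[leLHS]lnK ?posrE// ler_expR.
  move/le_trans; apply; rewrite !expRD lnK ?posrE// -/g mulrC mulrA ler_pM2r// ler_pM2r//.
  have := expR_ge1Dx (- ((k%:~R + s%:R) / h%:R) : R); rewrite expRN.
  have e0 := expR_gt0 ((k%:~R + s%:R) / h%:R : R).
  have : (k%:~R + s%:R) / h%:R <= 2^-1 :> R by rewrite ler_pdivrMr//; lra.
  set e := expR _ in e0 *; move=> q1 q2.
  have : 2^-1 <= e^-1 by lra.
  by rewrite lef_pV2 ?posrE.
have gh : 32 * h%:R <= g * h%:R by rewrite ler_pM2r.
have gz : 32 * h%:R <= zeta ^+ 2 * (g * h%:R).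
  rewrite mulrA ler_pM2r// mulrC -ler_pdivrMr ?exprn_gt0//.
have v_ge : g * h%:R / 4 <= v%:R by rewrite xvk; lra.
have v0 : 0 < v%:R :> R by lra.
have z2 : 0 < zeta ^+ 2 by rewrite exprn_gt0.
split.
- have : zeta ^+ 2 * (g * h%:R / 4) <= zeta ^+ 2 * v%:R by rewrite ler_pM2l.
  lra.
- rewrite xvk; lra.
(* [ln v - ln (v + k) = ln (1 + z)], which is negligible because [v + k] is of order [expR L * h]
   with [expR L >= 32 / zeta^2]. *)
- pose z := - k%:~R / x.
  have zx : `|z| <= zeta ^+ 2 / 16 * (`|k%:~R| / h%:R).
    rewrite /z normrM normrN normfV (gtr0_norm xR0) ler_pdivrMr//.
    have -> : zeta ^+ 2 / 16 * (`|k%:~R| / h%:R) * x = `|k%:~R| * (zeta ^+ 2 / 16 * x / h%:R).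
      by field; rewrite gt_eqF.
    rewrite ler_peMr// ler_pdivlMr// mul1r.
    have : zeta ^+ 2 * (g * h%:R / 2) <= zeta ^+ 2 * x by rewrite ler_pM2l.
    lra.
  have zx2 : `|z| <= 2^-1.
    rewrite /z normrM normrN normfV (gtr0_norm xR0) ler_pdivrMr//; lra.
  have lz := ln1D_abs zx2.
  have z1 : 0 < 1 + z by move: zx2; rewrite ler_norml => /andP[? _]; lra.
  have vz : v%:R = x * (1 + z) by rewrite xvk /z mulrDr mulr1 [x * _]mulrC divfK ?gt_eqF.
  have lnv : ln v%:R = ln x + ln (1 + z) by rewrite vz lnM ?posrE.
  have nN1 : (1 < n <= N)%N by rewrite nN (leq_trans h1 hn).
  have /andP[r1 r2] := ln_a_ratio p_gt0 p_lt1 a_gt0 aS nN1; rewrite -/L in r1 r2.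
  have nh : 4 / n%:R <= 4 / h%:R :> R by rewrite ler_wpM2l// lef_pV2 ?posrE.
  have sk' : s%:R / h%:R <= zeta / 8 * `|k%:~R| / h%:R by rewrite ler_pM2r ?invr_gt0.
  move: xl xu; rewrite mulrBl mulrDl => xl xu.
  rewrite [(zeta / 8 + _) * _]mulrDl [(_ + _) / h%:R]mulrDl /ell lnv.
  move: lz; rewrite ler_norml => /andP[lz1 lz2].
  have e4 : zeta ^+ 2 / 16 * (`|k%:~R| / h%:R) * 2 = zeta ^+ 2 / 8 * `|k%:~R| / h%:R.
    by field; rewrite gt_eqF.
  rewrite ler_norml; apply/andP; split; lra.
Qed.

(** Here [f] stands for [phi h], [r] for the absolute value of the tilt and [q] for the half-width
    of the window. Aiming at [(1 - zeta / 2) * f] leaves room both for the loss in the deviation,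
    which stays above [(1 - zeta) * f], and for the cost, which stays below
    [(1 - zeta / 2) * f^2 / 2]. The bound [100 <= zeta * f] absorbs the rounding. *)
Lemma tilt_choice (zeta f : R) : 0 < zeta <= 2^-1 -> 100 <= zeta * f ->
  exists r q : nat, [/\ r%:R <= f, q%:R <= zeta / 8 * r%:R,
    (1 - zeta) * f <= r%:R - (zeta / 8 + zeta ^+ 2 / 8) * r%:R - 4,
    zeta / 32 * f <= q%:R &
    r%:R ^+ 2 / 2 + r%:R * q%:R <= (1 - zeta / 2) * (f ^+ 2 / 2)].
Proof.
move=> /andP[z0 z1] zf.
have f0 : 0 < f by nra.
have r0 : 0 <= (1 - zeta / 2) * f by rewrite mulr_ge0//; lra.
pose r := Num.truncn ((1 - zeta / 2) * f).
have rl : r%:R <= (1 - zeta / 2) * f by rewrite truncn_le.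
have ru : (1 - zeta / 2) * f < r%:R + 1 by rewrite natr1; exact: truncnS_gt.
have q0 : 0 <= zeta / 8 * r%:R by rewrite mulr_ge0// ltW// divr_gt0.
pose q := Num.truncn (zeta / 8 * r%:R : R).
have ql : q%:R <= zeta / 8 * r%:R by rewrite truncn_le.
have qu : zeta / 8 * r%:R < q%:R + 1 by rewrite natr1; exact: truncnS_gt.
exists r, q; move: (ler0n R r) (ler0n R q) rl ru ql qu.
move: (r%:R : R) (q%:R : R) => {q0 r0 r q} x y x0 y0 xl xu yl yu.
have xf : x <= f by apply: (le_trans xl); rewrite ler_piMl//; lra.
split=> //.
- have : (zeta / 8 + zeta ^+ 2 / 8) * x <= zeta / 4 * f.
    apply: (@le_trans _ _ (zeta / 4 * x)); last by rewrite ler_wpM2l//; lra.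
    by rewrite ler_wpM2r//; nra.
  lra.
- have : zeta * (f / 2) <= zeta * x by rewrite ler_pM2l//; nra.
  lra.
- apply: (@le_trans _ _ (((1 - zeta / 2) * f) ^+ 2 * (1 / 2 + zeta / 8))).
    apply: (@le_trans _ _ (x ^+ 2 * (1 / 2 + zeta / 8))).
      have : x * y <= x * (zeta / 8 * x) by rewrite ler_wpM2l.
      lra.
    by rewrite ler_wpM2r; [|lra|rewrite ler_pXn2r// nnegrE (le_trans x0)].
  have : (1 - zeta / 2) ^+ 2 * (1 + zeta / 4) <= 1 - zeta / 2 by nra.
  move=> /(ler_wpM2r (sqr_ge0 f)); lra.
Qed.

(** The condition [h ln h <= n] enters here: [k^2] is at most of order [h * lam h], so [k^2 / n] is
    at most of order [lam h / ln h]. *)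
Lemma near_err2 : \forall h \near \oo, forall n, h%:R * ln h%:R <= n%:R :> R ->
  forall k : int, `|k%:~R| <= 2 * phi (h%:R : R) -> err2 R k h n <= 1 / 8.
Proof.
near=> h => n good k hk.
have h1 : 1 <= h%:R :> R by near: h; exact: near_ge.
(* Since [ln h = exp (lam h) >= 1 + lam h ^ 2 / 2], this threshold gives [8 * 64 * lam h <= ln h],
   which is what [4 (2 phi h)^2 <= h ln h / 16] amounts to. *)
have l0 : 1 + 16 * 64 <= lam (h%:R : R) by near: h; exact: near_lam.
have er : forall k : int, `|k%:~R| <= 2 * phi (h%:R : R) -> err R k h <= 1 / 16.
  by near: h; apply: near_err.
have := er _ hk; rewrite /err2 => {}er.
suff : 4 * (k%:~R ^+ 2 / n%:R) <= 1 / 16 :> R by lra.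
have h0 : 0 < h%:R :> R by lra.
have ln1 : 1 < ln (h%:R : R) by apply: ln_gt1_lam; lra.
have n0 : 0 < n%:R :> R by apply: lt_le_trans good; rewrite mulr_gt0//; lra.
rewrite mulrA ler_pdivrMr//.
apply: (@le_trans _ _ (4 * (2 * phi (h%:R : R)) ^+ 2)).
  by rewrite ler_wpM2l// -[leLHS]real_normK ?num_real// ler_pXn2r ?nnegrE ?mulr_ge0 ?phi_ge0.
apply: (@le_trans _ _ (1 / 16 * (h%:R * ln h%:R))); last by rewrite ler_wpM2l.
rewrite exprMn sqr_phi; [|lra|lra].
have : 8 * 64 * lam (h%:R : R) <= ln h%:R.
  have := @expR_ge1Dxn R (lam h%:R) 1 ltac:(lra).
  have -> : expR (lam (h%:R : R)) = ln h%:R by rewrite lnK// posrE (lt_trans ltr01).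
  rewrite (_ : 2`!%:R = 2 :> R)//.
  clear - a_gt0 aS p_gt0 p_lt1 l0; move: (lam _) l0 (ln _) => l l0 x; nra.
clear - a_gt0 aS p_gt0 p_lt1 h0; move=> /(ler_wpM2l (ltW h0)); lra.
Unshelve. all: by end_near. Qed.

(** The second factor is at least [1 / 3], hence at least [exp (- 3 / 2)]; half of the margin
    [zeta / 2 * l] pays for it and for [E]. *)
Lemma lower_exponent (zeta l rho E t : R) : 0 < zeta -> rho <= (1 - zeta / 2) * l ->
  E <= 1 / 8 -> 2 <= t -> 2 <= zeta / 4 * l ->
  expR (- ((1 - zeta / 4) * l)) <= expR (- rho - E) * (1 - 2 * expR (- t + 2 * E)).
Proof.
move=> z0 hrho hE ht hl.
have : expR (- t + 2 * E) <= expR (- (1 + 1 / 2)) by rewrite ler_expR; lra.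
move=> t1.
have t2 : expR (- (1 + 1 / 2)) <= 1 / 3 :> R.
  rewrite expRN expRD -[1 / 3]invf_div divr1 lef_pV2 ?posrE ?mulr_gt0 ?expR_gt0//.
  apply: (@le_trans _ _ ((1 + 1) * (1 + 1 / 2))); first by lra.
  apply: ler_pM; [lra|lra|exact: expR_ge1Dx|exact: expR_ge1Dx].
apply: (@le_trans _ _ (expR (- rho - E) * (1 / 3))).
  have t3 : expR (- (1 + 1 / 2)) <= 1 / 3 :> R := t2.
  apply: (@le_trans _ _ (expR (- rho - E) * expR (- (1 + 1 / 2)))); last first.
    by rewrite ler_pM2l ?expR_gt0.
  rewrite -expRD ler_expR; lra.
rewrite ler_pM2l ?expR_gt0//; lra.
Qed.

Lemma hit_devL (zeta : R) : 0 < zeta <= 2^-1 -> exists c0 : nat,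
  \forall h \near \oo, forall n, (h <= n)%N -> h%:R * ln h%:R <= n%:R :> R ->
    forall c s, (c0 <= c)%N -> exists j,
      expR (- ((1 - zeta / 4) * lam (h : nat)%:R)) <= hit p (devL s zeta c n h) j n h.
Proof.
move=> z01; have /andP[z0 z1] := z01.
have z2 : 0 < zeta ^+ 2 by rewrite exprn_gt0.
have g32 : 0 < 32 / zeta ^+ 2 by rewrite divr_gt0.
(* Chosen so that [L >= p * ln K >= ln (32 / zeta^2)], the growth that [window_ell] asks for. *)
pose K := (Num.truncn (expR (ln (32 / zeta ^+ 2) / p))).+1.
have K0 : (0 < K)%N by [].
have Kp : ln (32 / zeta ^+ 2) <= p * ln K%:R.
  rewrite [leRHS]mulrC -ler_pdivrMr// -ler_expR lnK ?posrE ?ltr0n//.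
  exact/ltW/truncnS_gt.
have G0 : 32 <= 32 / zeta ^+ 2 by rewrite ler_pdivlMr// ler_piMr//; nra.
(* As [L <= K], the level grows by a factor of at most [3 * expR K] up to time [N] on the window. *)
exists (Num.truncn (3 * expR K%:R : R)).+1.
near=> h => n hn good c s hc.
have h2 : 2 <= h%:R :> R by near: h; exact: near_ge.
have h0 : 0 < h%:R :> R by apply: lt_le_trans h2.
have l1 : 4 * (32 * 32) / zeta ^+ 2 <= lam (h%:R : R) by near: h; exact: near_lam.
have l2 : 2 / (zeta / 4) <= lam (h%:R : R) by near: h; exact: near_lam.
have ph : phi (h%:R : R) <= 1 / 16 * h%:R by near: h; apply: near_phi_le.
have ph2 : 100 / zeta <= phi (h%:R : R) by near: h; exact: near_phi_ge.
have er : forall n, h%:R * ln h%:R <= n%:R :> R ->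
  forall k : int, `|k%:~R| <= 2 * phi (h%:R : R) -> err2 R k h n <= 1 / 8.
  by near: h; exact: near_err2.
have l0 : 0 <= lam (h%:R : R).
  by apply: le_trans l2; rewrite divr_ge0// divr_ge0// ltW.
have f2 : phi h%:R ^+ 2 = 2 * h%:R * lam h%:R :> R by rewrite sqr_phi.
have zf : 100 <= zeta * phi (h%:R : R) by rewrite mulrC -ler_pdivrMr.
have [r [q [rf qr rq qf rho]]] := tilt_choice z01 zf.
have [ka kr] := signed_nat s r.
set k : int := (-1) ^+ s * r%:Z in ka kr.
have kaR : `|k%:~R| = r%:R :> R by rewrite -intr_norm ka.
have qr1 : q%:R <= r%:R :> R.
  by apply: (le_trans qr); rewrite ler_piMl//; clear - a_gt0 aS p_gt0 p_lt1 z1; lra.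
have r8 : r%:R * 8 <= h%:R :> R by clear - a_gt0 aS p_gt0 p_lt1 rf ph h0; lra.
have q8 : q%:R * 8 <= h%:R :> R by clear - a_gt0 aS p_gt0 p_lt1 qr1 r8; lra.
pose N := (n * K)%N.
have nN : (n <= N)%N by rewrite leq_pmulr.
have h1 : (1 < h)%N by rewrite -(ler_nat R).
have hn1 : (1 < h <= n)%N by rewrite h1.
have hn0 : (0 < h <= n)%N by rewrite (ltnW h1).
have n0 : (0 < n)%N := leq_trans (ltnW h1) hn.
have /andP[L1 L2] := @Lsum_mul_bounds n K n0 K0; rewrite -/N in L1 L2.
have G1 : 32 / zeta ^+ 2 <= expR (Lsum p n N).
  by rewrite -[leLHS]lnK ?posrE// ler_expR (le_trans Kp).
have G2 : 32 <= expR (Lsum p n N) := le_trans G0 G1.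
have G3 : expR (Lsum p n N) <= expR K%:R by rewrite ler_expR.
have kh : (`|k| + q%:Z) *+ 2 <= h%:Z.
  rewrite ka; move: r8 q8; rewrite -!natrM !ler_nat; clear; lia.
have khR : `|k%:~R| <= h%:R / 8 :> R by rewrite kaR ler_pdivlMr.
have qh : q%:R <= h%:R / 8 :> R by rewrite ler_pdivlMr.
have qk : q%:R <= zeta / 8 * `|k%:~R| by rewrite kaR.
exists (N - n)%N.
have D_ok v : (h <= v <= N)%N ->
   Lsum p n N + ln h%:R + (k%:~R - q%:R) / h%:R <= ln ((v%:Z + k)%:~R)
       <= Lsum p n N + ln h%:R + (k%:~R + q%:R) / h%:R -> devL s zeta c n h N v.
  move=> /andP[hv _] xx.
  have x0 : 0 < v%:Z + k by clear - kh hv h1; lia.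
  have [w1 w2 w3] := window_ell hn1 nN z0 G1 G2 khR qk qh x0 xx.
  apply/and3P; split=> //.
    rewrite -(ltr_nat R) natrM; apply: (le_lt_trans w2); rewrite ltr_pM2r//.
    apply: (@lt_le_trans _ _ ((Num.truncn (3 * expR K%:R : R)).+1%:R)); last by rewrite ler_nat.
    by apply: le_lt_trans (truncnS_gt _); rewrite ler_pM2l.
  have : `|(-1) ^+ s * (ell a N v - ell a n h - k%:~R / h%:R)| <=
     (zeta / 8 + zeta ^+ 2 / 8) * `|k%:~R| / h%:R + 4 / h%:R.
    by rewrite normrM normr_sign mul1r.
  rewrite ler_norml => /andP[w4 _].
  have ek : (-1) ^+ s * (k%:~R / h%:R) = r%:R / h%:R :> R.
    by rewrite kr -[_ * r%:R / _]mulrA signrMK.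
  move: w4; rewrite mulrBr ek kaR.
  have : (1 - zeta) * phi h%:R / h%:R <= (r%:R - (zeta / 8 + zeta ^+ 2 / 8) * r%:R - 4) / h%:R.
    by rewrite ler_pM2r ?invr_gt0.
  rewrite [in X in X -> _]mulrBl [in X in X -> _]mulrBl; clear - a_gt0 aS p_gt0 p_lt1; lra.
have := hit_lower p_gt0 p_lt1 hn0 nN kh D_ok; apply: le_trans.
have KR : `|(`|k| + q%:Z)%:~R| <= 2 * phi h%:R :> R.
  rewrite ka -PoszD -[_%:~R]/((r + q)%:R) normr_nat natrD.
  by clear - a_gt0 aS p_gt0 p_lt1 rf qr1; lra.
have E1 := er n good _ KR.
rewrite [in leRHS]mulNr [- _ ^+ 2 / _]mulNr.
apply: lower_exponent => //.
- rewrite kr exprMn sqrr_sign mul1r normrM normr_sign mul1r normr_nat.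
  rewrite ler_pdivrMr//; apply: (le_trans rho); rewrite f2.
  by have -> : 2 * h%:R * lam h%:R / 2 = lam h%:R * h%:R :> R by [field]; rewrite mulrA.
- rewrite ler_pdivlMr ?mulr_gt0//.
  apply: (@le_trans _ _ ((zeta / 32 * phi h%:R) ^+ 2)); last first.
    by rewrite ler_pXn2r ?nnegrE// mulr_ge0 ?phi_ge0// divr_ge0// ltW.
  rewrite exprMn f2.
  have : 4 * (32 * 32) <= lam h%:R * zeta ^+ 2 by rewrite -ler_pdivrMr.
  by move=> /(ler_wpM2l (ltW h0)); clear - a_gt0 aS p_gt0 p_lt1 h0; lra.
- by rewrite mulrC -ler_pdivrMr// divr_gt0.
Unshelve. all: by end_near. Qed.

End LargeDeviations.

(** * The law of the process *)

Section Realization.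
Variables (u : nat -> nat) (b : nat -> bool).

Lemma size_Xs n : size (Xs u b n) = n.
Proof. by elim: n => [|[|n] IH] //; rewrite /= size_rcons IH. Qed.

Lemma XsS n : (0 < n)%N ->
  Xs u b n.+1 = rcons (Xs u b n) (if b n then nth 0%N (Xs u b n) (u n).-1 else 0%N).
Proof. by case: n. Qed.

Lemma Xs_01 n : all (leq^~ 1%N) (Xs u b n).
Proof.
elim: n => [|[|n] IH] //; rewrite XsS// all_rcons IH andbT.
case: ifP => // _; have [lt|ge] := ltnP (u n.+1).-1 (size (Xs u b n.+1)).
  by move/allP: IH; apply; exact: mem_nth.
by rewrite nth_default.
Qed.

Lemma take_Xs m n : (m <= n)%N -> take m (Xs u b n) = Xs u b m.
Proof.
elim: n => [|n IH]; first by rewrite leqn0 => /eqP ->.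
rewrite leq_eqVlt => /predU1P[->|mn].
  by rewrite take_oversize// size_Xs.
have [n0|n0] := posnP n; first by move: mn; rewrite n0 ltnS leqn0 => /eqP ->.
by rewrite XsS// -cats1 takel_cat ?size_Xs// IH.
Qed.

Lemma HnS n : (0 < n)%N ->
  Hn u b n.+1 = (Hn u b n + (if b n then nth 0%N (Xs u b n) (u n).-1 else 0))%N.
Proof. by move=> n0; rewrite /Hn XsS// sumn_rcons. Qed.

Lemma Hn_step n : (Hn u b n <= Hn u b n.+1 <= (Hn u b n).+1)%N.
Proof.
case: n => [//|n]; rewrite (@HnS n.+1)// leq_addr/= -[leqRHS]addn1 leq_add2l.
case: ifP => // _; have [lt|ge] := ltnP (u n.+1).-1 (size (Xs u b n.+1)).
  by move/allP: (Xs_01 n.+1); apply; exact: mem_nth.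
by rewrite nth_default.
Qed.

Lemma Hn_mono m n : (m <= n)%N -> (Hn u b m <= Hn u b n)%N.
Proof.
move=> mn; rewrite -(subnKC mn); elim: (n - m)%N => [|k IH]; first by rewrite addn0.
by rewrite addnS (leq_trans IH)//; case/andP: (Hn_step (m + k)).
Qed.

Lemma Hn_le n : (Hn u b n <= n)%N.
Proof.
by elim: n => [//|n IH]; case/andP: (Hn_step n) => _ /leq_trans; apply.
Qed.

Lemma Hn_gt0 n : (0 < n)%N -> (0 < Hn u b n)%N.
Proof. by move=> n0; apply: (@Hn_mono 1). Qed.

(** Since [Hn u b 0 = 0], level 0 has no first time, and the first time of a positive level is
    positive, so the predecessor of [n] is then a genuine earlier time. *)
Definition first_time (h n : nat) : bool := (Hn u b n == h) && (Hn u b n.-1 < h)%N.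

Lemma first_time_uniq h n m : first_time h n -> first_time h m -> n = m.
Proof.
move=> /andP[/eqP n1 n2] /andP[/eqP m1 m2].
have [nm|mn|//] := ltngtP n m.
  have := @Hn_mono n m.-1 ltac:(lia); lia.
have := @Hn_mono m n.-1 ltac:(lia); lia.
Qed.

Lemma first_timeP h n : (0 < h)%N -> (h <= Hn u b n)%N ->
  exists2 m, (m <= n)%N & first_time h m.
Proof.
move=> h0; elim: n => [|n IH] hn; first by move: hn; rewrite leqn0; lia.
have [hle|hlt] := leqP h (Hn u b n).
  by have [m mn fm] := IH hle; exists m => //; exact: leqW.
exists n.+1 => //; rewrite /first_time hlt andbT eqn_leq hn andbT.
by have /andP[_] := Hn_step n; lia.
Qed.

End Realization.

(** * Independence of the past and the future choices *)

Section Law.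
Variables (d : measure_display) (T : measurableType d) (R : realType).
Variables (P : probability T R) (p : R).
Variables (U : nat -> T -> nat) (B : nat -> T -> bool).
Hypotheses (p_gt0 : 0 < p) (p_lt1 : p < 1).
Hypothesis mU : forall n k : nat, measurable (U n @^-1` [set k]).
Hypothesis mB : forall n : nat, measurable (B n @^-1` [set true]).
Hypothesis PU : forall n k : nat, (1 <= n)%N -> (1 <= k <= n)%N ->
  P (U n @^-1` [set k]) = (n%:R^-1)%:E.
Hypothesis PB : forall n : nat, (1 <= n)%N -> P (B n @^-1` [set true]) = p%:E.
Hypothesis indepUB : indep_UB P U B.

Definition Xw (w : T) := Xs (U^~ w) (B^~ w).
Definition Hw (w : T) := Hn (U^~ w) (B^~ w).

Lemma measurable_U n (A : set nat) : measurable (U n @^-1` A).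
Proof.
have -> : U n @^-1` A = \bigcup_(k in A) (U n @^-1` [set k]).
  by apply/seteqP; split=> [w Aw|w [k Ak /= ->]//]; exists (U n w).
by apply: bigcup_measurable => k _.
Qed.

Lemma measurable_B n (C : set bool) : measurable (B n @^-1` C).
Proof.
have mF : measurable (B n @^-1` [set false]).
  have -> : B n @^-1` [set false] = ~` (B n @^-1` [set true]).
    by apply/seteqP; split=> w /=; case: (B n w).
  exact: measurableC.
have -> : B n @^-1` C = \bigcup_(c in C) (B n @^-1` [set c]).
  by apply/seteqP; split=> [w Aw|w [k Ak /= ->]//]; exists (B n w).
rewrite bigcup_fset_set; last exact: finite_finset.
by apply: bigsetU_measurable => -[] _.
Qed.

Definition event (A : nat -> set nat) (C : nat -> set bool) (i : nat + nat) : set T :=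
  match i with inl n => U n @^-1` A n | inr n => B n @^-1` C n end.

Definition later (n : nat) (i : nat + nat) : bool :=
  match i with inl m => (n <= m)%N | inr m => (n <= m)%N end.

Definition rect A C (l : seq (nat + nat)) : set T :=
  \bigcap_(i in [set j | j \in l]) event A C i.

Lemma measurable_rect A C l : measurable (rect A C l).
Proof.
rewrite /rect; apply: fin_bigcap_measurable; first exact: finite_seq.
by move=> [n|n] _; [exact: measurable_U|exact: measurable_B].
Qed.

Lemma P_rect A C l : uniq l -> P (rect A C l) = (\prod_(i <- l) P (event A C i))%E.
Proof. exact: indepUB. Qed.

Definition cyl (s : seq nat) : set T := [set w | Xw w (size s) = s].

Definition last_event (s : seq nat) (x : nat) : set T :=
  [set w | (if B (size s) w then nth 0%N s (U (size s) w).-1 else 0%N) = x].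

Lemma cyl_rcons s x : (0 < size s)%N -> cyl (rcons s x) = cyl s `&` last_event s x.
Proof.
move=> s0; apply/seteqP; split=> w; rewrite /cyl /last_event/= size_rcons /Xw XsS//.
  by move=> /rcons_inj[-> <-].
by move=> [-> ->].
Qed.

Lemma last_event_split s x : last_event s x =
  (U (size s) @^-1` [set k | nth 0%N s k.-1 = x] `&` B (size s) @^-1` [set true])
  `|` (U (size s) @^-1` [set _ | x = 0%N] `&` B (size s) @^-1` [set false]).
Proof.
apply/seteqP; split=> w; rewrite /last_event /=.
  by case: (B _ w) => e; [left|right].
by case: (B _ w) => -[[e1 e2]|[e1 e2]].
Qed.

Lemma measurable_last_event s x : measurable (last_event s x).
Proof.
by rewrite last_event_split; apply: measurableU; apply: measurableI;
  (exact: measurable_U || exact: measurable_B).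
Qed.

Lemma measurable_cyl s : measurable (cyl s).
Proof.
elim/last_ind: s => [|s x IH].
  by rewrite (_ : cyl _ = setT)//; apply/seteqP; split.
have [s0|s0] := posnP (size s); last first.
  by rewrite cyl_rcons//; apply: measurableI => //; exact: measurable_last_event.
move/size0nil : s0 => ->; rewrite /cyl/=.
have [->|x1] := eqVneq x 1%N.
  by rewrite (_ : [set _ | _] = setT)//; apply/seteqP; split.
rewrite (_ : [set _ | _] = set0)//; apply/seteqP; split=> // w /= [] /esym/eqP.
by rewrite (negbTE x1).
Qed.

(** The first [n] letters depend only on choices of index below [n], while [l] lists choices of
    index at least [n]. The induction removes the last letter: its event is a disjoint union of two
    rectangles in the choices of index [n - 1], and these are moved into the rectangle of the future
    before the induction hypothesis is applied. *)
Lemma cyl_indep s A C l : (0 < size s)%N -> uniq l -> all (later (size s)) l ->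
  P (cyl s `&` rect A C l) = (P (cyl s) * P (rect A C l))%E.
Proof.
elim/last_ind: s A C l => [//|s x IH] A C l _ ul; rewrite size_rcons => all_l.
have [s0|s0] := posnP (size s).
  move/size0nil : s0 => ->; rewrite /cyl/=.
  have [->|x1] := eqVneq x 1%N.
    rewrite (_ : [set _ | _] = setT); last by apply/seteqP; split.
    by rewrite setTI probability_setT mul1e.
  rewrite (_ : [set _ | _] = set0); last first.
    by apply/seteqP; split=> // w /= [] /esym/eqP; rewrite (negbTE x1).
  by rewrite set0I measure0 mul0e.
have key A0 C0 l' : uniq l' -> all (later (size s).+1) l' -> P (cyl s `&` (U (size s) @^-1` A0 `&` B (size s) @^-1` C0) `&` rect A C l')
   = (P (cyl s) * P (U (size s) @^-1` A0 `&` B (size s) @^-1` C0) * P (rect A C l'))%E.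
  move=> ul' all_l'.
  (* The index [size s] does not occur in [l'], so overriding the sets there adds two coordinates to
     the rectangle without changing the others. *)
  pose A' m := if m == size s then A0 else A m.
  pose C' m := if m == size s then C0 else C m.
  have ev i : i \in l' -> event A' C' i = event A C i.
    move=> il; have := allP all_l' _ il; rewrite /event /A' /C'.
    by case: i {il} => m /=; case: eqP => // ->; rewrite ltnn.
  have rl : rect A' C' l' = rect A C l' by apply: eq_bigcapr => i /= /ev.
  have notin_l : (inl (size s) \notin l') /\ (inr (size s) \notin l').
    by split; apply/negP => /(allP all_l'); rewrite /= ltnn.
  have two : rect A' C' [:: inl (size s); inr (size s)] =
       U (size s) @^-1` A0 `&` B (size s) @^-1` C0.
    apply/seteqP; split=> w.
      move=> wr; split.
        by have := wr (inl (size s)); rewrite /= /A' eqxx; apply; rewrite inE eqxx.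
      by have := wr (inr (size s)); rewrite /= /C' eqxx; apply; rewrite !inE eqxx orbT.
    move=> [w1 w2] i; rewrite /= !inE => /orP[] /eqP ->.
      by rewrite /= /A' eqxx.
    by rewrite /= /C' eqxx.
  have all_two : rect A' C' (inl (size s) :: inr (size s) :: l') =
     (U (size s) @^-1` A0 `&` B (size s) @^-1` C0) `&` rect A C l'.
    rewrite -rl -two; apply/seteqP; split=> w.
      move=> wr; split=> i /= il; apply: wr => /=.
        by move: il; rewrite !inE => /orP[] ->; rewrite ?orbT.
      by rewrite !inE il !orbT.
    move=> [w1 w2] i; rewrite /= !inE orbA => /orP[il|il].
      by apply: w1; rewrite /= !inE.
    exact: w2.
  have u2 : uniq (inl (size s) :: inr (size s) :: l' : seq (nat + nat)).
    by rewrite /= ul' andbT inE notin_l.1 notin_l.2.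
  rewrite -setIA -all_two IH//; last first.
    rewrite /= leqnn; apply/allP => i /(allP all_l').
    by case: i => m /= /ltnW.
  rewrite P_rect// !big_cons -P_rect// rl -two [P (rect A' C' [:: _; _])]P_rect//.
  by rewrite !big_cons big_nil mule1 !muleA.
rewrite cyl_rcons// last_event_split.
set V1 := U (size s) @^-1` _ `&` _; set V2 := U (size s) @^-1` _ `&` _.
have mV1 : measurable V1 by apply: measurableI; [exact: measurable_U|exact: measurable_B].
have mV2 : measurable V2 by apply: measurableI; [exact: measurable_U|exact: measurable_B].
have mc := measurable_cyl s; have mr := measurable_rect A C l.
have dis : V1 `&` V2 = set0.
  by apply/seteqP; split=> // w /= [[_ e1] [_ e2]]; move: e1 e2; rewrite /V1 /V2 /= => ->.
have dis2 X : (cyl s `&` V1 `&` X) `&` (cyl s `&` V2 `&` X) = set0.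
  apply/seteqP; split=> // w /= [[[_ v1] _] [[_ v2] _]].
  have : (V1 `&` V2) w by split.
  by rewrite dis.
have split2 X : measurable X -> P (cyl s `&` (V1 `|` V2) `&` X) =
   (P (cyl s `&` V1 `&` X) + P (cyl s `&` V2 `&` X))%E.
  move=> mX; rewrite setIUr setIUl.
  have mI V : measurable V -> measurable (cyl s `&` V `&` X).
    by move=> mV; apply: measurableI => //; exact: measurableI.
  exact: (measureU P (mI _ mV1) (mI _ mV2) (dis2 X)).
rewrite split2// !key//.
have := split2 setT measurableT; rewrite !setIT => ->.
have H A0 C0 : P (cyl s `&` (U (size s) @^-1` A0 `&` B (size s) @^-1` C0)) =
   (P (cyl s) * P (U (size s) @^-1` A0 `&` B (size s) @^-1` C0))%E.
  have := key A0 C0 [::] isT isT.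
  have -> : rect A C [::] = setT by apply/seteqP; split.
  by rewrite setIT probability_setT mule1.
by rewrite !H ge0_muleDl ?mule_ge0.
Qed.

End Law.

(** * Transition probabilities and conditioning on histories *)

Definition bits (s : seq nat) : bool := all (leq^~ 1%N) s.

Lemma sumn_bits s : bits s -> sumn s = count (fun i => nth 0%N s i == 1%N) (iota 0 (size s)).
Proof.
move=> bs; rewrite -[in LHS](mkseq_nth 0%N s) /mkseq.
have : all (fun i => nth 0%N s i <= 1)%N (iota 0 (size s)).
  apply/allP => i; rewrite mem_iota/= add0n => si.
  by apply: (allP bs); exact: mem_nth.
elim: (iota _ _) => [//|i l IH] /= /andP[i1 /IH ->].
by case: (nth 0%N s i) i1 => [|[|]].
Qed.

Lemma bits_sumn_le s : bits s -> (sumn s <= size s)%N.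
Proof. by elim: s => [//|x s IH] /= /andP[x1 /IH]; lia. Qed.

Section Hitting.
Variables (d : measure_display) (T : measurableType d) (R : realType).
Variables (P : probability T R) (p : R).
Variables (U : nat -> T -> nat) (B : nat -> T -> bool).
Hypotheses (p_gt0 : 0 < p) (p_lt1 : p < 1).
Hypothesis mU : forall n k : nat, measurable (U n @^-1` [set k]).
Hypothesis mB : forall n : nat, measurable (B n @^-1` [set true]).
Hypothesis PU : forall n k : nat, (1 <= n)%N -> (1 <= k <= n)%N ->
  P (U n @^-1` [set k]) = (n%:R^-1)%:E.
Hypothesis PB : forall n : nat, (1 <= n)%N -> P (B n @^-1` [set true]) = p%:E.
Hypothesis indepUB : indep_UB P U B.

Local Notation cyl := (cyl U B).
Local Notation Hw := (Hw U B).
Let mcyl s : measurable (cyl s) := measurable_cyl mU mB s.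

Lemma P_fin (A : set T) : measurable A -> exists x, P A = x%:E.
Proof. by move=> mA; exists (fine (P A)); rewrite fineK// fin_num_measure. Qed.

Lemma P_setU (A A' : set T) : measurable A -> measurable A' -> A `&` A' = set0 ->
  P (A `|` A') = (P A + P A')%E.
Proof. by move=> mA mA' AA'; rewrite measureU. Qed.

Lemma P_U_count n m (D : pred nat) : (1 <= n)%N -> (m <= n)%N ->
  P (U n @^-1` [set k | (1 <= k <= m)%N && D k.-1]) =
  ((count D (iota 0 m))%:R / n%:R)%:E.
Proof.
move=> n1; elim: m => [|m IH] mn.
  rewrite (_ : _ @^-1` _ = set0) ?measure0 ?mul0r//.
  by apply/seteqP; split=> // w /=; case: (U n w).
have -> : iota 0 m.+1 = iota 0 m ++ [:: m] by rewrite -addn1 iotaD.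
rewrite count_cat natrD mulrDl EFinD.
rewrite (_ : _ @^-1` _ = (U n @^-1` [set k | (1 <= k <= m)%N && D k.-1]) `|`
   (U n @^-1` [set k | k = m.+1 /\ D m])); last first.
  apply/seteqP; split=> w /=.
    move=> /andP[/andP[k1]]; rewrite leq_eqVlt ltnS.
    move=> /predU1P[-> dk|km dk]; first by right.
    by left; rewrite k1 km.
  by move=> [/andP[/andP[-> /leqW ->] ->]|[-> ->]]//; rewrite leqnn.
rewrite P_setU; [|exact: measurable_U..|]; last first.
  apply/seteqP; split=> // w /= [/andP[/andP[_ km] _] [ke _]].
  by move: km; rewrite ke ltnn.
rewrite IH 1?ltnW//; congr (_ + _)%E => /=.
case: (boolP (D m)) => Dm /=.
  rewrite addn0 mul1r -(@PU n m.+1)//; congr (P _).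
  by apply/seteqP; split=> w /=; [case|].
rewrite mul0r (_ : _ @^-1` _ = set0) ?measure0//.
by apply/seteqP; split=> // w /= [].
Qed.

(** Only the values from 1 to [n] have prescribed probabilities. These add up to 1, so all other
    values of [U n] together form a null event. *)
Lemma P_U_pred n (D : pred nat) : (1 <= n)%N ->
  P (U n @^-1` [set k | D k.-1]) = ((count D (iota 0 n))%:R / n%:R)%:E.
Proof.
move=> n1; rewrite -P_U_count//.
have mA := measurable_U mU n.
have full : P (U n @^-1` [set k | (1 <= k <= n)%N]) = 1%E.
  rewrite (_ : [set k | (1 <= k <= n)%N] = [set k | (1 <= k <= n)%N && predT k.-1]).
    by rewrite P_U_count// count_predT size_iota divff// pnatr_eq0 -lt0n.
  by apply/seteqP; split=> k /=; rewrite andbT.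
rewrite (_ : U n @^-1` [set k | (1 <= k <= n)%N && D k.-1] =
  U n @^-1` [set k | D k.-1] `&` U n @^-1` [set k | (1 <= k <= n)%N]).
  have := probability_setC P (mA [set k | (1 <= k <= n)%N]).
  rewrite full subee// => nul.
  rewrite [LHS](measureDI P (mA _) (mA [set k | (1 <= k <= n)%N])).
  rewrite [X in (X + _)%E](_ : _ = 0)%E ?add0e//.
  apply/eqP; rewrite -measure_le0 -nul; apply: le_measure; rewrite ?inE.
  - exact: measurableD.
  - exact: measurableC.
  - by move=> w [].
by apply/seteqP; split=> w /=; [case/andP|case=> -> ->].
Qed.

(** The Markov property of [H]: the next letter is 1 exactly if the coin shows [true] and the chosen
    index carries a 1, and the resulting factor depends on the history only through its sum and its
    length. *)
Lemma P_cyl1 s : (0 < size s)%N -> bits s ->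
  P (cyl (rcons s 1%N)) = (P (cyl s) * (p * (sumn s)%:R / (size s)%:R)%:E)%E.
Proof.
move=> s0 bs; set n := size s.
pose A0 := [set k : nat | nth 0%N s k.-1 == 1%N].
have -> : cyl (rcons s 1%N) = cyl s `&` rect U B (fun _ => A0) (fun _ => [set true])
    [:: inl n; inr n].
  rewrite cyl_rcons//; apply/seteqP; split=> w [ws]; rewrite /last_event/=.
    case: ifP => // Bn nth1; split=> // i; rewrite /= !inE => /orP[] /eqP -> //=.
    exact/eqP.
  move=> wr; split=> //; have := wr (inr n); have := wr (inl n).
  rewrite /= !inE !eqxx orbT => /(_ isT) e1 /(_ isT) e2.
  by rewrite /last_event /= e2; exact/eqP.
rewrite cyl_indep//=; last by rewrite !leqnn.
rewrite (P_rect indepUB)// !big_cons big_nil mule1 PB//.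
rewrite (@P_U_pred n (fun i => nth 0%N s i == 1%N))// -sumn_bits//.
by rewrite -EFinM mulrC mulrA.
Qed.

Lemma cyl_split s : (0 < size s)%N -> cyl s = cyl (rcons s 1%N) `|` cyl (rcons s 0%N).
Proof.
move=> s0; rewrite !cyl_rcons// -setIUr; apply/seteqP; split=> [w ws|w []//].
split=> //; rewrite /last_event/=.
have := Xs_01 (U^~ w) (B^~ w) (size s).+1.
rewrite XsS// all_rcons; have -> : Xs (U^~ w) (B^~ w) (size s) = s := ws.
by move=> /andP[]; case: (if _ then _ else _) => [|[|]]; [right|left|].
Qed.

Lemma cyl_disj s x y : (0 < size s)%N -> x != y -> cyl (rcons s x) `&` cyl (rcons s y) = set0.
Proof.
move=> s0 xy; apply/seteqP; split=> // w; rewrite !cyl_rcons//.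
by move=> [[_ e1] [_ e2]]; move: xy; rewrite -e1 -e2 eqxx.
Qed.

Lemma P_cyl0 s : (0 < size s)%N -> bits s ->
  P (cyl (rcons s 0%N)) = (P (cyl s) * (1 - p * (sumn s)%:R / (size s)%:R)%:E)%E.
Proof.
move=> s0 bs; have := P_cyl1 s0 bs.
have : P (cyl s) = (P (cyl (rcons s 1%N)) + P (cyl (rcons s 0%N)))%E.
  by rewrite {1}cyl_split// measureU//; exact: cyl_disj.
have [x ->] := P_fin (mcyl s).
have [y ->] := P_fin (mcyl (rcons s 1%N)).
have [z ->] := P_fin (mcyl (rcons s 0%N)).
rewrite -!EFinM -!EFinD => -[xe] [ye]; congr EFin; rewrite mulrBr mulr1 -ye xe.
by rewrite addrAC subrr add0r.
Qed.

Definition hits (D : nat -> nat -> bool) (s : seq nat) (j : nat) : set T :=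
  cyl s `&` [set w | exists2 m, (m <= j)%N & D (size s + m)%N (Hw w (size s + m)%N)].

Lemma Hw_cyl s w : cyl s w -> Hw w (size s) = sumn s.
Proof. by move=> ws; rewrite /Hw /Hn; congr sumn; exact: ws. Qed.

Lemma measurable_Xw n (Q : seq nat -> Prop) : measurable [set w | Q (Xw U B w n)].
Proof.
have -> : [set w | Q (Xw U B w n)] =
    \bigcup_(s : seq nat) (if `[< size s = n /\ Q s >] then cyl s else set0).
  apply/seteqP; split=> w /=.
    move=> Qw; exists (Xw U B w n) => //; case: asboolP => [_|[]].
      by rewrite /cyl/= size_Xs.
    by rewrite size_Xs.
  by move=> [s _]; case: asboolP => // -[<- Qs] ->.
apply: countable_bigcupT_measurable; first exact: countableP.
by move=> s; case: ifP.
Qed.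

Lemma measurable_Hw n (Q : nat -> Prop) : measurable [set w | Q (Hw w n)].
Proof. exact: (measurable_Xw n (fun s => Q (sumn s))). Qed.

Lemma measurable_hits D s j : measurable (hits D s j).
Proof.
apply: measurableI => //.
rewrite (_ : [set w | _] = \bigcup_(m in [set m | (m <= j)%N])
   [set w | D (size s + m)%N (Hw w (size s + m)%N)]).
  by apply: bigcup_measurable => m _; exact: (measurable_Hw _ (fun h => D _ h)).
by apply/seteqP; split=> w [m mj Dm]; exists m.
Qed.

(** The event obeys the first-step recursion that defines [hit]: outside [D], the history is
    extended by a 1 or by a 0. *)
Lemma P_hits D s j : (0 < size s)%N -> bits s ->
  P (hits D s j) = (P (cyl s) * (hit p D j (size s) (sumn s))%:E)%E.
Proof.
elim: j s => [|j IH] s s0 bs.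
  rewrite /=; case: ifPn => Ds.
    rewrite mule1; congr (P _); apply/seteqP; split=> [w []//|w ws].
    by split=> //; exists 0%N => //; rewrite addn0 Hw_cyl.
  rewrite mule0 (_ : hits _ _ _ = set0) ?measure0//.
  apply/seteqP; split=> // w [ws [m]]; rewrite leqn0 => /eqP ->.
  by rewrite addn0 Hw_cyl// (negbTE Ds).
rewrite /=; case: ifPn => Ds.
  rewrite mule1; congr (P _); apply/seteqP; split=> [w []//|w ws].
  by split=> //; exists 0%N => //; rewrite addn0 Hw_cyl.
have e : hits D s j.+1 = hits D (rcons s 1%N) j `|` hits D (rcons s 0%N) j.
  apply/seteqP; split=> w.
    move=> [ws [[|m] mj]]; first by rewrite addn0 Hw_cyl// (negbTE Ds).
    rewrite addnS -addSn => Dm.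
    have := ws; rewrite cyl_split// => -[w1|w0]; [left|right]; split=> //;
      by exists m => //; rewrite size_rcons.
  by move=> [] [ws [m mj]]; rewrite size_rcons addSn -addnS => Dm;
    (split; last by exists m.+1); rewrite cyl_split//; [left|right].
rewrite e P_setU; [|exact: measurable_hits..|]; last first.
  apply/seteqP; split=> // w [[w1 _] [w0 _]].
  by rewrite -(@cyl_disj s 1%N 0%N).
rewrite !IH ?size_rcons ?/bits ?all_rcons//.
rewrite !sumn_rcons addn0 addn1 P_cyl1// P_cyl0// /step.
have [x ->] := P_fin (mcyl s).
by rewrite -!EFinM -!EFinD; congr EFin; ring.
Qed.

Definition ever (D : nat -> nat -> bool) (s : seq nat) : set T :=
  cyl s `&` [set w | exists2 m, (size s <= m)%N & D m (Hw w m)].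

Lemma everE D s : ever D s = \bigcup_j hits D s j.
Proof.
apply/seteqP; split=> w.
  move=> [ws [m sm Dm]]; exists (m - size s)%N => //; split=> //.
  by exists (m - size s)%N => //; rewrite subnKC.
by move=> [j _ [ws [m mj Dm]]]; split=> //; exists (size s + m)%N; rewrite ?leq_addr.
Qed.

Lemma measurable_ever D s : measurable (ever D s).
Proof. by rewrite everE; apply: bigcup_measurable => j _; exact: measurable_hits. Qed.

Lemma P_ever_le D s c : (0 < size s)%N -> bits s ->
  (forall j, hit p D j (size s) (sumn s) <= c) ->
  (P (ever D s) <= P (cyl s) * c%:E)%E.
Proof.
move=> s0 bs hc.
have cv : (P (hits D s j) @[j --> \oo] --> P (ever D s))%E.
  rewrite everE; apply: nondecreasing_cvg_mu.
  - by move=> j; exact: measurable_hits.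
  - by rewrite -everE; exact: measurable_ever.
  - move=> i j ij; apply/subsetPset => w [ws [m mi Dm]]; split=> //; exists m => //.
    exact: leq_trans ij.
rewrite -(cvg_lim _ cv)//; apply: lime_le; first by apply/cvg_ex; exists (P (ever D s)).
by apply: nearW => j; rewrite P_hits// lee_wpmul2l// lee_fin.
Qed.

Lemma P_ever_ge D s j : (0 < size s)%N -> bits s ->
  (P (cyl s) * (hit p D j (size s) (sumn s))%:E <= P (ever D s))%E.
Proof.
move=> s0 bs; rewrite -P_hits//; apply: le_measure; rewrite ?inE.
- exact: measurable_hits.
- exact: measurable_ever.
- by rewrite everE; exact: bigcup_sup.
Qed.

(** Summing conditional bounds over disjoint histories; with the histories stopped at a random time
    for [S], it acts as the strong Markov property. *)
Lemma P_bigcup_le (S : set (seq nat)) (Ev : seq nat -> set T) (c : R) : 0 <= c ->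
  (forall s t w, S s -> S t -> cyl s w -> cyl t w -> s = t) ->
  (forall s, S s -> measurable (Ev s)) ->
  (forall s, S s -> P (Ev s) <= P (cyl s) * c%:E)%E ->
  (P (\bigcup_(s in S) Ev s) <= P (\bigcup_(s in S) cyl s) * c%:E)%E.
Proof.
move=> c0 dis mE hE.
(* Histories are numbered by [pickle], so that sigma-additivity over [nat] applies; numbers that
   encode no history of [S] get the empty set. *)
pose F (G : seq nat -> set T) (i : nat) : set T :=
  if pickle_inv i is Some s then (if `[< S s >] then G s else set0) else set0.
have bF G : \bigcup_(s in S) G s = \bigcup_i F G i.
  apply/seteqP; split=> w.
    move=> [s Ss Gs]; exists (pickle s) => //.
    by rewrite /F pickleK_inv; case: asboolP.
  move=> [i _]; rewrite /F; case: pickle_inv => // s.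
  by case: asboolP => // Ss Gs; exists s.
have mF G : (forall s, S s -> measurable (G s)) -> forall i, measurable (F G i).
  move=> mG i; rewrite /F; case: pickle_inv => // s.
  by case: asboolP => // Ss; exact: mG.
rewrite !bF.
have mEv := mF _ mE.
have mcy := mF _ (fun s _ => mcyl s).
apply: (@le_trans _ _ (\sum_(0 <= i <oo) P (F Ev i))%E).
  apply: measure_sigma_subadditive => //.
  exact: bigcup_measurable.
have tF : trivIset setT (F cyl).
  apply/trivIsetP => i j _ _ ij; apply/seteqP; split=> // w [].
  rewrite /F; case ei : (pickle_inv i) => [s|]//; case ej : (pickle_inv j) => [t|]//.
  case: asboolP => // Ss; case: asboolP => // St ws wt.
  have st := dis _ _ _ Ss St ws wt.
  have hi := @pickle_invK (seq nat) i; have hj := @pickle_invK (seq nat) j.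
  by move: ij; rewrite -hi -hj ei ej /= st eqxx.
rewrite measure_semi_bigcup//; last exact: bigcup_measurable.
rewrite muleC -nneseriesZl//.
apply: lee_nneseries => // i _.
rewrite /F; case: pickle_inv => [s|]; last by rewrite !measure0 mule0.
case: asboolP => Ss; last by rewrite !measure0 mule0.
by rewrite muleC; exact: hE.
Qed.

End Hitting.

(** * Almost sure bounds *)

(* Borel-Cantelli with summability given by the telescoping majorant [v]. *)
Lemma ae_eventually d (T : measurableType d) (R : realType) (P : probability T R)
    (F : nat -> set T) (v : nat -> R) (K : nat) :
  (forall k, measurable (F k)) -> (forall k, 0 <= v k) ->
  (forall k, (K <= k)%N -> P (F k) <= (v k - v k.+1)%:E)%E ->
  {ae P, forall w, exists N, forall k, (N <= k)%N -> ~ F k w}.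
Proof.
move=> mF v0 hF; pose G k := F (K + k)%N.
have mG k : measurable (G k) by exact: mF.
have sG : (\sum_(0 <= k <oo) P (G k) < +oo)%E.
  apply: (@le_lt_trans _ _ (v K)%:E); last exact: ltry.
  apply: lime_le; first exact: is_cvg_nneseries.
  apply: nearW => n.
  apply: (@le_trans _ _ (v K - v (K + n)%N)%:E); last by rewrite lee_fin gerBl.
  elim: n => [|n IH]; first by rewrite big_geq// addn0 subrr.
  rewrite big_nat_recr//= addnS; apply: (le_trans (leeD IH (hF _ (leq_addr _ _)))).
  by rewrite -EFinD lee_fin addrA subrK.
have G0 : P (lim_sup_set G) = 0 := lim_sup_set_cvg0 mG sG.
have mlim : measurable (lim_sup_set G).
  by apply: bigcap_measurable => // n _; apply: bigcup_measurable => k _.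
have : P.-negligible (lim_sup_set G) by exact/negligibleP.
apply: negligibleS => w /= hw n _; apply: contrapT => hn; apply: hw.
exists (K + n)%N => k Kk Fk; apply: hn; exists (k - K)%N => /=; first by lia.
by rewrite /G subnKC//; lia.
Qed.

Lemma P_negligible d (T : measurableType d) (R : realType) (P : probability T R)
    (A : set T) : measurable A -> P A = 0%E -> P.-negligible A.
Proof. by move=> mA A0; apply/negligibleP. Qed.

Section AlmostSure.
Variables (d : measure_display) (T : measurableType d) (R : realType).
Variables (P : probability T R) (p : R).
Variables (U : nat -> T -> nat) (B : nat -> T -> bool).
Hypotheses (p_gt0 : 0 < p) (p_lt1 : p < 1).
Hypothesis mU : forall n k : nat, measurable (U n @^-1` [set k]).
Hypothesis mB : forall n : nat, measurable (B n @^-1` [set true]).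
Hypothesis PU : forall n k : nat, (1 <= n)%N -> (1 <= k <= n)%N ->
  P (U n @^-1` [set k]) = (n%:R^-1)%:E.
Hypothesis PB : forall n : nat, (1 <= n)%N -> P (B n @^-1` [set true]) = p%:E.
Hypothesis indepUB : indep_UB P U B.
Variable a : nat -> R.
Hypothesis a_gt0 : forall n, (0 < n)%N -> 0 < a n.
Hypothesis aS : forall n, (0 < n)%N -> a n.+1 = a n * (1 + p / n%:R).

Local Notation cyl := (cyl U B).
Local Notation Hw := (Hw U B).
Local Notation hits_level w := (first_time (U^~ w) (B^~ w)).

(* The possible histories of the process stopped when it first reaches level [h]. *)
Definition stops (h : nat) : set (seq nat) :=
  [set s | [/\ (0 < size s)%N, bits s, sumn s = h & (sumn (take (size s).-1 s) < h)%N]].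

Lemma Hw_take s w n : cyl s w -> (n <= size s)%N -> Hw w n = sumn (take n s).
Proof.
by move=> ws ns; rewrite /Hw /Hn -(take_Xs _ _ ns); congr (sumn (take _ _)).
Qed.

Lemma stops_first h s w : stops h s -> cyl s w -> hits_level w h (size s).
Proof.
move=> [s0 bs sh sl] ws; by rewrite /first_time -!/(Hw w _) (Hw_take ws)// take_size sh eqxx (Hw_take ws)// leq_pred.
Qed.

Lemma first_stops h w n : hits_level w h n -> stops h (Xw U B w n) /\ cyl (Xw U B w n) w.
Proof.
move=> /andP[/eqP hn hlt].
have n0 : (0 < n)%N by case: n hn hlt => [|//] <-; rewrite ltnn.
split; last by rewrite /cyl/= size_Xs.
split=> //; rewrite ?size_Xs//; first exact: Xs_01.
by rewrite take_Xs ?leq_pred.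
Qed.

Lemma stops_uniq h s t w : stops h s -> stops h t -> cyl s w -> cyl t w -> s = t.
Proof.
move=> hs ht ws wt.
have e := first_time_uniq (stops_first hs ws) (stops_first ht wt).
exact: etrans (esym ws) (etrans (congr1 (Xw U B w) e) wt).
Qed.

Lemma stops_size h s : stops h s -> (h <= size s)%N.
Proof. by move=> [_ bs <- _]; exact: bits_sumn_le. Qed.

(** Splitting by the stopped history replaces the random starting time of the deviation by the
    length of a fixed history. *)
Lemma devE (D : nat -> nat -> nat -> bool) (h : nat) :
  [set w | exists2 n, hits_level w h n & exists2 m, (n <= m)%N & D n m (Hw w m)] =
  \bigcup_(s in stops h) ever U B (D (size s)) s.
Proof.
apply/seteqP; split=> w /=.
  move=> [n fn [m nm Dm]]; have [st ws] := first_stops fn.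
  exists (Xw U B w n) => //; split=> //; exists m; rewrite size_Xs//.
move=> [s hs [ws [m sm Dm]]]; exists (size s); first exact: stops_first hs ws.
by exists m.
Qed.

Lemma measurable_bigcup_seq (S : set (seq nat)) (F : seq nat -> set T) :
  (forall s, measurable (F s)) -> measurable (\bigcup_(s in S) F s).
Proof.
move=> mF; rewrite bigcup_mkcond; apply: countable_bigcupT_measurable => [|s].
  exact: countableP.
by case: ifP.
Qed.

Lemma measurable_dev (D : nat -> nat -> nat -> bool) (h : nat) : measurable
  [set w | exists2 n, hits_level w h n & exists2 m, (n <= m)%N & D n m (Hw w m)].
Proof.
by rewrite devE; apply: measurable_bigcup_seq => s; exact: measurable_ever.
Qed.

Lemma P_dev_le (D : nat -> nat -> nat -> bool) (h : nat) (c : R) : 0 <= c ->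
  (forall n, (h <= n)%N -> forall j, hit p (D n) j n h <= c) ->
  (P [set w | exists2 n, hits_level w h n & exists2 m, (n <= m)%N & D n m (Hw w m)]
    <= c%:E)%E.
Proof.
move=> c0 hc; rewrite devE.
apply: (@le_trans _ _ (P (\bigcup_(s in stops h) cyl s) * c%:E)%E).
  apply: P_bigcup_le => //.
  - by move=> s t w; exact: stops_uniq.
  - by move=> s _; exact: measurable_ever.
  - move=> s hs; have hsz := stops_size hs; case: hs => s0 bs sh _.
    by apply: (P_ever_le mU mB PU PB indepUB s0 bs) => j; rewrite sh; exact: hc.
rewrite -[leRHS]mul1e lee_wpmul2r ?lee_fin// probability_le1//.
by apply: measurable_bigcup_seq => s; exact: measurable_cyl.
Qed.

Lemma a_large (n : nat) (M : R) : (1 < n)%N -> exists2 N, (n <= N)%N & M <= a N.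
Proof.
move=> n1; have an := a_gt0 (ltnW n1).
pose K := (Num.truncn (expR ((`|M| / a n + 4) / p))).+1.
exists (n * K)%N; first by rewrite leq_pmulr.
rewrite (@a_ratio R p a aS n); last by rewrite (ltnW n1) leq_pmulr.
have b := @beta_ge R p p_gt0 p_lt1 1 n (n * K) (ltnW n1) ltac:(lia).
apply: (@le_trans _ _ (a n * (`|M| / a n))).
  by rewrite mulrC divfK ?gt_eqF// ler_norm.
rewrite ler_pM2l//; apply: le_trans b.
have := expR_ge1Dx (1%:~R * Lsum p n (n * K) - 4 * (1%:~R ^+ 2 / n%:R)).
apply: le_trans; rewrite mul1r expr1n.
have /andP[L1 _] := @Lsum_mul_bounds R p p_gt0 p_lt1 n K (ltnW n1) isT.
have : (`|M| / a n + 4) / p <= ln K%:R.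
  by rewrite -ler_expR lnK ?posrE ?ltr0n//; exact/ltW/truncnS_gt.
rewrite ler_pdivrMr// => L2.
have n1R : 1 / n%:R <= 1 :> R by rewrite ler_pdivrMr ?ltr0n ?(ltnW n1)// mul1r ler1n ltnW.
lra.
Qed.

(** At time [m] the chain stays at [h] with probability [1 - p h / m <= (1 + p / m)^-1], and the
    product of the right sides is [a n / a (n + j)]. *)
Lemma hit_next_ge (n h j : nat) : (0 < h <= n)%N ->
  1 - a n / a (n + j)%N <= hit p (fun _ v => h < v)%N j n h.
Proof.
move=> /andP[h0 hn]; set N := (n + j)%N.
have n0 : (0 < n)%N by exact: leq_trans hn.
pose g (m v : nat) : R := if (v <= h)%N then 1 - a m / a N else 1.
have aN : 0 < a N by apply: a_gt0; rewrite /N addn_gt0 n0.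
have gs m v : (n <= m < N)%N -> (h <= v <= m)%N -> g m v <= step p g m v.
  move=> /andP[nm mN] /andP[hv vm].
  have m0 : (0 < m)%N := leq_trans n0 nm.
  have m0R : 0 < m%:R :> R by rewrite ltr0n.
  have am := a_gt0 m0; have amN : 0 <= a m / a N by rewrite divr_ge0// ltW.
  rewrite /step /g (aS m0); case: (leqP v h) => vh; last first.
    by rewrite ltnNge (ltnW vh)/= !mulr1 addrC subrK.
  have vE : v = h by apply/eqP; rewrite eqn_leq vh hv.
  rewrite vE ltnn mulr1.
  have [c1 c2] := step_coef p_gt0 p_lt1 (leq_trans hv vm : (h <= m)%N).
  set x := p * h%:R / m%:R in c1 c2 *.
  have px : p / m%:R <= x.
    by rewrite /x ler_pM2r ?invr_gt0// ler_peMr ?ler1n// ltW.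
  have pm : 0 <= p / m%:R by rewrite divr_ge0// ltW.
  have -> : a m * (1 + p / m%:R) / a N = a m / a N * (1 + p / m%:R) by ring.
  move: (a m / a N) (p / m%:R) amN px pm => A y A0 xy y0.
  have : (1 - x) * (1 + y) <= 1 by nra.
  move=> /(ler_wpM2l A0); lra.
have gN v : (h <= v <= N)%N -> g N v <= 1 * (h < v)%N%:R.
  move=> /andP[hv vN]; rewrite /g mul1r; case: leqP => // _.
  by rewrite divff ?subrr// gt_eqF.
have hn' : (h <= h <= n)%N by rewrite leqnn.
have := hit_ge p_gt0 p_lt1 (D := fun _ v => (h < v)%N) ler01 gs gN (erefl (n + j)%N) (leqnn n) hn'.
by rewrite mul1r {1}/g leqnn.
Qed.

(** For each finite history, its sum is almost surely exceeded later, since [a] tends to infinity;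
    there are countably many histories. *)
Lemma ae_unbounded : {ae P, forall w, forall h, exists n, (h <= Hw w n)%N}.
Proof.
have null s : P.-negligible (if ((1 < size s)%N && bits s && (0 < sumn s)%N)
    then cyl s `\` ever U B (fun _ v => sumn s < v)%N s else set0).
  case: ifPn => [/andP[/andP[s1 bs] h0]|_]; last exact: negligible_set0.
  set D := fun _ v => _.
  have mc := measurable_cyl mU mB s.
  have me := measurable_ever mU mB D s.
  apply: P_negligible; first exact: measurableD.
  have sub : ever U B D s `<=` cyl s by move=> w [].
  have [x Px] := P_fin P mc.
  have [y Py] := P_fin P me.
  have xy : y <= x by rewrite -lee_fin -Px -Py; apply: le_measure; rewrite ?inE.
  have x0 : 0 <= x by rewrite -lee_fin -Px measure_ge0.
  have eq : x = y.
    apply/eqP; rewrite eq_le xy andbT.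
    apply/ler_addgt0Pr => e e0.
    have [N sN aN] := @a_large (size s) (a (size s) * (x + 1) / e) s1.
    have := P_ever_ge mU mB PU PB indepUB D (N - size s) (ltnW s1) bs.
    rewrite Px Py lee_fin; move=> le1.
    have := @hit_next_ge (size s) (sumn s) (N - size s)
      (introT andP (conj h0 (bits_sumn_le bs))).
    rewrite subnKC// => /(ler_wpM2l x0) => le2.
    have as0 := a_gt0 (ltnW s1).
    have aN0 : 0 < a N := a_gt0 (leq_trans (ltnW s1) sN).
    have : x * (a (size s) / a N) <= e.
      rewrite mulrA ler_pdivrMr// -ler_pdivrMl//.
      apply: le_trans aN; rewrite mulrC ler_pM2r ?invr_gt0//.
      rewrite mulrC ler_pM2l//; lra.
    move: le1 le2; rewrite mulrBr mulr1; lra.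
  have -> : P (cyl s `\` ever U B D s) = (P (cyl s) - P (ever U B D s))%E.
    rewrite measureD//=; first by rewrite (setIidr sub).
    by rewrite [X in (X < _)%E]Px ltry.
  by rewrite Px Py -EFinB eq subrr.
pose F (i : nat) : set T := if pickle_inv i is Some s then
   (if ((1 < size s)%N && bits s && (0 < sumn s)%N)
    then cyl s `\` ever U B (fun _ v => sumn s < v)%N s else set0) else set0.
have : P.-negligible (\bigcup_i F i).
  apply: negligible_bigcup => i; rewrite /F.
  by case: pickle_inv => // ; exact: negligible_set0.
apply: negligibleS => w /= unb; apply: contrapT => hw; apply: unb => h.
elim: h => [|h [n hn]]; first by exists 0%N.
apply: contrapT => hmax; apply: hw.
(* The shift by 2 gives a history of length at least 2 and of positive sum, the ones for which the
   null events are set up. *)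
pose n2 := (n + 2)%N; pose s := Xw U B w n2.
have sz : size s = n2 by rewrite size_Xs.
have bs : bits s := Xs_01 _ _ _.
have ws : cyl s w by rewrite /cyl/= sz.
have ss : sumn s = Hw w n2 by [].
have s0 : (0 < sumn s)%N by rewrite ss; apply: Hn_gt0; rewrite /n2; lia.
exists (pickle s) => //; rewrite /F pickleK_inv sz bs s0 /= (_ : (1 < n2)%N); last by rewrite /n2; lia.
split=> // -[_ [m _]] sm; apply: hmax; exists m.
apply: leq_trans sm; rewrite ltnS ss; apply: leq_trans hn _.
by apply: Hn_mono; rewrite /n2; lia.
Qed.

End AlmostSure.

(** * Geometric levels and a telescoping majorant *)

Section Levels.
Variable R : realType.

Definition lev (rho : R) (k : nat) : nat := (Num.truncn (rho ^+ k)).+1.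

Lemma lev_gt (rho : R) k : rho ^+ k < (lev rho k)%:R.
Proof. exact: truncnS_gt. Qed.

Lemma lt_lev (rho : R) k h : 0 <= rho -> (h < lev rho k)%N -> h%:R <= rho ^+ k.
Proof. by move=> r0; rewrite ltnS truncn_ge_nat// exprn_ge0. Qed.

Lemma lev_ge_mul (rho : R) k : 1 < rho -> k%:R * ln rho <= (lev rho k)%:R.
Proof.
move=> r1; have r0 : 0 < rho by rewrite (lt_trans ltr01).
apply: le_trans (ltW (lev_gt rho k)).
rewrite -[rho in leRHS](lnK r0) -expRM_natl.
by have := expR_ge1Dx (k%:R * ln rho); lra.
Qed.

Lemma lev_unbounded (rho : R) (N : nat) : 1 < rho ->
  exists K, forall k, (K <= k)%N -> (N <= lev rho k)%N.
Proof.
move=> r1; have l0 := ln_gt0 r1.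
exists (Num.truncn (N%:R / ln rho)).+1 => k Kk.
rewrite -(ler_nat R) (le_trans _ (lev_ge_mul k r1))// -ler_pdivrMr//.
by rewrite ltW// (lt_le_trans (truncnS_gt _))// ler_nat.
Qed.

(** Turns [exp (- gamma * lam h)] at the [k]-th level into a constant times [k^(- gamma)]. *)
Lemma lam_lev (rho : R) k : 1 < rho -> (0 < k)%N ->
  ln k%:R + ln (ln rho) <= lam (lev rho k)%:R.
Proof.
move=> r1 k0; have l0 := ln_gt0 r1; have r0 : 0 < rho by rewrite (lt_trans ltr01).
have k0R : 0 < k%:R :> R by rewrite ltr0n.
rewrite -lnM ?posrE// /lam ler_ln ?posrE ?mulr_gt0//; last first.
  by apply: ln_gt0; apply: lt_trans (lev_gt rho k); rewrite exprn_egt1 ?lt0n_neq0.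
rewrite mulr_natl -lnXn// ler_ln ?posrE ?exprn_gt0//.
exact/ltW/lev_gt.
Qed.

Lemma ln_succ_ge (x : R) : 0 < x -> ln x <= ln (x + 1) - (x + 1)^-1.
Proof.
move=> x0.
have := @le_ln1Dx R (- (x + 1)^-1).
have -> : 1 + - (x + 1)^-1 = x / (x + 1) by field; lra.
rewrite ln_div ?posrE//; last lra.
have : (x + 1)^-1 < 1 by rewrite invf_lt1; lra.
set z := _^-1; move=> z1 /(_ ltac:(lra)); lra.
Qed.

(** Discrete form of the fact that [x^(- e)] has derivative [- e * x^(- 1 - e)]; it supplies the
    majorant in [ae_eventually]. *)
Lemma riemann_telescope (e : R) (k : nat) : 0 < e -> (2 <= k)%N ->
  e * expR (- ((1 + e) * ln k%:R)) <=
    expR (- (e * ln (k.-1)%:R)) - expR (- (e * ln k%:R)).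
Proof.
case: k => [|[|k]] // e0 _; rewrite [k.+2.-1]/=.
set x : R := k.+1%:R; have x0 : 0 < x by rewrite ltr0n.
have -> : k.+2%:R = x + 1 :> R by rewrite natr1.
have l := ln_succ_ge x0.
have -> : expR (- ((1 + e) * ln (x + 1))) = (x + 1)^-1 * expR (- (e * ln (x + 1))).
  rewrite mulrDl mul1r opprD expRD (expRN (ln _)) lnK// posrE; lra.
set E := expR (- (e * ln (x + 1))).
have E0 : 0 < E := expR_gt0 _.
have : E * (1 + e / (x + 1)) <= expR (- (e * ln x)).
  apply: (@le_trans _ _ (E * expR (e / (x + 1)))).
    by rewrite ler_pM2l// expR_ge1Dx.
  rewrite -expRD ler_expR.
  have := ler_wpM2l (ltW e0) l; rewrite mulrBr; lra.
rewrite mulrDr mulr1 -lerBrDl => H; apply: le_trans H.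
by rewrite le_eqVlt; apply/predU1P; left; ring.
Qed.

End Levels.

(** * Almost sure upper bound for the oscillation of [ell] *)

Section AlmostSureUpper.
Variables (d : measure_display) (T : measurableType d) (R : realType).
Variables (P : probability T R) (p : R).
Variables (U : nat -> T -> nat) (B : nat -> T -> bool).
Hypotheses (p_gt0 : 0 < p) (p_lt1 : p < 1).
Hypothesis mU : forall n k : nat, measurable (U n @^-1` [set k]).
Hypothesis mB : forall n : nat, measurable (B n @^-1` [set true]).
Hypothesis PU : forall n k : nat, (1 <= n)%N -> (1 <= k <= n)%N ->
  P (U n @^-1` [set k]) = (n%:R^-1)%:E.
Hypothesis PB : forall n : nat, (1 <= n)%N -> P (B n @^-1` [set true]) = p%:E.
Hypothesis indepUB : indep_UB P U B.
Variable a : nat -> R.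
Hypothesis a_gt0 : forall n, (0 < n)%N -> 0 < a n.
Hypothesis aS : forall n, (0 < n)%N -> a n.+1 = a n * (1 + p / n%:R).

Local Notation Hw := (Hw U B).
Local Notation hits_level w := (first_time (U^~ w) (B^~ w)).

Lemma ae_devU (s : bool) (eta kappa gamma rho : R) : 0 < eta -> 0 < kappa <= 1 ->
  1 < gamma < eta ^+ 2 / kappa -> 1 < rho ->
  {ae P, forall w, exists N, forall k, (N <= k)%N -> forall n,
     hits_level w (lev rho k) n -> forall m, (n <= m)%N ->
     ~~ devU a s eta kappa n (lev rho k) m (Hw w m)}.
Proof.
move=> eta0 k01 /andP[g1 ge] r1.
have [h0 _ hh0] := hit_devU p_gt0 p_lt1 a_gt0 aS eta0 k01 ge.
have [K hK] := lev_unbounded h0 r1.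
pose e := gamma - 1; have e0 : 0 < e by rewrite subr_gt0.
pose C1 := expR (- (gamma * ln (ln rho))).
pose v (k : nat) := C1 / e * expR (- (e * ln (k.-1)%:R)).
pose F k := [set w | exists2 n, hits_level w (lev rho k) n &
  exists2 m, (n <= m)%N & devU a s eta kappa n (lev rho k) m (Hw w m)].
have : {ae P, forall w, exists N, forall k, (N <= k)%N -> ~ F k w}.
  apply: (@ae_eventually _ _ _ P F v (K + 2)%N).
  - by move=> k; exact: (measurable_dev mU mB (fun n => devU a s eta kappa n (lev rho k))).
  - by move=> k; rewrite mulr_ge0 ?expR_ge0// divr_ge0 ?expR_ge0// ltW.
  move=> k Kk.
  apply: (@le_trans _ _ (expR (- (gamma * lam (lev rho k)%:R)))%:E).
    apply: (P_dev_le mU mB PU PB indepUB (D := fun n => devU a s eta kappa n (lev rho k))).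
      exact: expR_ge0.
    move=> n hn j; apply: hh0 => //=; apply: hK.
    exact: leq_trans (leq_addr _ _) Kk.
  have k2 : (2 <= k)%N by exact: leq_trans (leq_addl _ _) Kk.
  rewrite lee_fin /v -mulrBr.
  apply: (@le_trans _ _ (C1 / e * (e * expR (- ((1 + e) * ln k%:R))))); last first.
    by rewrite ler_wpM2l ?riemann_telescope// divr_ge0 ?expR_ge0// ltW.
  rewrite mulrA divfK ?gt_eqF// -expRD ler_expR /e addrCA subrr addr0.
  have := lam_lev r1 (ltnW k2); have g0 : 0 <= gamma by lra.
  move=> /(ler_wpM2l g0); rewrite mulrDr; lra.
apply: filterS => w [N hN]; exists N => k Nk n hn m nm.
by apply/negP => dm; apply: (hN k Nk); exists n => //; exists m.
Qed.

(** Let [t] be the first time at the last grid level [h] not above [H_n]. From [t] to [m] the change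
    of [ell] is at most [(1 + e) * phi h / h], by the bound over the whole future; from [t] to [n]
    it is at most [e * phi h / h], as [H] has grown by a factor of at most [rho]. The sum is
    rescaled from [h] to [H_n] at the price of another factor [rho <= 1 + e]. *)
Lemma ae_oscillation (e : R) : 0 < e <= 2^-1 ->
  {ae P, forall w, exists N, forall n m, (N <= n <= m)%N ->
     `|ell a m (Hw w m) - ell a n (Hw w n)|
        <= (1 + 4 * e) * (phi (Hw w n)%:R / (Hw w n)%:R)}.
Proof.
move=> /andP[e0 e1].
(* With this [kap], deviations of size [e] have exponent [e^2 / kap = 4], well above the critical
   value 1; [rho] is the growth factor that [kap] permits. *)
pose kap := e ^+ 2 / 4; pose rho := (1 - kap)^-1.
have e2 : 0 < e ^+ 2 by rewrite exprn_gt0.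
have e3 : e ^+ 2 <= 4^-1.
  have -> : (4^-1 : R) = 2^-1 ^+ 2 by rewrite expr2; field.
  by rewrite ler_pXn2r ?nnegrE// ltW.
have kap0 : 0 < kap by rewrite divr_gt0.
have kap1 : kap <= 16^-1 by rewrite /kap; lra.
have k1 : 0 < 1 - kap by lra.
have r1 : 1 < rho by rewrite /rho -[ltLHS]invr1 ltf_pV2 ?posrE//; lra.
have re : rho <= 1 + e.
  rewrite /rho -[leLHS]mul1r ler_pdivrMr// /kap.
  have : e * e ^+ 2 <= e * 4^-1 by rewrite ler_pM2l.
  have : e ^+ 2 <= 2^-1 * e by rewrite expr2 ler_pM2r.
  lra.
have A1 s : {ae P, forall w, exists N, forall k, (N <= k)%N -> forall n,
     hits_level w (lev rho k) n -> forall m, (n <= m)%N ->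
     ~~ devU a s (1 + e) 1 n (lev rho k) m (Hw w m)}.
  apply: (@ae_devU s (1 + e) 1 (1 + e) rho) => //; [lra|lra|].
  by rewrite divr1; apply/andP; split; nra.
have A2 s : {ae P, forall w, exists N, forall k, (N <= k)%N -> forall n,
     hits_level w (lev rho k) n -> forall m, (n <= m)%N ->
     ~~ devU a s e kap n (lev rho k) m (Hw w m)}.
  apply: (@ae_devU s e kap 2 rho) => //; first by apply/andP; split => //; lra.
  have -> : e ^+ 2 / kap = 4 by rewrite /kap; field; lra.
  by apply/andP; split; lra.
have A0 := ae_unbounded p_gt0 p_lt1 mU mB PU PB indepUB a_gt0 aS.
apply: filterS3 A0 (filterI (A1 false) (A1 true)) (filterI (A2 false) (A2 true)).
move=> w unb [[K1 h1] [K2 h2]] [[K3 h3] [K4 h4]].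
have [h0 _ hh0] := @near_lam R 0.
have [K5 h5] := lev_unbounded (h0 + 2) r1.
pose K := (K1 + K2 + K3 + K4 + K5)%N.
have [N hN] := unb (lev rho K); exists N => n m /andP[Nn nm].
have Hn : (lev rho K <= Hw w n)%N := leq_trans hN (Hn_mono _ _ Nn).
have exj : exists j, (Hw w n < lev rho j)%N.
  by have [J hJ] := lev_unbounded (Hw w n).+1 r1; exists J; exact: hJ.
case: (ex_minnP exj) => j jlt jmin.
case: j jlt jmin => [|k] jlt jmin.
  have : (lev rho 0 <= lev rho K)%N.
    rewrite ltnS le_truncn// expr0 exprn_ege1// ltW//.
  by move=> l0; have := leq_trans l0 Hn; rewrite leqNgt jlt.
have hk : (lev rho k <= Hw w n)%N.
  by rewrite leqNgt; apply/negP => /jmin; rewrite ltnn.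
have Kk : (K <= k)%N.
  rewrite leqNgt; apply/negP => kK.
  have : (lev rho k.+1 <= lev rho K)%N.
    by rewrite ltnS le_truncn// ler_weXn2l// ltW.
  by move=> l0; have := leq_trans l0 Hn; rewrite leqNgt jlt.
set h := lev rho k in hk.
have h_ge : (h0 + 2 <= h)%N by apply: h5; rewrite (leq_trans _ Kk)// leq_addl.
have h00 : (0 < h)%N by [].
have [t tn ft] := first_timeP h00 hk.
have Ht : Hw w t = h by case/andP: ft => /eqP.
have tm : (t <= m)%N := leq_trans tn nm.
have hR : 0 < h%:R :> R by rewrite ltr0n.
have Hnr : (Hw w n)%:R <= rho * h%:R :> R.
  have r0 : 0 <= rho by lra.
  apply: le_trans (lt_lev r0 jlt) _; rewrite exprS ler_wpM2l//.
  exact/ltW/lev_gt.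
have HnR : 0 < (Hw w n)%:R :> R by rewrite ltr0n (leq_trans h00 hk).
have [q1 q2 q3 q4] : [/\ (K1 <= k)%N, (K2 <= k)%N, (K3 <= k)%N & (K4 <= k)%N].
  by move: Kk; rewrite /K; clear; split; lia.
have u1 := h1 k q1 t ft m tm.
have u2 := h2 k q2 t ft m tm.
have u3 := h3 k q3 t ft n tn.
have u4 := h4 k q4 t ft n tn.
have kH : (1 - kap) * (Hw w n)%:R <= h%:R.
  apply: (@le_trans _ _ ((1 - kap) * (rho * h%:R))); first by rewrite ler_pM2l.
  by rewrite /rho mulrA divff ?mul1r// gt_eqF.
move: u1 u2 u3 u4; rewrite /devU -/h subrr mul0r ler0n kH !andbT -!ltNge expr0 expr1 !mulN1r !mul1r.
set x := ell a m _; set y := ell a n _; set z := ell a t _.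
rewrite -!mulrA; set f := phi h%:R / h%:R => u1 u2 u3 u4.
have f0 : 0 <= f by rewrite divr_ge0 ?phi_ge0.
have ff : f <= rho * (phi (Hw w n)%:R / (Hw w n)%:R).
  have pp : phi h%:R <= phi (Hw w n)%:R :> R.
    apply: phi_mono; [|by rewrite ler_nat|apply: hh0 => /=].
      by rewrite ltr1n; apply: leq_trans h_ge; rewrite addn2.
    by apply: leq_trans h_ge; rewrite leq_addr.
  apply: (@le_trans _ _ (phi (Hw w n)%:R / h%:R)); first by rewrite ler_pM2r ?invr_gt0.
  rewrite [leRHS]mulrCA ler_wpM2l ?phi_ge0//.
  by rewrite ler_pdivlMr// mulrC ler_pdivrMr.
have g0 : 0 <= phi (Hw w n)%:R / (Hw w n)%:R :> R by rewrite divr_ge0 ?phi_ge0.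
move: ff g0; set g := phi (Hw w n)%:R / _ => ff g0.
have : (1 + 2 * e) * f <= (1 + 4 * e) * g.
  apply: (@le_trans _ _ ((1 + 2 * e) * ((1 + e) * g))).
    rewrite ler_wpM2l//; first by lra.
    by apply: le_trans ff _; rewrite ler_wpM2r.
  by rewrite mulrA ler_wpM2r//; nra.
by move=> fg; rewrite ler_norml; apply/andP; split; lra.
Qed.

End AlmostSureUpper.

(** * Growth of the chain compared with time *)

Section Growth.
Variables (R : realType) (p : R).
Hypotheses (p_gt0 : 0 < p) (p_lt1 : p < 1).
Variable a : nat -> R.
Hypothesis a_gt0 : forall n, (0 < n)%N -> 0 < a n.
Hypothesis aS : forall n, (0 < n)%N -> a n.+1 = a n * (1 + p / n%:R).

Lemma ln_a_le n : (1 < n)%N -> ln (a n) <= ln (a 2%N) + p * ln n%:R.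
Proof.
move=> n1; have /andP[_ r2] := ln_a_ratio p_gt0 p_lt1 a_gt0 aS (n := 2) (m := n) n1.
suff H m : (0 < m)%N -> Lsum p 2 m.+1 <= p * ln m%:R.
  have := H n.-1 ltac:(by case: n n1 {r2} => [|[]]).
  rewrite prednK ?(ltnW n1)// => le1.
  have : p * ln (n.-1)%:R <= p * ln n%:R.
    rewrite ler_pM2l// ler_ln ?posrE ?ltr0n ?ler_nat ?leq_pred ?(ltnW n1)//.
    by case: n n1 {r2 le1} => [|[]].
  lra.
elim: m => [//|[|m] IH] _; first by rewrite /Lsum big_geq// ln1 mulr0.
rewrite /Lsum big_nat_recr//=; apply: (le_trans (lerD (IH isT) (lexx _))).
rewrite -mulrDr ler_pM2l//.
have := @ln_succ_ge R m.+1%:R ltac:(by rewrite ltr0n).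
by rewrite natr1 -lerBrDr.
Qed.

(** [H n] is at most of order [a n], hence of order [n^p], and [p < 1] leaves a power of [n] to
    absorb the logarithm. This provides the condition under which [hit_devL] applies. *)
Lemma level_growth (H : nat -> nat) (C : R) :
  (forall n, (0 < n)%N -> (0 < H n <= n)%N) ->
  (\forall n \near \oo, ell a n (H n) <= C) ->
  \forall n \near \oo, (H n)%:R * ln (H n)%:R <= n%:R :> R.
Proof.
move=> Hn hC; pose C' := C + ln (a 2%N).
(* Half of the spare exponent [1 - p] pays for the constant [C'], the other half for [ln (ln n)]. *)
have q0 : 0 < (1 - p) / 2 by rewrite divr_gt0// subr_gt0.
near=> n.
have n1 : (1 < n)%N by near: n; exists 2%N.
have n0 : (0 < n)%N := ltnW n1.
have n0R : 0 < n%:R :> R by rewrite ltr0n.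
have /andP[H0 Hle] := Hn n n0.
have H0R : 0 < (H n)%:R :> R by rewrite ltr0n.
have HleR : (H n)%:R <= n%:R :> R by rewrite ler_nat.
have eC : ell a n (H n) <= C by near: n.
have l1 : 2 / ((1 - p) / 2) + 1 <= lam (n%:R : R) by near: n; exact: near_lam.
have l2 : ln (Num.max 1 (`|C'| / ((1 - p) / 2))) <= lam (n%:R : R) by near: n; exact: near_lam.
have t0 : 0 < 2 / ((1 - p) / 2) by rewrite divr_gt0.
have ln1 : 1 < ln (n%:R : R) by apply: ln_gt1_lam; [exact: ltW|lra].
have c1 : `|C'| <= (1 - p) / 2 * ln n%:R.
  rewrite mulrC -ler_pdivrMr//.
  move: l2; rewrite ler_ln ?posrE//; last 2 first.
  - by rewrite lt_max ltr01.
  - by rewrite (lt_trans ltr01).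
  by rewrite ge_max => /andP[].
have c2 : lam (n%:R : R) <= (1 - p) / 2 * ln n%:R.
  have := @expR_ge1Dxn R (lam n%:R) 1 ltac:(lra).
  have -> : expR (lam (n%:R : R)) = ln n%:R by rewrite lnK// posrE (lt_trans ltr01).
  rewrite (_ : 2`!%:R = 2 :> R)//.
  set l := lam _ in l1 *; set q := (1 - p) / 2 in q0 l1 t0 * => le.
  have : 2 <= l * q by rewrite -ler_pdivrMr//; lra.
  have : q * (1 + l ^+ 2 / 2) <= q * ln n%:R by rewrite ler_pM2l.
  nra.
have lH : ln (H n)%:R <= C' + p * ln n%:R.
  by move: eC; rewrite /ell /C'; have := ln_a_le n1; lra.
have lH2 : ln (H n)%:R <= ln n%:R :> R by rewrite ler_ln.
apply: (@le_trans _ _ (expR (C' + p * ln n%:R) * ln n%:R)).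
  rewrite ler_pM ?ln_ge0 ?ler1n//.
  by rewrite -[leLHS]lnK ?posrE// ler_expR.
have -> : expR (C' + p * ln n%:R) * ln n%:R = expR (C' + p * ln n%:R + lam n%:R).
  by rewrite [RHS]expRD; congr (_ * _); rewrite lnK// posrE (lt_trans ltr01).
rewrite -[leRHS]lnK ?posrE// ler_expR.
have := ler_norm C'; lra.
Unshelve. all: by end_near. Qed.

End Growth.

(** * Almost sure existence of large excursions *)

Section AlmostSureLower.
Variables (d : measure_display) (T : measurableType d) (R : realType).
Variables (P : probability T R) (p : R).
Variables (U : nat -> T -> nat) (B : nat -> T -> bool).
Hypotheses (p_gt0 : 0 < p) (p_lt1 : p < 1).
Hypothesis mU : forall n k : nat, measurable (U n @^-1` [set k]).
Hypothesis mB : forall n : nat, measurable (B n @^-1` [set true]).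
Hypothesis PU : forall n k : nat, (1 <= n)%N -> (1 <= k <= n)%N ->
  P (U n @^-1` [set k]) = (n%:R^-1)%:E.
Hypothesis PB : forall n : nat, (1 <= n)%N -> P (B n @^-1` [set true]) = p%:E.
Hypothesis indepUB : indep_UB P U B.
Variable a : nat -> R.
Hypothesis a_gt0 : forall n, (0 < n)%N -> 0 < a n.
Hypothesis aS : forall n, (0 < n)%N -> a n.+1 = a n * (1 + p / n%:R).

Local Notation Hw := (Hw U B).
Local Notation hits_level w := (first_time (U^~ w) (B^~ w)).
Local Notation cyl := (cyl U B).

Section Avoidance.
Variables (s : bool) (zeta : R) (c : nat).
Hypothesis c2 : (2 <= c)%N.

(* Level [c ^ K] is reached, and no excursion of [devL] has started from a
   level [c ^ k] with [K0 <= k < K]. *)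
Definition avoid (K0 K : nat) : set T := [set w |
  (exists n, hits_level w (c ^ K) n) /\
  forall k, (K0 <= k < K)%N -> forall n, hits_level w (c ^ k) n ->
    (c ^ k)%:R * ln (c ^ k)%:R <= n%:R :> R /\
    forall m, (n <= m)%N -> ~~ devL a s zeta c n (c ^ k) m (Hw w m)].

(** Avoidance is decided by the history up to the first time at level [c ^ K]: by the second
    conjunct of [devL], an excursion from [c ^ k] with [k < K] ends below [c ^ k.+1], hence before
    that time. *)
Lemma avoid_cyl K0 K t w w' : stops (c ^ K) t -> cyl t w -> cyl t w' ->
  avoid K0 K w -> avoid K0 K w'.
Proof.
move=> ht wt wt' [_ av].
have eqH n : (n <= size t)%N -> Hw w' n = Hw w n.
  by move=> nt; rewrite (Hw_take wt')// (Hw_take wt).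
have HK : Hw w' (size t) = (c ^ K)%N.
  by have /andP[/eqP] := stops_first ht wt'.
split; first by exists (size t); exact: stops_first ht wt'.
move=> k /andP[K0k kK] n fn.
have ck : (c ^ k.+1 <= c ^ K)%N by rewrite leq_exp2l.
have nt : (n <= size t)%N.
  have /andP[_ lt] := fn.
  have ck' : (c ^ k <= c ^ K)%N by rewrite leq_exp2l// ltnW.
  rewrite leqNgt; apply/negP => tn.
  have : (Hw w' (size t) <= Hw w' n.-1)%N by apply: Hn_mono; case: (n) tn.
  rewrite HK leqNgt; apply/negP; rewrite negbK; exact: leq_trans lt ck'.
have fn' : hits_level w (c ^ k) n.
  have /andP[e lt] := fn; rewrite /first_time -/(Hw w n) -/(Hw w n.-1).
  by rewrite -!eqH// ?e//; exact: leq_trans (leq_pred _) nt.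
have [g av'] := av k ltac:(by rewrite K0k) n fn'; split=> // m nm.
have [mt|mt] := leqP m (size t); first by rewrite eqH//; exact: av'.
apply/negP => /and3P[_ lt _].
have : (Hw w' (size t) <= Hw w' m)%N by apply: Hn_mono; exact: ltnW.
rewrite HK leqNgt; apply/negP; rewrite negbK.
by apply: leq_trans lt _; rewrite -expnS.
Qed.

Definition avoid_stops (K0 K : nat) : set (seq nat) :=
  [set t | stops (c ^ K) t /\ exists2 w, cyl t w & avoid K0 K w].

Lemma avoidE K0 K : avoid K0 K = \bigcup_(t in avoid_stops K0 K) cyl t.
Proof.
apply/seteqP; split=> w.
  move=> av; have [[n fn] _] := av; have [st ws] := first_stops fn.
  by exists (Xw U B w n) => //; split=> //; exists w.
move=> [t [ht [w' w't av]] wt]; exact: (avoid_cyl ht w't wt av).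
Qed.

Lemma measurable_avoid K0 K : measurable (avoid K0 K).
Proof.
by rewrite avoidE; apply: measurable_bigcup_seq => t; exact: measurable_cyl.
Qed.

(** Stopped histories that violate [good] contribute the empty event, because avoidance up to [K.+1]
    includes this condition at level [c ^ K]; the other ones lose at least the fraction [rho]. *)
Lemma P_avoid_step K0 K (rho : R) : (K0 <= K)%N -> 0 <= rho <= 1 ->
  (forall n, (c ^ K <= n)%N -> (c ^ K)%:R * ln (c ^ K)%:R <= n%:R :> R ->
     exists j, rho <= hit p (devL a s zeta c n (c ^ K)) j n (c ^ K)) ->
  (P (avoid K0 K.+1) <= P (avoid K0 K) * (1 - rho)%:E)%E.
Proof.
move=> K0K /andP[r0 r1] hhit.
pose good (t : seq nat) := (c ^ K)%:R * ln (c ^ K)%:R <= (size t)%:R :> R.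
pose Ev t := if good t then cyl t `\` ever U B (devL a s zeta c (size t) (c ^ K)) t else set0.
have mEv t : measurable (Ev t).
  rewrite /Ev; case: ifP => // _; apply: measurableD; first exact: measurable_cyl.
  exact: measurable_ever.
apply: (@le_trans _ _ (P (\bigcup_(t in avoid_stops K0 K) Ev t))).
  apply: le_measure; rewrite ?inE; first exact: measurable_avoid.
    exact: measurable_bigcup_seq.
  move=> w [[n fn] av].
  have h0 : (0 < c ^ K)%N by rewrite expn_gt0 (ltnW c2).
  have hle : (c ^ K <= Hw w n)%N.
    by have /andP[/eqP + _] := fn; rewrite -/(Hw w n) => ->; rewrite leq_exp2l.
  have [n' _ fn'] := first_timeP h0 hle.
  have [st ws] := first_stops fn'.
  have [g av'] := av K ltac:(by rewrite K0K ltnSn) n' fn'.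
  exists (Xw U B w n').
    split=> //; exists w => //; split; first by exists n'.
    by move=> k /andP[k0 kK]; apply: av; rewrite k0 ltnW.
  rewrite /Ev /good size_Xs g; split=> // -[_ [m nm dm]].
  by move: dm; rewrite size_Xs in nm *; rewrite (negbTE (av' m nm)).
rewrite [in leRHS]avoidE.
apply: (P_bigcup_le mU mB); first by rewrite subr_ge0.
- by move=> t t' w [ht _] [ht' _]; exact: stops_uniq ht ht'.
- by move=> t _; exact: mEv.
move=> t [ht _]; rewrite /Ev; case: ifPn => [gt|_]; last first.
  by rewrite measure0 mule_ge0// lee_fin subr_ge0.
have hsz := stops_size ht; case: (ht) => t0 bt st _.
have [j hj] := hhit _ hsz gt.
set D := devL a s zeta c (size t) (c ^ K) in hj *.
have mc := measurable_cyl mU mB t.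
have me := measurable_ever mU mB D t.
have sub : ever U B D t `<=` cyl t by move=> w [].
have -> : P (cyl t `\` ever U B D t) = (P (cyl t) - P (ever U B D t))%E.
  rewrite measureD//=; first by rewrite (setIidr sub).
  by have [x Px] := P_fin P mc; rewrite [X in (X < _)%E]Px ltry.
have := P_ever_ge mU mB PU PB indepUB D j t0 bt.
rewrite st; have [x Px] := P_fin P mc; have [y Py] := P_fin P me.
rewrite Px Py -EFinM -EFinB -EFinM !lee_fin => le1.
have x0 : 0 <= x by rewrite -lee_fin -Px measure_ge0.
have := ler_wpM2l x0 hj; rewrite mulrBr mulr1; lra.
Qed.

End Avoidance.

(** The factors [1 - 1 / (K + 1) = K / (K + 1)] telescope. *)
Lemma P_avoid_le (s : bool) (zeta : R) (c Kmin : nat) : (2 <= c)%N -> (0 < Kmin)%N ->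
  (forall K, (Kmin <= K)%N -> forall n, (c ^ K <= n)%N ->
     (c ^ K)%:R * ln (c ^ K)%:R <= n%:R :> R ->
     exists j, (K.+1%:R)^-1 <= hit p (devL a s zeta c n (c ^ K)) j n (c ^ K)) ->
  forall K0, (Kmin <= K0)%N -> forall i,
    (P (avoid s zeta c K0 (K0 + i)) <= (K0%:R / (K0 + i)%:R)%:E)%E.
Proof.
move=> c2 Kmin0 hhit K0 hK0; have K00 : (0 < K0)%N := leq_trans Kmin0 hK0.
elim=> [|i IH].
  rewrite addn0 divff ?pnatr_eq0 -?lt0n// probability_le1//.
  exact: measurable_avoid.
have Ki0 : 0 < (K0 + i)%:R :> R by rewrite ltr0n addn_gt0 K00.
rewrite addnS; apply: (@le_trans _ _ (P (avoid s zeta c K0 (K0 + i)) *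
    (1 - ((K0 + i).+1%:R)^-1)%:E)%E).
  apply: P_avoid_step => //; first exact: leq_addr.
    by rewrite invr_ge0 ler0n/= invf_le1 ?ltr0n// ler1n.
  by move=> n; apply: hhit; exact: leq_trans hK0 (leq_addr _ _).
have q0 : 0 <= 1 - ((K0 + i).+1%:R)^-1 :> R.
  by rewrite subr_ge0 invf_le1 ?ltr0n// ler1n.
apply: (@le_trans _ _ ((K0%:R / (K0 + i)%:R)%:E * (1 - ((K0 + i).+1%:R)^-1)%:E)%E).
  by apply: lee_wpmul2r => //; rewrite lee_fin.
rewrite -EFinM lee_fin -[(K0 + i).+1%:R]natr1; clear IH q0.
move: (K0 + i)%:R Ki0 => x x0.
by rewrite le_eqVlt; apply/predU1P; left; field; apply/andP; split; rewrite gt_eqF// addr_gt0.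
Qed.

Lemma ae_excursion (s : bool) (zeta : R) : 0 < zeta <= 2^-1 ->
  exists c : nat, {ae P, forall w N, exists n m, (N <= n <= m)%N /\
    devL a s zeta c n (Hw w n) m (Hw w m)}.
Proof.
move=> z01; have /andP[z0 z1] := z01.
have [c0 [h0 _ hh0]] := hit_devL p_gt0 p_lt1 a_gt0 aS z01.
pose c := (c0 + 3)%N; exists c.
have c3 : (3 <= c)%N by rewrite leq_addl.
have c2 : (2 <= c)%N := ltnW c3.
have c0R : 0 < c%:R :> R by rewrite ltr0n (ltnW c2).
have lc0 : 0 < ln (c%:R : R) by rewrite ln_gt0// ltr1n.
(* From here on [zeta / 4 * ln K] is at least [|ln (ln c)|], and since
   [lam (c ^ K) = ln K + ln (ln c)], this gives [(1 - zeta / 4) * lam (c ^ K) <= ln K]. *)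
pose Kmin := (h0 + (Num.truncn (expR (`|ln (ln (c%:R : R))| * 4 / zeta))).+1)%N.
have Kmin0 : (0 < Kmin)%N by rewrite /Kmin addnS.
have hhit K : (Kmin <= K)%N -> forall n, (c ^ K <= n)%N ->
     (c ^ K)%:R * ln (c ^ K)%:R <= n%:R :> R ->
     exists j, (K.+1%:R)^-1 <= hit p (devL a s zeta c n (c ^ K)) j n (c ^ K).
  move=> hK n cn gn.
  have K0 : (0 < K)%N := leq_trans Kmin0 hK.
  have K0R : 0 < K%:R :> R by rewrite ltr0n.
  have hcK : (h0 <= c ^ K)%N.
    by apply: leq_trans (ltnW (ltn_expl K c2)); apply: leq_trans hK; rewrite leq_addr.
  have [j hj] := hh0 _ hcK n cn gn c s (leq_addr _ _).
  exists j; apply: le_trans hj.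
  apply: (@le_trans _ _ (expR (- ln K%:R))).
    by rewrite expRN lnK ?posrE// lef_pV2 ?posrE ?ltr0n// ler_nat.
  rewrite ler_expR lerN2 natrX /lam lnXn// -[ln _ *+ _]mulr_natl lnM ?posrE//.
  have : expR (`|ln (ln (c%:R : R))| * 4 / zeta) <= K%:R.
    apply: le_trans (ltW (truncnS_gt _)) _; rewrite ler_nat.
    by apply: leq_trans hK; rewrite leq_addl.
  rewrite -[leRHS]lnK ?posrE// ler_expR ler_pdivrMr// => l1.
  have := ler_norm (ln (ln (c%:R : R))).
  have := normr_ge0 (ln (ln (c%:R : R))); move: (ln (ln _)) l1 => x.
  move: (ln _) => y; nra.
have Pav := P_avoid_le c2 Kmin0 hhit.
pose N K0 := \bigcap_i avoid s zeta c K0 (K0 + i).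
have mN K0 : measurable (N K0).
  by apply: bigcap_measurable => // i _; exact: measurable_avoid.
have null K0 : (Kmin <= K0)%N -> P (N K0) = 0%E.
  move=> hK0; have [x Px] := P_fin P (mN K0); rewrite Px; congr EFin.
  have x0 : 0 <= x by rewrite -lee_fin -Px measure_ge0.
  have K00 : (0 < K0)%N := leq_trans Kmin0 hK0.
  have xi i : x * (K0 + i)%:R <= K0%:R.
    rewrite -ler_pdivlMr ?ltr0n ?addn_gt0 ?K00// -lee_fin -Px.
    apply: le_trans (Pav K0 hK0 i); apply: le_measure; rewrite ?inE//.
      exact: measurable_avoid.
    exact: bigcap_inf.
  apply/eqP; rewrite eq_le x0 andbT leNgt; apply/negP => xpos.
  have := xi (Num.truncn (K0%:R / x)).+1; rewrite natrD mulrDr.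
  have : K0%:R < x * (Num.truncn (K0%:R / x)).+1%:R.
    by rewrite mulrC -ltr_pdivrMr// truncnS_gt.
  have : 0 <= x * K0%:R by rewrite mulr_ge0.
  lra.
have aeN : {ae P, forall w, forall i, ~ N (Kmin + i)%N w}.
  apply/ae_foralln => i.
  have := P_negligible (mN (Kmin + i)%N) (null _ (leq_addr _ _)).
  by apply: negligibleS => w /= /contrapT.
have A0 := ae_unbounded p_gt0 p_lt1 mU mB PU PB indepUB a_gt0 aS.
have A1 := ae_oscillation p_gt0 p_lt1 mU mB PU PB indepUB a_gt0 aS
  (e := 2^-1) ltac:(by rewrite lexx andbT).
apply: filterS3 A0 aeN A1 => w unb notN [N1 osc] M.
have [C hC] : exists C, \forall n \near \oo, ell a n (Hw w n) <= C.
  exists (ell a N1 (Hw w N1) + (1 + 4 * 2^-1) * (phi (Hw w N1)%:R / (Hw w N1)%:R)).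
  exists N1 => // n /= Nn; have := osc N1 n ltac:(by rewrite leqnn).
  by rewrite ler_norml => /andP[_]; rewrite lerBlDl.
have Hb n : (0 < n)%N -> (0 < Hw w n <= n)%N.
  by move=> n0; rewrite Hn_gt0//= Hn_le.
have [N2 _ gr] := level_growth p_gt0 p_lt1 a_gt0 aS Hb hC.
(* A level [c ^ k] with [k >= i] is reached only after time [i], where the growth condition holds.
   Without excursions starting after [M], the path would thus lie in the null event
   [N (Kmin + i)]. *)
pose i := (M + N2)%N.
have := notN i; apply: contra_notP => none.
move=> j _; split.
  have [n hn] := unb (c ^ (Kmin + i + j))%N.
  have c0' : (0 < c ^ (Kmin + i + j))%N by rewrite expn_gt0 (ltnW c2).
  have [t _ ft] := first_timeP c0' hn.
  by exists t.
move=> k /andP[k1 k2] n fn.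
have Hn : Hw w n = (c ^ k)%N by case/andP: fn => /eqP.
have kn : (k <= n)%N.
  apply: leq_trans (Hn_le (U^~ w) (B^~ w) n); rewrite -/(Hw w n) Hn.
  exact: ltnW (ltn_expl k c2).
have in_ : (i <= n)%N := leq_trans (leq_trans (leq_addl _ _) k1) kn.
split; first by have := gr n (leq_trans (leq_addl _ _) in_); rewrite /= Hn.
move=> m nm; apply/negP => dv; apply: none; exists n, m; split.
  by rewrite nm andbT (leq_trans (leq_addr _ _) in_).
by rewrite Hn.
Qed.

End AlmostSureLower.

(** * From path bounds to the limits superior *)

Section Path.
Variable R : realType.

Lemma limn_esup_eq1 (u : nat -> R) :
  (forall e, 0 < e -> \forall n \near \oo, u n <= 1 + e) ->
  (forall e, 0 < e -> forall N, exists2 n, (N <= n)%N & 1 - e <= u n) ->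
  limn_esup (fun n => (u n)%:E) = 1%E.
Proof.
move=> up lo; rewrite limn_esup_lim.
apply/eqP; rewrite eq_le; apply/andP; split.
  apply/lee_addgt0Pr => e e0; rewrite -EFinD.
  apply: lime_le; first exact: is_cvg_esups.
  have [N _ hN] := up e e0; exists N => // n /= Nn.
  by apply: ub_ereal_sup => _ [m /= nm <-]; rewrite lee_fin hN//= (leq_trans Nn).
apply/lee_addgt0Pr => e e0; rewrite -leeBlDr// -EFinB.
apply: lime_ge; first exact: is_cvg_esups.
apply: nearW => N; have [n Nn hn] := lo e e0 N.
by apply: le_trans (ereal_sup_ubound _); last (exists n => //); rewrite lee_fin.
Qed.

(** After squaring, the factor [(1 + e)^2] is shared between [y <= (1 + e) * x] and
    [lam y <= lam x + e <= (1 + e) * lam x]. *)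
Lemma phi_scale (e x y : R) : 0 < e -> 1 < x -> 1 <= lam x -> 1 < y ->
  0 <= lam y -> y <= (1 + e) * x -> phi y <= (1 + e) * phi x.
Proof.
move=> e0 x1 lx y1 ly yx.
have e1 : 0 <= 1 + e by lra.
have x0 : 0 < x by lra.
have y0 : 0 < y by lra.
have lnx : 1 < ln x by apply: ln_gt1_lam; lra.
rewrite -(ler_pXn2r (n := 2))// ?nnegrE ?mulr_ge0 ?phi_ge0//.
rewrite exprMn !sqr_phi; [|lra..].
have lxy : lam y <= (1 + e) * lam x.
  have l1 : ln y <= ln x * (1 + e).
    apply: (@le_trans _ _ (ln ((1 + e) * x))).
      by rewrite ler_ln ?posrE ?mulr_gt0//; lra.
    rewrite lnM ?posrE//; last by lra.
    have := @le_ln1Dx R e ltac:(lra); nra.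
  apply: (@le_trans _ _ (ln (ln x * (1 + e)))).
    by rewrite ler_ln ?posrE ?mulr_gt0 ?ln_gt0//; lra.
  rewrite lnM ?posrE; [|lra..].
  have := @le_ln1Dx R e ltac:(lra); rewrite -/(lam x); nra.
have -> : (1 + e) ^+ 2 * (2 * x * lam x) = 2 * ((1 + e) * x) * ((1 + e) * lam x) by ring.
apply: ler_pM => //; first by rewrite mulr_ge0 ?(ltW y0).
by rewrite ler_pM2l.
Qed.

Variables (a : nat -> R) (H : nat -> nat).
Hypothesis a_gt0 : forall n, (0 < n)%N -> 0 < a n.
Hypothesis H_gt0 : forall n, (0 < n)%N -> (0 < H n)%N.
Hypothesis H_mono : forall n m, (n <= m)%N -> (H n <= H m)%N.
Hypothesis H_unb : forall h, exists n, (h <= H n)%N.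
Hypothesis osc : forall e : R, 0 < e <= 2^-1 -> exists N, forall n m, (N <= n <= m)%N ->
     `|ell a m (H m) - ell a n (H n)| <= (1 + 4 * e) * (phi (H n)%:R / (H n)%:R).

Let l_ n := ell a n (H n).
Let psi n : R := phi (H n)%:R / (H n)%:R.

Lemma near_H (Q : nat -> Prop) : (\forall h \near \oo, Q h) -> \forall n \near \oo, Q (H n).
Proof.
move=> [h0 _ hQ]; have [N hN] := H_unb h0; exists N => // n /= Nn.
by apply: hQ => /=; exact: leq_trans hN (H_mono Nn).
Qed.

Lemma near_psi (e : R) : 0 < e -> \forall n \near \oo, psi n <= e.
Proof.
move=> e0; near=> n.
have H0 : 0 < (H n)%:R :> R.
  by near: n; apply: (@near_H (fun h => 0 < (h%:R : R))); exists 1%N => // h /=; rewrite ltr0n.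
rewrite /psi ler_pdivrMr//; near: n.
by apply: (@near_H (fun h => phi (h%:R : R) <= e * h%:R)); exact: near_phi_le.
Unshelve. all: by end_near. Qed.

Lemma cvg_ell : cvgn l_.
Proof.
apply: cauchy_cvg; apply: cauchy_exP => e e0.
have h01 : 0 < (2^-1 : R) <= 2^-1 by rewrite lexx invr_gt0 ltr0n.
have [N hN] := osc h01.
have [N' _ hN'] := near_psi (e := e / 4) ltac:(by rewrite divr_gt0).
exists (l_ (N + N')%N); exists (N + N')%N => // m /= Nm.
rewrite /ball/= distrC; have := hN (N + N')%N m ltac:(by rewrite leq_addr).
have := hN' (N + N')%N (leq_addl _ _); rewrite /= -/(psi _) => h1 /le_lt_trans; apply.
have -> : 1 + 4 * 2^-1 = 3 :> R by field.
lra.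
Qed.

Let l := limn l_.

Lemma ell_lim (e : R) : 0 < e <= 2^-1 ->
  \forall n \near \oo, `|l_ n - l| <= (1 + 4 * e) * psi n.
Proof.
move=> /osc[N hN]; exists N => // n /= Nn.
have cv : (fun m => `|l_ m - l_ n|) @ \oo --> `|l - l_ n|.
  by apply: cvg_norm; apply: cvgB; [exact: cvg_ell|exact: cvg_cst].
rewrite distrC -(cvg_lim _ cv)//; apply: limr_le.
  by apply/cvg_ex; exists `|l - l_ n|.
by exists n => // m /= nm; apply: hN; rewrite Nn.
Qed.

Let W := expR l.

Lemma HaE n : (0 < n)%N -> (H n)%:R / a n = expR (l_ n).
Proof.
move=> n0; have H0 : 0 < (H n)%:R :> R by rewrite ltr0n H_gt0.
by rewrite /l_ /ell expRD expRN !lnK ?posrE// a_gt0.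
Qed.

Lemma cvg_Ha : (fun n => (H n)%:R / a n) @ \oo --> W.
Proof.
have : (expR \o l_) @ \oo --> W.
  by apply: continuous_cvg; [exact: continuous_expR|exact: cvg_ell].
apply: cvg_trans; apply: near_eq_cvg.
by exists 1%N => // n /= n0; rewrite HaE.
Qed.

Let D n := l_ n - l.

(** Consequently [H - W a = H * (1 - exp (- D))], about [H * D], and the normalized ratio of the
    theorem is [D / psi] up to factors close to 1. *)
Lemma WaE n : (0 < n)%N -> W * a n = (H n)%:R * expR (- D n).
Proof.
move=> n0; have an := a_gt0 n0.
have e : (H n)%:R = expR (l_ n) * a n by rewrite -HaE// divfK// gt_eqF.
by rewrite e mulrAC -expRD /D opprB addrC subrK.
Qed.

Let ratio n := ((H n)%:R - W * a n) / phi (W * a n).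

Lemma psi_ge0 n : 0 <= psi n.
Proof. by rewrite /psi divr_ge0 ?phi_ge0. Qed.

Lemma expR_bounds (x : R) : `|x| <= 2^-1 ->
  [/\ expR (- x) <= 1 + 2 * `|x|, expR x <= 1 + 2 * `|x| &
      `|1 - expR (- x)| <= `|x| * (1 + 2 * `|x|)].
Proof.
have key (y : R) : `|y| <= 2^-1 -> expR y <= 1 + 2 * `|y|.
  move=> hy; have y0 := normr_ge0 y.
  have y1 : 0 < 1 - `|y| by lra.
  apply: (@le_trans _ _ (expR `|y|)); first by rewrite ler_expR ler_norm.
  have := expR_ge1Dx (- `|y|); rewrite expRN => h.
  apply: (@le_trans _ _ (1 - `|y|)^-1); last first.
    by rewrite -[leLHS]mul1r ler_pdivrMr//; nra.
  rewrite -[leLHS]invrK lef_pV2 ?posrE ?invr_gt0 ?expR_gt0//.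
move=> hx; have hx' : `|- x| <= 2^-1 by rewrite normrN.
have k1 := key _ hx'; have k2 := key _ hx; rewrite normrN in k1.
split=> //.
have a1 := expR_ge1Dx (- x).
have a2 : expR (- x) - 1 <= - x * expR (- x).
  have := expR_ge1Dx x; have E0 := expR_gt0 (- x).
  move=> /(ler_wpM2r (ltW E0)); rewrite -expRD subrr expR0; lra.
have n0 := normr_ge0 x; have n1 := ler_norm x; have n2 := ler_norm (- x).
rewrite normrN in n2.
have E0 := expR_gt0 (- x).
have : - x * expR (- x) <= `|x| * (1 + 2 * `|x|).
  apply: (@le_trans _ _ (`|x| * expR (- x))); first by rewrite ler_pM2r.
  by rewrite ler_wpM2l.
have : `|x| * 1 <= `|x| * (1 + 2 * `|x|) by rewrite ler_wpM2l//; lra.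
by move=> b1 b2; rewrite ler_norml; apply/andP; split; lra.
Qed.

Lemma near_D (e : R) : 0 < e -> \forall n \near \oo, `|D n| <= e.
Proof.
move=> e0; near=> n.
have h1 : `|D n| <= (1 + 4 * 2^-1) * psi n.
  by near: n; apply: ell_lim; rewrite lexx invr_gt0 ltr0n.
have h2 : psi n <= e / 3 by near: n; apply: near_psi; rewrite divr_gt0.
apply: (le_trans h1); have -> : 1 + 4 * 2^-1 = 3 :> R by field.
lra.
Unshelve. all: by end_near. Qed.

Lemma near_phiW (e : R) : 0 < e <= 4^-1 -> \forall n \near \oo,
  [/\ 0 < phi (W * a n), 0 < phi (H n)%:R :> R,
     phi (W * a n) <= (1 + 2 * e) * phi (H n)%:R &
     phi (H n)%:R <= (1 + 2 * e) * phi (W * a n)].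
Proof.
move=> /andP[e0 e1]; have e2 : 0 < 2 * e by lra.
near=> n.
have n0 : (0 < n)%N by near: n; exists 1%N.
have hD : `|D n| <= e by near: n; exact: near_D.
have hD2 : `|D n| <= 2^-1 by lra.
have [b1 b2 _] := expR_bounds hD2.
pose X := expR (expR 1) + 2 : R.
have hX : 2 * X <= (H n)%:R.
  by near: n; apply: (@near_H (fun h => 2 * X <= h%:R)); exact: near_ge.
have X1 : 1 < X by rewrite /X; have := expR_gt0 (expR 1 : R); lra.
have XX : expR (expR 1) <= X by rewrite /X; lra.
have lamX (x : R) : X <= x -> 1 <= lam x.
  by move=> hx; apply: lam_ge; exact: le_trans hx.
rewrite WaE//; set x : R := (H n)%:R in hX *; set y := x * expR (- D n).
have x0 : 0 < x by lra.
have xy : x = y * expR (D n) by rewrite /y -mulrA -expRD addNr expR0 mulr1.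
have E0 := expR_gt0 (- D n).
have y0 : 0 < y by rewrite mulr_gt0.
have yx : y <= (1 + 2 * e) * x.
  by rewrite mulrC ler_pM2l//; apply: le_trans b1 _; lra.
have xy' : x <= (1 + 2 * e) * y.
  by rewrite [leLHS]xy mulrC ler_pM2r//; apply: le_trans b2 _; lra.
have yX : X <= y.
  have : (1 + 2 * e) * y <= 2 * y by rewrite ler_pM2r//; lra.
  lra.
have xX : X <= x by lra.
have lx := lamX _ xX; have ly := lamX _ yX.
have lx0 := lt_le_trans ltr01 lx; have ly0 := lt_le_trans ltr01 ly.
have y1 := lt_le_trans X1 yX; have x1 := lt_le_trans X1 xX.
by split; [exact: phi_gt0|exact: phi_gt0
  |apply: phi_scale => //; exact: ltW|apply: phi_scale => //; exact: ltW].
Unshelve. all: by end_near. Qed.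

Lemma ratio_upper (e : R) : 0 < e <= 8^-1 -> \forall n \near \oo, `|ratio n| <= 1 + 20 * e.
Proof.
move=> e01; have /andP[e0 e1] := e01; near=> n.
have n0 : (0 < n)%N by near: n; exists 1%N.
have H0 : 0 < (H n)%:R :> R by rewrite ltr0n H_gt0.
have hD : `|D n| <= e by near: n; exact: near_D.
have hD2 : `|D n| <= 2^-1 by lra.
have [_ _ b3] := expR_bounds hD2.
have hd : `|D n| <= (1 + 4 * e) * psi n.
  by near: n; apply: ell_lim; apply/andP; split; lra.
have [f1 f2 f3 f4] : [/\ 0 < phi (W * a n), 0 < phi (H n)%:R :> R,
     phi (W * a n) <= (1 + 2 * e) * phi (H n)%:R &
     phi (H n)%:R <= (1 + 2 * e) * phi (W * a n)].
  by near: n; apply: near_phiW; apply/andP; split; lra.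
rewrite /ratio normrM normfV (gtr0_norm f1) ler_pdivrMr//.
have -> : (H n)%:R - W * a n = (H n)%:R * (1 - expR (- D n)).
  by rewrite WaE// mulrBr mulr1.
rewrite normrM (gtr0_norm H0).
have t0 : 0 <= 1 + 4 * e by lra.
have t1 : 0 <= 1 + 2 * e by lra.
have t2 : 0 <= 1 + 2 * `|D n| by rewrite addr_ge0// mulr_ge0.
apply: (@le_trans _ _ ((H n)%:R * ((1 + 4 * e) * psi n * (1 + 2 * e)))).
  rewrite ler_pM2l//; apply: (le_trans b3); apply: ler_pM => //.
  by lra.
have -> : (H n)%:R * ((1 + 4 * e) * psi n * (1 + 2 * e)) =
    (1 + 4 * e) * (1 + 2 * e) * phi (H n)%:R.
  by rewrite /psi; field; rewrite gt_eqF.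
apply: (@le_trans _ _ ((1 + 4 * e) * (1 + 2 * e) * ((1 + 2 * e) * phi (W * a n)))).
  by rewrite ler_wpM2l// mulr_ge0.
rewrite mulrA ler_pM2r//; nra.
Unshelve. all: by end_near. Qed.

(** [D n] is [D m] minus the increment of [ell] from [n] to [m], whence the opposite sign [~~ s]. As
    [H m >= H n / zeta^2], [psi m] is at most [2 * zeta * psi n], so that [D m] costs at most
    [6 * zeta * psi n]. *)
Lemma ratio_lower (s : bool) (zeta : R) (c : nat) : 0 < zeta <= 16^-1 ->
  (forall N, exists n m, (N <= n <= m)%N /\
     devL a (~~ s) zeta c n (H n) m (H m)) ->
  forall N, exists2 n, (N <= n)%N & 1 - 10 * zeta <= (-1) ^+ s * ratio n.
Proof.
move=> /andP[z0 z1] exc N.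
have z2 : 0 < zeta ^+ 2 by rewrite exprn_gt0.
(* Ensures [c <= H n], so that [H m <= c * H n <= H n ^ 2] and [lam (H m) <= 2 * lam (H n)]. *)
pose X : R := Num.max 2 (ln (Num.max 1 c%:R)).
have : \forall n \near \oo, [/\ (0 < n)%N, `|D n| <= zeta,
    (forall m, (n <= m)%N -> `|D m| <= 3 * psi m),
    X <= ln ((H n)%:R : R) &
    [/\ 0 < phi (W * a n), 0 < phi (H n)%:R :> R,
     phi (W * a n) <= (1 + 2 * zeta) * phi (H n)%:R &
     phi (H n)%:R <= (1 + 2 * zeta) * phi (W * a n)]].
  near=> n; split.
  - by near: n; exists 1%N.
  - by near: n; exact: near_D.
  - near: n; have h01 : 0 < (2^-1 : R) <= 2^-1 by rewrite lexx invr_gt0 ltr0n.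
    have [N1 _ h1] := ell_lim h01; exists N1 => // n /= Nn m nm.
    have := h1 m (leq_trans Nn nm); rewrite /=.
    by have -> : 1 + 4 * 2^-1 = 3 :> R by field.
  - have : expR X <= (H n)%:R.
      by near: n; apply: (@near_H (fun h => expR X <= (h%:R : R))); exact: near_ge.
    move=> h; have H0 : 0 < (H n)%:R :> R := lt_le_trans (expR_gt0 _) h.
    by rewrite -ler_expR lnK.
  - by near: n; apply: near_phiW; apply/andP; split; lra.
move=> [N1 _ h1].
have [n [m [/andP[Nn nm]]]] := exc (N + N1)%N.
have [n0 hD hDm hl [f1 f2 f3 f4]] := h1 n (leq_trans (leq_addl _ _) Nn).
move=> /and3P[d1 d2 d3]; exists n; first exact: leq_trans (leq_addr _ _) Nn.
have hDm' := hDm m nm.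
have H0 : 0 < (H n)%:R :> R by rewrite ltr0n H_gt0.
have Hm0 : 0 < (H m)%:R :> R by rewrite ltr0n H_gt0// (leq_trans n0).
have HnmR : (H n)%:R <= (H m)%:R :> R by rewrite ler_nat H_mono.
move: hl; rewrite /X ge_max => /andP[l2 lc].
have Hn1 : 1 < (H n)%:R :> R.
  by rewrite -ltr_ln ?posrE// ln1; lra.
have Hm1 : 1 < (H m)%:R :> R by apply: lt_le_trans HnmR.
have c0 : (0 < c)%N by case: (c) d2.
have c0R : 1 <= c%:R :> R by rewrite ler1n.
have lamn : 0 <= lam ((H n)%:R : R) by rewrite /lam ln_ge0//; lra.
have lamm : lam ((H m)%:R : R) <= 2 * lam (H n)%:R.
  have : (H m)%:R <= c%:R * (H n)%:R :> R by rewrite -natrM ler_nat ltnW.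
  have lc' : ln (c%:R : R) <= ln (H n)%:R by apply: le_trans lc; rewrite max_r.
  move=> hmc; have : ln ((H m)%:R : R) <= ln (H n)%:R ^+ 2.
    apply: (@le_trans _ _ (ln (c%:R * (H n)%:R))).
      by rewrite ler_ln ?posrE ?mulr_gt0//; lra.
    rewrite lnM ?posrE//; [|lra].
    move: (ln c%:R) (ln (H n)%:R) lc' l2 => u v; nra.
  move=> h; rewrite /lam; apply: (@le_trans _ _ (ln (ln (H n)%:R ^+ 2))).
    by rewrite ler_ln ?posrE ?exprn_gt0 ?ln_gt0.
  by rewrite lnXn ?ln_gt0// mulr2n; lra.
have lamm0 : 0 <= lam ((H m)%:R : R).
  by apply: le_trans lamn (lam_mono Hn1 HnmR).
have psim : psi m <= 2 * zeta * psi n.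
  rewrite /psi.
  rewrite -(ler_pXn2r (n := 2))// ?nnegrE ?mulr_ge0 ?divr_ge0 ?phi_ge0 ?(ltW z0)//.
  rewrite !exprMn !exprVn !sqr_phi//.
  have -> : 2 * (H m)%:R * lam (H m)%:R / (H m)%:R ^+ 2 = 2 * lam (H m)%:R / (H m)%:R :> R.
    by field; rewrite gt_eqF.
  have -> : 2 ^+ 2 * zeta ^+ 2 * (2 * (H n)%:R * lam (H n)%:R / (H n)%:R ^+ 2) =
     8 * lam (H n)%:R * zeta ^+ 2 / (H n)%:R :> R.
    by field; rewrite gt_eqF.
  rewrite ler_pdivrMr// mulrAC ler_pdivlMr//.
  apply: (@le_trans _ _ (2 * (2 * lam (H n)%:R) * (zeta ^+ 2 * (H m)%:R))).
    by apply: ler_pM => //; [rewrite mulr_ge0|rewrite ler_pM2l].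
  have : 0 <= lam (H n)%:R * (zeta ^+ 2 * (H m)%:R).
    by rewrite mulr_ge0// mulr_ge0// ltW.
  lra.
have psi0 := psi_ge0 n.
have key : (1 - 7 * zeta) * psi n <= (-1) ^+ s * D n.
  have e : (-1) ^+ s * D n = (-1) ^+ (~~ s) * (l_ m - l_ n) - (-1) ^+ (~~ s) * D m.
    by rewrite /D; case: (s); rewrite /= ?expr0 ?expr1; ring.
  have dm : (-1) ^+ (~~ s) * D m <= 3 * (2 * zeta * psi n).
    apply: le_trans (ler_norm _) _; rewrite normrM normr_sign mul1r.
    apply: (le_trans hDm'); rewrite ler_wpM2l//.
  move: d3; rewrite -/(l_ m) -/(l_ n) -mulrA -/(psi n) => d3.
  rewrite e; move: d3 dm; lra.
have hD2 : `|D n| <= 2^-1 by lra.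
have x0 : 0 <= (-1) ^+ s * D n by apply: le_trans key; rewrite mulr_ge0//; lra.
have x1 : (-1) ^+ s * D n <= zeta.
  by apply: le_trans (ler_norm _) _; rewrite normrM normr_sign mul1r.
have low : (1 - zeta) * ((-1) ^+ s * D n) <= (-1) ^+ s * (1 - expR (- D n)).
  set x := (-1) ^+ s * D n in x0 x1 *.
  have q : (1 - zeta) * x <= (1 - x) * x by rewrite ler_wpM2r//; lra.
  apply: (le_trans q); rewrite /x; case: (s) @x x0 x1 q; rewrite /= ?expr0 ?expr1 ?mul1r ?mulN1r.
    by have := expR_ge1Dx (- D n); nra.
  have E0 := expR_gt0 (- D n).
  have := expR_ge1Dx (D n) => /(ler_wpM2r (ltW E0)); rewrite -expRD subrr expR0.
  have := expR_ge1Dx (- D n); nra.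
have -> : (-1) ^+ s * ratio n = (-1) ^+ s * (1 - expR (- D n)) * (H n)%:R / phi (W * a n).
  by rewrite /ratio WaE//; ring.
rewrite ler_pdivlMr//.
apply: (@le_trans _ _ ((1 - zeta) * ((1 - 7 * zeta) * psi n) * (H n)%:R)); last first.
  rewrite ler_pM2r//; apply: le_trans low; rewrite ler_wpM2l//; lra.
have -> : (1 - zeta) * ((1 - 7 * zeta) * psi n) * (H n)%:R =
   (1 - zeta) * (1 - 7 * zeta) * phi (H n)%:R by rewrite /psi; field; rewrite gt_eqF.
apply: (@le_trans _ _ ((1 - 10 * zeta) * ((1 + 2 * zeta) * phi (H n)%:R))).
  rewrite ler_wpM2l//; lra.
rewrite mulrA ler_pM2r//; nra.
Unshelve. all: by end_near. Qed.

Hypothesis exc : forall (s : bool) (zeta : R), 0 < zeta <= 2^-1 -> exists c,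
  forall N, exists n m, (N <= n <= m)%N /\ devL a s zeta c n (H n) m (H m).

Lemma lil_path : let W := limn (fun n => (H n)%:R / a n) in
  [/\ cvgn (fun n => (H n)%:R / a n), 0 < W,
    limn_esup (fun n => (((H n)%:R - W * a n) / phi (W * a n))%:E) = 1%E &
    limn_esup (fun n => (- (((H n)%:R - W * a n) / phi (W * a n)))%:E) = 1%E].
Proof.
have -> /= : limn (fun n => (H n)%:R / a n) = W by exact: cvg_lim cvg_Ha.
have small (e : R) : 0 < e -> exists z : R, 0 < z <= 16^-1 /\ 20 * z <= e.
  move=> e0; exists (Num.min 16^-1 (e / 20)).
  rewrite lt_min ge_min lexx divr_gt0// ?invr_gt0 ?ltr0n//=; split=> //.
  rewrite mulrC -ler_pdivlMr// ge_min lexx orbT//.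
have sgn (s : bool) : limn_esup (fun n => ((-1) ^+ s * ratio n)%:E) = 1%E.
  apply: limn_esup_eq1 => e e0; have [z [z01 ze]] := small e e0; have /andP[z0 z1] := z01.
    have : \forall n \near \oo, `|ratio n| <= 1 + 20 * z.
      by apply: ratio_upper; apply/andP; split; lra.
    apply: filterS => n hn; apply: le_trans (ler_norm _) _.
    by rewrite normrM normr_sign mul1r; lra.
  have [|c hc] := exc (~~ s) (zeta := z); first by apply/andP; split; lra.
  move=> N; have [n Nn hn] := ratio_lower z01 hc N; exists n => //.
  by apply: le_trans hn; lra.
split.
- exact: cvg_Ha.
- exact: expR_gt0.
- by have := sgn false; under eq_fun do rewrite expr0 mul1r.
- by have := sgn true; under eq_fun do rewrite expr1 mulN1r.
Qed.

End Path.

(** * The Gamma function *)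

Section GammaFunction.
Variable R : realType.
Notation mu := (@lebesgue_measure R).

Lemma continuous_powR (t x : R) : 0 < x -> {for x, continuous (fun y : R => y `^ t)}.
Proof.
move=> x0; apply: differentiable_continuous; apply/derivable1_diffP.
by apply: derivable_powR; rewrite in_itv/= andbT.
Qed.

Lemma cvg_powR_at0 (t : R) : 0 <= t -> x `^ t @[x --> 0^'+] --> 0 `^ t.
Proof.
rewrite le_eqVlt => /predU1P[<-|t0]; last first.
  by rewrite powR0 ?gt_eqF//; exact: powR_cvg0.
by under eq_fun do rewrite powRr0; rewrite powRr0; exact: cvg_cst.
Qed.

Lemma cvg_expRN_at (r x : R) : expR (- (r * y)) @[y --> x] --> expR (- (r * x)).
Proof.
apply: continuous_cvg; first exact: continuous_expR.
by apply: cvgN; apply: cvgM; [exact: cvg_cst|exact: cvg_id].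
Qed.

(** Fundamental theorem of calculus on the open half-line used by [Gamma], obtained from the closed
    one since a point is negligible. *)
Lemma integral_bnd_open (f F : R -> R) (l : R) :
  measurable_fun setT f ->
  (forall x : R, 0 <= x -> 0 <= f x) -> {within `[0, +oo[, continuous f} ->
  F x @[x --> +oo] --> l -> (forall x : R, 0 < x -> is_derive x (1 : R) F (f x)) ->
  F x @[x --> 0^'+] --> F 0 ->
  (\int[mu]_(x in `]0%R, +oo[) (f x)%:E = (l - F 0)%:E)%E.
Proof.
move=> mf f0 cf Fl dF F0.
rewrite integral_itv_obnd_cbnd; last first.
  by apply/measurable_EFinP; apply: measurable_funTS.
rewrite (@ge0_continuous_FTC2y _ f F 0 l)//.
  by move=> x x0; case: (dF x x0).
move=> x; rewrite in_itv/= andbT => x0; rewrite derive1E.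
by case: (dF x x0).
Qed.

(** Below 1 the power is at most 1; above 1 it is at most an integer power, which one term of the
    series of [exp (x / 2)] controls. This serves both for the finiteness of the integral and for
    the boundary term at infinity. *)
Lemma pow_expR_bound (t : R) : 0 <= t -> exists2 C : R, 0 <= C &
  forall x, 0 <= x -> x `^ t <= C * expR (x / 2).
Proof.
move=> t0; pose n := Num.truncn t.
pose C : R := 1 + 2 ^+ n.+1 * (n.+1)`!%:R; exists C.
  by rewrite /C addr_ge0// mulr_ge0// exprn_ge0.
move=> x x0; have e1 : 1 <= expR (x / 2).
  by have := expR_ge1Dx (x / 2); lra.
have C0 : 0 <= 2 ^+ n.+1 * (n.+1)`!%:R :> R by rewrite mulr_ge0// exprn_ge0.
have [x1|x1] := leP x 1.
  have : x `^ t <= 1.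
    have [->|xn0] := eqVneq x 0.
      by rewrite /powR eqxx; case: (t == 0).
    apply: (@le_trans _ _ (x `^ 0)); last by rewrite powRr0.
    by apply: ger_powR => //; rewrite x1 andbT lt0r xn0.
  move=> h; apply: (le_trans h); rewrite mulrDl mul1r.
  by apply: le_trans e1 _; rewrite lerDl mulr_ge0 ?expR_ge0.
have : x `^ t <= x ^+ n.+1.
  rewrite -powR_mulrn//; apply: ler_powR; first exact: ltW.
  exact/ltW/truncnS_gt.
move=> h; apply: (le_trans h).
have x20 : 0 <= x / 2 by rewrite divr_ge0.
have := expR_ge1Dxn n x20.
have f0 : 0 < (n.+1)`!%:R :> R by rewrite ltr0n fact_gt0.
have p2 : 0 < 2 ^+ n.+1 :> R by rewrite exprn_gt0.
move=> h2; have : x ^+ n.+1 / 2 ^+ n.+1 / (n.+1)`!%:R <= expR (x / 2).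
  by rewrite -expr_div_n; lra.
rewrite ler_pdivrMr// ler_pdivrMr// => h3; apply: (le_trans h3).
have -> : C * expR (x / 2) = expR (x / 2) * (n.+1)`!%:R * 2 ^+ n.+1 + expR (x / 2).
  by rewrite /C; ring.
by rewrite lerDl expR_ge0.
Qed.

Lemma cvg_pow_expR (t : R) : 0 <= t -> x `^ t * expR (- x) @[x --> +oo] --> 0.
Proof.
move=> /pow_expR_bound[C C0 hC].
have c2 : C * expR (- (x / 2)) @[x --> +oo] --> 0.
  rewrite -[X in _ --> X](mulr0 C); apply: cvgM; first exact: cvg_cst.
  apply: (@cvg_comp _ _ _ (fun x : R => x / 2) (fun x : R => expR (- x)) _ +oo).
    by apply: gt0_cvgMly.
  exact: cvgr_expR.
apply: (@squeeze_cvgr _ _ _ _ (fun=> 0) (fun x => C * expR (- (x / 2)))) => //; last exact: cvg_cst.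
near=> x; have x0 : 0 <= x by near: x; apply: nbhs_pinfty_ge; exact: num_real.
rewrite mulr_ge0 ?powR_ge0 ?expR_ge0//=.
have -> : C * expR (- (x / 2)) = C * expR (x / 2) * expR (- x).
  by rewrite -mulrA -expRD; congr (_ * expR _); field.
by rewrite ler_pM2r ?expR_gt0// hC.
Unshelve. all: by end_near. Qed.

(** [Gamma (t + 1)] before [fine], so that identities of integrals can be stated independently of
    finiteness. *)
Definition gint (t : R) : \bar R :=
  (\int[mu]_(x in `]0%R, +oo[) ((x `^ t) * expR (- x))%:E)%E.

Lemma integral_expRN (r : R) : 0 < r ->
  (\int[mu]_(x in `]0%R, +oo[) (expR (- (r * x)))%:E = (r^-1)%:E)%E.
Proof.
move=> r0.
pose F (x : R) := - (r^-1 * expR (- (r * x))).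
have dF (x : R) : 0 < x -> is_derive x (1 : R) F (expR (- (r * x))).
  move=> _; apply: is_derive_eq.
  by rewrite /GRing.scale/=; field; rewrite gt_eqF.
have mf : measurable_fun setT (fun x : R => expR (- (r * x))).
  by apply: continuous_measurable_fun => x; exact: cvg_expRN_at.
have f0 (x : R) : 0 <= x -> 0 <= expR (- (r * x)) by move=> _; exact: expR_ge0.
have cf : {within `[0, +oo[, continuous (fun x : R => expR (- (r * x)))}.
  by apply: continuous_subspaceT => x; exact: cvg_expRN_at.
have Fl : F x @[x --> +oo] --> 0.
  rewrite -[X in _ --> X]oppr0 -[X in _ --> - X](mulr0 r^-1).
  apply: cvgN; apply: cvgM; first exact: cvg_cst.
  apply: (@cvg_comp _ _ _ (fun x : R => r * x) (fun x : R => expR (- x)) _ +oo).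
    by apply: gt0_cvgMry.
  exact: cvgr_expR.
have F0 : F x @[x --> 0^'+] --> F 0.
  apply: cvg_at_right_filter; apply: cvgN; apply: cvgM; first exact: cvg_cst.
  exact: cvg_expRN_at.
rewrite (integral_bnd_open mf f0 cf Fl dF F0) /F.
by rewrite mulr0 oppr0 expR0 mulr1 sub0r opprK.
Qed.

Lemma continuous_expRN : continuous (fun x : R => expR (- x)).
Proof.
by move=> x; apply: continuous_comp; [exact: opp_continuous|exact: continuous_expR].
Qed.

Lemma measurable_pow_expR (t : R) : measurable_fun setT (fun x : R => x `^ t * expR (- x)).
Proof.
apply: measurable_funM; first exact: measurable_powR.
exact: continuous_measurable_fun continuous_expRN.
Qed.

Lemma integral_openD (f g : R -> R) :
  measurable_fun setT f -> measurable_fun setT g ->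
  (forall x, 0 < x -> 0 <= f x) -> (forall x, 0 < x -> 0 <= g x) ->
  (\int[mu]_(x in `]0%R, +oo[) (f x + g x)%:E =
   \int[mu]_(x in `]0%R, +oo[) (f x)%:E + \int[mu]_(x in `]0%R, +oo[) (g x)%:E)%E.
Proof.
move=> mf mg f0 g0; under eq_integral do rewrite EFinD.
apply: ge0_integralD => //.
- by move=> x; rewrite /= in_itv/= andbT lee_fin => /f0.
- by apply/measurable_EFinP; exact: measurable_funTS.
- by move=> x; rewrite /= in_itv/= andbT lee_fin => /g0.
- by apply/measurable_EFinP; exact: measurable_funTS.
Qed.

Lemma integral_openZ (c : R) (f : R -> R) : 0 <= c -> measurable_fun setT f ->
  (forall x, 0 < x -> 0 <= f x) ->
  (\int[mu]_(x in `]0%R, +oo[) (c * f x)%:E =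
   c%:E * \int[mu]_(x in `]0%R, +oo[) (f x)%:E)%E.
Proof.
move=> c0 mf f0; under eq_integral do rewrite EFinM.
apply: ge0_integralZl => //.
- by apply/measurable_EFinP; exact: measurable_funTS.
- by move=> x; rewrite /= in_itv/= andbT lee_fin => /f0.
Qed.

(* With [K = s ^ s], [x ^ s - s * x ^ (s - 1) + K] is nonnegative, so that the
   fundamental theorem for nonnegative functions applies to
   [- (x ^ s + K) * exp (- x)]. *)
Lemma gint_succ (s : R) : 1 <= s -> gint s = (s%:E * gint (s - 1))%E.
Proof.
move=> s1; have s0 : 0 < s by lra.
have sm0 : 0 <= s - 1 by lra.
pose K := s `^ s; have K0 : 0 < K by apply: powR_gt0.
pose f (x : R) := (x `^ s - s * x `^ (s - 1) + K) * expR (- x).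
pose F (x : R) := - ((x `^ s + K) * expR (- x)).
have mp := measurable_pow_expR.
have me : measurable_fun setT (fun x : R => expR (- x))
  by exact: continuous_measurable_fun continuous_expRN.
have mf : measurable_fun setT f.
  apply: measurable_funM => //; apply: measurable_funD => //.
  apply: measurable_funB; first exact: measurable_powR.
  by apply: measurable_funM => //; exact: measurable_powR.
have f0 (x : R) : 0 <= x -> 0 <= f x.
  move=> x0; rewrite /f mulr_ge0 ?expR_ge0//.
  have -> : x `^ s = x * x `^ (s - 1) by rewrite mulr_powRB1.
  have p0 := powR_ge0 x (s - 1).
  (* For [x >= s] the two powers already have a nonnegative difference; for [x < s] the subtracted
     one is at most [s * s ^ (s - 1) = K]. *)
  have [xs|xs] := leP s x.
    have : 0 <= (x - s) * x `^ (s - 1) by rewrite mulr_ge0// subr_ge0.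
    lra.
  have : x `^ (s - 1) <= s `^ (s - 1).
    by apply: ge0_ler_powR => //; rewrite ?nnegrE ltW.
  have -> : K = s * s `^ (s - 1) by rewrite /K mulr_powRB1// ltW.
  have : 0 <= x * x `^ (s - 1) by rewrite mulr_ge0.
  move: (x `^ _) (s `^ _) => u v; nra.
have cpow (t : R) : 0 <= t -> {within `[0, +oo[, continuous (fun x : R => x `^ t)}.
  move=> t0; apply/continuous_within_itvcyP; split; last exact: cvg_powR_at0.
  by move=> x; rewrite in_itv/= andbT => x0; exact: continuous_powR.
have cexp : {within `[0, +oo[, continuous (fun x : R => expR (- x))}.
  exact: continuous_subspaceT continuous_expRN.
have cf : {within `[0, +oo[, continuous f}.
  move=> x; apply: cvgM; last exact: cexp.
  apply: cvgD; last exact: cvg_cst.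
  apply: cvgB; first by apply: cpow; exact: ltW.
  by apply: cvgM; [exact: cvg_cst|exact: cpow].
have Fl : F x @[x --> +oo] --> 0.
  rewrite -[X in _ --> X]oppr0; apply: cvgN.
  have -> : (fun x : R => (x `^ s + K) * expR (- x)) =
      (fun x => x `^ s * expR (- x) + K * expR (- x)).
    by apply/funext => x; rewrite mulrDl.
  rewrite -[X in _ --> X]addr0 -[X in _ --> _ + X](mulr0 K).
  apply: cvgD; first by apply: cvg_pow_expR; exact: ltW.
  by apply: cvgM; [exact: cvg_cst|exact: cvgr_expR].
have dF (x : R) : 0 < x -> is_derive x (1 : R) F (f x).
  move=> x0; have d1 := is_derive1_powR s x0.
  apply: is_derive_eq.
  by rewrite /GRing.scale/= /f; ring.
have F0 : F x @[x --> 0^'+] --> F 0.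
  apply: cvgN; apply: cvgM.
    by apply: cvgD; [apply: cvg_powR_at0; exact: ltW|exact: cvg_cst].
  have := @cvg_expRN_at 1 0; rewrite mul1r => h.
  by apply: cvg_at_right_filter; under eq_fun do rewrite -[X in - X]mul1r.
have int_f := integral_bnd_open mf f0 cf Fl dF F0.
have FK : (0 - F 0 : R) = K.
  by rewrite /F powR0 ?gt_eqF// oppr0 expR0; ring.
rewrite FK in int_f.
have e0 (x : R) : 0 < x -> 0 <= expR (- x) by move=> _; exact: expR_ge0.
have int_K : (\int[mu]_(x in `]0%R, +oo[) (K * expR (- x))%:E = K%:E)%E.
  rewrite integral_openZ//; last exact: ltW.
  rewrite (_ : integral _ _ _ = 1%E) ?mule1//.
  have := integral_expRN (@ltr01 R); rewrite invr1 => <-.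
  by apply: eq_integral => x _; rewrite mul1r.
have pos (t x : R) : 0 < x -> 0 <= x `^ t * expR (- x).
  by move=> _; rewrite mulr_ge0 ?powR_ge0 ?expR_ge0.
(* Integrates [x^s e^(-x) + K e^(-x) = f x + s x^(s-1) e^(-x)], where all terms are nonnegative. The
   integrals of [f] and of [K e^(-x)] both equal [K], which is finite and cancels. *)
have sides : (gint s + K%:E = K%:E + s%:E * gint (s - 1))%E.
  rewrite -{1}int_K /gint -integral_openD//;
    [|exact: measurable_funM|exact: pos|by move=> x x0; rewrite mulr_ge0 ?e0// ltW].
  rewrite -integral_openZ//; [|exact: ltW|by move=> x; exact: pos].
  rewrite -int_f -integral_openD//; [|exact: measurable_funM
    |by move=> x x0; rewrite f0// ltW|by move=> x x0; rewrite mulr_ge0 ?pos// ltW].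
  by apply: eq_integral => x _; congr EFin; rewrite /f; ring.
move: sides; rewrite [RHS]addeC.
by move=> /(congr1 (fun z => z - K%:E)%E); rewrite !addeK.
Qed.

Lemma gint_fin (t : R) : 0 <= t -> (gint t < +oo)%E.
Proof.
move=> t0; have [C C0 hC] := pow_expR_bound t0.
have h2 : 0 < 2^-1 :> R by rewrite invr_gt0.
have me : measurable_fun setT (fun x : R => expR (- (2^-1 * x))).
  by apply: continuous_measurable_fun => x; exact: cvg_expRN_at.
have mE : measurable_fun (`]0%R, +oo[ : set R) (fun x : R => (expR (- (2^-1 * x)))%:E).
  by apply/measurable_EFinP; exact: measurable_funTS.
apply: (@le_lt_trans _ _ (\int[mu]_(x in `]0%R, +oo[) (C%:E * (expR (- (2^-1 * x)))%:E))%E).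
  apply: ge0_le_integral => //.
  - by move=> x _; rewrite lee_fin mulr_ge0 ?powR_ge0 ?expR_ge0.
  - by apply/measurable_EFinP; apply: measurable_funTS; exact: measurable_pow_expR.
  - by apply: measurable_funeM.
  - move=> x; rewrite /= in_itv/= andbT => x0; rewrite -EFinM lee_fin.
    have -> : C * expR (- (2^-1 * x)) = C * expR (x / 2) * expR (- x).
      by rewrite -mulrA -expRD; congr (_ * expR _); field.
    by rewrite ler_pM2r ?expR_gt0// hC// ltW.
rewrite ge0_integralZl//.
by rewrite integral_expRN// -EFinM ltry.
Qed.

Lemma gint_gt0 (t : R) : 0 <= t -> (0 < gint t)%E.
Proof.
move=> t0.
apply: (@lt_le_trans _ _ (\int[mu]_(x in `[1%R, 2%R]) (expR (- 2))%:E)%E).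
  rewrite integral_cst//= lebesgue_measure_itv/= lte_fin ltr1n -EFinD -EFinM lte_fin.
  by rewrite mulr_gt0 ?expR_gt0//; lra.
have sub : (`[1%R, 2%R] : set R) `<=` `]0%R, +oo[.
  by move=> x; rewrite /= !in_itv/= andbT => /andP[x1 _]; lra.
have mE : measurable_fun (`]0%R, +oo[ : set R) (fun x : R => (x `^ t * expR (- x))%:E).
  by apply/measurable_EFinP; apply: measurable_funTS; exact: measurable_pow_expR.
apply: (@le_trans _ _ (\int[mu]_(x in `[1%R, 2%R]) (x `^ t * expR (- x))%:E)%E).
  apply: ge0_le_integral => //.
  - exact: measurable_funS mE.
  - move=> x; rewrite /= in_itv/= => /andP[x1 x2]; rewrite lee_fin.
    apply: (@le_trans _ _ (1 * expR (- x))); first by rewrite mul1r ler_expR; lra.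
    have e1 : (1 : R) `^ t = 1 by rewrite powR1.
    rewrite ler_pM2r ?expR_gt0// -[leLHS]e1.
    by apply: ge0_ler_powR => //; rewrite nnegrE//; lra.
apply: ge0_subset_integral => //.
by move=> x _; rewrite lee_fin mulr_ge0 ?powR_ge0 ?expR_ge0.
Qed.

End GammaFunction.

(** * Positivity and recurrence of the normalizing sequence *)

Section Normalization.
Variable R : realType.

Lemma gint_fin_num (t : R) : 0 <= t -> gint t \is a fin_num.
Proof. by move=> t0; rewrite ge0_fin_numE ?gint_fin// ltW// gint_gt0. Qed.

Lemma Gamma_gt0 (s : R) : 1 <= s -> 0 < Gamma s.
Proof.
move=> s1; have s0 : 0 <= s - 1 by rewrite subr_ge0.
by apply: fine_gt0; rewrite gint_gt0// gint_fin.
Qed.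

Lemma Gamma_succ (s : R) : 1 <= s -> Gamma (s + 1) = s * Gamma s.
Proof.
move=> s1; have s0 : 0 <= s - 1 by rewrite subr_ge0.
have -> : Gamma (s + 1) = fine (gint s) by rewrite /gint /Gamma addrK.
by rewrite gint_succ// fineM// gint_fin_num.
Qed.

Lemma a_seq_gt0 (p : R) n : 0 < p -> (0 < n)%N -> 0 < a_seq p n.
Proof.
move=> p0 n0; have n1 : 1 <= n%:R :> R by rewrite ler1n.
by rewrite /a_seq divr_gt0 ?mulr_gt0 ?Gamma_gt0//; lra.
Qed.

Lemma a_seqS (p : R) n : 0 < p -> (0 < n)%N ->
  a_seq p n.+1 = a_seq p n * (1 + p / n%:R).
Proof.
move=> p0 n0; have n1 : 1 <= n%:R :> R by rewrite ler1n.
have G1 : 0 < Gamma (n%:R : R) by apply: Gamma_gt0.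
have G2 : 0 < Gamma (1 + p) by apply: Gamma_gt0; lra.
rewrite /a_seq -[n.+1%:R]natr1 Gamma_succ//.
have -> : n%:R + 1 + p = n%:R + p + 1 by ring.
rewrite Gamma_succ; last by lra.
move: (Gamma (n%:R + p)) G1 G2 => c; move: (Gamma _) (Gamma _) => u v u0 v0.
have n0R : 0 < n%:R :> R by rewrite ltr0n.
move: (n%:R : R) n0R => x x0 {n1}.
by field; rewrite !gt_eqF.
Qed.

End Normalization.

(** * Reduction to countably many parameters and conclusion *)

Lemma inv_nat_le (R : realType) (e : R) : 0 < e ->
  exists i : nat, (i.+2%:R)^-1 <= e :> R.
Proof.
move=> e0; exists (Num.truncn e^-1); rewrite invf_ple ?posrE ?ltr0n//.
by rewrite (le_trans (ltW (truncnS_gt _)))// ler_nat.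
Qed.

Theorem theorem2p4 (d : measure_display) (T : measurableType d)
  (R : realType) (P : probability T R) (p : R)
  (U : nat -> T -> nat) (B : nat -> T -> bool) :
  0 < p < 1 ->
  (forall n k : nat, measurable (U n @^-1` [set k])) ->
  (forall n : nat, measurable (B n @^-1` [set true])) ->
  (forall n k : nat, (1 <= n)%N -> (1 <= k <= n)%N ->
     P (U n @^-1` [set k]) = (n%:R^-1)%:E) ->
  (forall n : nat, (1 <= n)%N -> P (B n @^-1` [set true]) = p%:E) ->
  indep_UB P U B ->
  let H := fun (w : T) (n : nat) => (Hn (U^~ w) (B^~ w) n)%:R : R in
  let W := fun w : T => lim ((fun n => H w n / a_seq p n) @ \oo) in
  {ae P, forall w,
     cvgn (fun n => H w n / a_seq p n) /\ 0 < W w /\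
     limn_esup (fun n => ((H w n - W w * a_seq p n)
                          / phi (W w * a_seq p n))%:E) = 1%E /\
     limn_esup (fun n => (- ((H w n - W w * a_seq p n)
                          / phi (W w * a_seq p n)))%:E) = 1%E}.
Proof.
move=> /andP[p0 p1] mU mB PU PB ind H W.
have a0 n := @a_seq_gt0 R p n p0.
have aS n := @a_seqS R p n p0.
(* The parameters run through [1 / (i + 2)], so that one null event serves all of them; the
   oscillation bound and the excursions for one parameter imply those for any larger one. *)
have e01 i : 0 < (i.+2%:R : R)^-1 <= 2^-1.
  by rewrite invr_gt0 ltr0n/= lef_pV2 ?posrE ?ltr0n// ler_nat.
have Aosc : {ae P, forall w, forall i, exists N, forall n m, (N <= n <= m)%N ->
     `|ell (a_seq p) m (Hw U B w m) - ell (a_seq p) n (Hw U B w n)|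
        <= (1 + 4 * (i.+2%:R)^-1) * (phi (Hw U B w n)%:R / (Hw U B w n)%:R)}.
  by apply/ae_foralln => i; exact: (ae_oscillation p0 p1 mU mB PU PB ind a0 aS (e01 i)).
have Aexc s : {ae P, forall w, forall i, exists c, forall N, exists n m, (N <= n <= m)%N /\
     devL (a_seq p) s (i.+2%:R)^-1 c n (Hw U B w n) m (Hw U B w m)}.
  apply/ae_foralln => i.
  have [c hc] := ae_excursion p0 p1 mU mB PU PB ind a0 aS s (e01 i).
  by apply: filterS hc => w hw; exists c.
have Aunb := ae_unbounded p0 p1 mU mB PU PB ind a0 aS.
apply: filterS3 Aunb Aosc (filterI (Aexc false) (Aexc true)) => w unb osc [exF exT].
have osc' (e : R) : 0 < e <= 2^-1 -> exists N, forall n m, (N <= n <= m)%N ->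
     `|ell (a_seq p) m (Hw U B w m) - ell (a_seq p) n (Hw U B w n)|
        <= (1 + 4 * e) * (phi (Hw U B w n)%:R / (Hw U B w n)%:R).
  move=> /andP[/inv_nat_le[i ie] _]; have [N hN] := osc i; exists N => n m nm.
  apply: le_trans (hN n m nm) _.
  by rewrite ler_wpM2r ?divr_ge0 ?phi_ge0// lerD2l ler_pM2l.
have exc' (s : bool) (zeta : R) : 0 < zeta <= 2^-1 -> exists c,
    forall N, exists n m, (N <= n <= m)%N /\
      devL (a_seq p) s zeta c n (Hw U B w n) m (Hw U B w m).
  move=> /andP[z0 z1]; have [i ie] := inv_nat_le z0.
  have [c hc] : exists c, forall N, exists n m, (N <= n <= m)%N /\
     devL (a_seq p) s (i.+2%:R)^-1 c n (Hw U B w n) m (Hw U B w m).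
    by case: s; [exact: exT|exact: exF].
  exists c => N; have [n [m [nm /and3P[d1 d2 d3]]]] := hc N; exists n, m; split=> //.
  apply/and3P; split=> //.
    apply: (le_trans d1); rewrite ler_wpM2r// ler_pXn2r ?nnegrE ?invr_ge0 ?(ltW z0)//.
  apply: le_trans d3; rewrite -!mulrA ler_wpM2r ?divr_ge0 ?phi_ge0//.
  by rewrite lerD2l lerN2.
have [] := lil_path a0 (@Hn_gt0 (U^~ w) (B^~ w)) (@Hn_mono (U^~ w) (B^~ w)) unb osc' exc'.
by [].
Qed.
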